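(* The (pseudo-)Kähler metrics defined on some domain $U\subset\mathbb{CP}^2$ which are compatible with the standard complex projective structure on $\mathbb{CP}^2$ are in one-to-one correspondence with the hermitian forms on $\mathbb{C}^3$ whose rank is at least two. That is: every (pseudo-)Kähler metric on a (nonempty, connected, open) domain $U\subset\mathbb{CP}^2$ which is compatible with the standard complex projective structure is induced on $U$ by exactly one hermitian $3\times3$ matrix $C=C^*$ of rank at least two, and every hermitian $3\times3$ matrix of rank at least two induces such a metric on some domain $U\subset\mathbb{CP}^2$.
   Context: Standard complex projective structure. On a complex surface, a complex-linear connection is an affine torsion-free connection $\nabla$ with $\nabla J=0$; a generalised geodesic of $\nabla$ is a smoothly immersed curve $\gamma$ such that the $2$-plane spanned by $\dot\gamma$ and $J\dot\gamma$ is parallel along $\gamma$, i.e. $\nabla_{\dot\gamma}\dot\gamma\wedge\dot\gamma\wedge J\dot\gamma=0$. Two complex-linear torsion-free connections are complex projectively equivalent if they have the same generalised geodesics, and an equivalence class is a complex projective structure. The standard complex projective structure on $\mathbb{CP}^2$ is the class of the Levi-Civita connection of the Fubini–Study metric; its generalised geodesics are the smoothly immersed curves contained in linearly embedded projective lines $\mathbb{CP}^1\subset\mathbb{CP}^2$. A (pseudo-)Kähler metric on a domain $U\subset\mathbb{CP}^2$ is compatible with it if its Levi-Civita connection belongs to the restriction of this class to $U$. Metric induced by a hermitian matrix. Let $\pi:\mathrm{PSL}(3,\mathbb{C})\to\mathbb{CP}^2$, $\pi(a)=a\cdot[1,0,0]^t$, and let $\theta=a^{-1}\mathrm{d}a=(\theta^p_q)_{p,q=0,1,2}$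 be the Maurer–Cartan form ($p$ the row index, $q$ the column index). For a hermitian matrix $C=C^*$ (with ${}^*$ the conjugate transpose) define $H=a^{-1}C(a^{-1})^*$, a well-defined hermitian-matrix-valued function on $\mathrm{PSL}(3,\mathbb{C})$, with entries $H_{pq}$, $p,q\in\{0,1,2\}$, and put $h_{1\bar1}=-H_{22}$, $h_{1\bar2}=H_{21}$, $h_{2\bar1}=H_{12}$, $h_{2\bar2}=-H_{11}$. A metric $g$ on a domain $U\subset\mathbb{CP}^2$ is induced by $C$ if on $\pi^{-1}(U)$ one has $h_{1\bar1}h_{2\bar2}-|h_{1\bar2}|^2\neq0$ and $$\pi^*g=\frac{\sum_{i,j=1}^2h_{i\bar\jmath}\,\theta^i_0\circ\overline{\theta^j_0}}{\left(h_{1\bar1}h_{2\bar2}-|h_{1\bar2}|^2\right)^2},$$ where $\circ$ denotes the symmetric product of $1$-forms. *)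

(* Defs.v *)
From HB Require Import structures.
From mathcomp Require Import all_boot all_order all_algebra complex.
From mathcomp Require Import all_classical all_reals all_analysis.

Set Implicit Arguments.
Unset Strict Implicit.
Unset Printing Implicit Defensive.

Import Order.TTheory GRing.Theory Num.Theory.
Import numFieldNormedType.Exports.

Local Open Scope classical_set_scope.
Local Open Scope quotient_scope.
Local Open Scope sesquilinear_scope.
Local Open Scope ring_scope.

(* The complex projective plane: nonzero column vectors up to a nonzero
   scalar, with the quotient topology. *)

Definition C3x (R : realType) : Type :=
  set_type [set z : 'cV[(R[i] : numFieldType)]_3 | z != 0].

HB.instance Definition _ (R : realType) := Topological.on (C3x R).
HB.instance Definition _ (R : realType) := SubType.on (C3x R).

Definition same_line (R : realType) (z w : C3x R) : bool :=
  `[< exists l : R[i], l != 0 /\ val w = l *: val z >].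

Lemma same_line_equiv (R : realType) : equiv_class_of (@same_line R).
Proof.
split.
- by move=> z; apply/asboolP; exists 1; rewrite oner_eq0 scale1r.
- move=> z w; apply/asboolP/asboolP => -[l [l0 e]]; exists l^-1;
    by rewrite invr_eq0 l0 e scalerA mulVf ?scale1r.
- move=> y z w /asboolP[l [l0 e]] /asboolP[m [m0 f]]; apply/asboolP.
  by exists (m * l); rewrite f e scalerA mulf_neq0.
Qed.

Canonical same_line_rel (R : realType) := EquivRelPack (same_line_equiv R).

Definition CP2 (R : realType) : Type :=
  quotient_topology {eq_quot (@same_line R)}.

HB.instance Definition _ (R : realType) := Topological.on (CP2 R).

Lemma C3x_default_subproof (R : realType) :
  (const_mx 1 : 'cV[(R[i] : numFieldType)]_3) \in [set z | z != 0].
Proof.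
rewrite inE /=; apply/eqP => /matrixP/(_ 0 0).
by rewrite !mxE => /eqP; rewrite oner_eq0.
Qed.

Definition C3x_default (R : realType) : C3x R :=
  exist _ (const_mx 1) (C3x_default_subproof R).

(* z |-> [z]; a junk value is returned for z = 0. *)
Definition proj_pt (R : realType) (z : 'cV[R[i]]_3) : CP2 R :=
  \pi_(CP2 R) (insubd (C3x_default R) z).

(* Homogeneous coordinates, for an arbitrary choice of representative. *)
Definition hcoord (R : realType) (p : CP2 R) : 'cV[R[i]]_3 :=
  val (repr p : C3x R).

(* R^4 is identified with C^2 by (x_0, x_1, y_0, y_1) <-> (x_j + i y_j)_j. *)

Definition toC (R : realType) (x : 'rV[R]_4) : 'rV[R[i]]_2 :=
  \row_j ((x : 'rV_(2 + 2)) 0 (lshift 2 j) +i* (x : 'rV_(2 + 2)) 0 (rshift 2 j))%C.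

Definition ofC (R : realType) (w : 'rV[R[i]]_2) : 'rV[R]_4 :=
  row_mx (map_mx (@complex.Re R) w) (map_mx (@complex.Im R) w).

(* The complex structure of C^2: u *m Jmx R is i times u. *)
Definition Jmx (R : realType) : 'M[R]_4 :=
  block_mx (0 : 'M[R]_2) 1%:M (- 1%:M) 0.

(* The vector of C^3 with k-th coordinate c and remaining coordinates w. *)
Definition insert_coord (R : realType) (k : 'I_3) (c : R[i]) (w : 'rV[R[i]]_2) :
    'cV[R[i]]_3 :=
  \col_i (if unlift k i is Some j then w 0 j else c).

(* The three standard affine charts of CP^2, numbered by the coordinate that is
   normalised to 1, and their inverses. *)

Definition chart_dom (R : realType) (k : 'I_3) : set (CP2 R) :=
  [set p | hcoord p k 0 != 0].

Definition chart (R : realType) (k : 'I_3) (p : CP2 R) : 'rV[R]_4 :=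
  let z := hcoord p in ofC (\row_j (z (lift k j) 0 / z k 0)).

Definition chart_inv (R : realType) (k : 'I_3) (x : 'rV[R]_4) : CP2 R :=
  proj_pt (insert_coord k 1 (toC x)).

Definition chart_img (R : realType) (U : set (CP2 R)) (k : 'I_3) :
    set 'rV[R]_4 :=
  chart_inv k @^-1` U.

Definition transition (R : realType) (k j : 'I_3) (x : 'rV[R]_4) : 'rV[R]_4 :=
  chart j (chart_inv k x).

Definition domain (R : realType) (U : set (CP2 R)) : Prop :=
  [/\ open U, connected U & U !=set0].

(* C^infinity on an open set A: all iterated directional derivatives exist and
   are continuous on A. *)

Fixpoint Ck_on (R : realType) (V W : normedModType R) (n : nat) (A : set V)
    (f : V -> W) : Prop :=
  (forall x, A x -> {for x, continuous f}) /\
  if n is m.+1 then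
    forall v : V, (forall x, A x -> derivable f x v) /\ Ck_on m A ('D_v f)
  else True.

Definition smooth_on (R : realType) (V W : normedModType R) (A : set V)
    (f : V -> W) : Prop :=
  forall n, Ck_on n A f.

(* A covariant 2-tensor field on an open set U of CP^2 is given by its component
   matrices in the three charts; only the values of g k on chart_img U k are
   relevant. *)

Definition cotensor2 (R : realType) : Type := 'I_3 -> 'rV[R]_4 -> 'M[R]_4.

Definition bil (R : realType) (G : 'M[R]_4) (u v : 'rV[R]_4) : R :=
  (u *m G *m v^T) 0 0.

Definition is_cotensor2 (R : realType) (U : set (CP2 R)) (g : cotensor2 R) :
    Prop :=
  forall (k j : 'I_3) (x : 'rV[R]_4),
    chart_img U k x -> chart_dom j (chart_inv k x) ->
    let D := jacobian (transition k j) x in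
    g k x = D *m g j (transition k j x) *m D^T.

(* dw (u, v, w) for the 2-form w with component matrices om, on constant
   vector fields u, v, w. *)
Definition ext_deriv2 (R : realType) (om : 'rV[R]_4 -> 'M[R]_4)
    (x u v w : 'rV[R]_4) : R :=
  'D_u (fun y => bil (om y) v w) x + 'D_v (fun y => bil (om y) w u) x
  + 'D_w (fun y => bil (om y) u v) x.

(* The fundamental form g(J u, v) has component matrix Jmx *m g. *)
Definition pseudo_kahler (R : realType) (U : set (CP2 R)) (g : cotensor2 R) :
    Prop :=
  is_cotensor2 U g /\
  forall k : 'I_3, smooth_on (chart_img U k) (g k) /\
    forall x, chart_img U k x ->
      [/\ (g k x)^T = g k x,
          g k x \in unitmx,
          forall u v, bil (g k x) (u *m Jmx R) (v *m Jmx R) = bil (g k x) u v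
        & forall u v w, ext_deriv2 (fun y => Jmx R *m g k y) x u v w = 0].

(* An affine connection is given by its Christoffel forms in the three charts:
   nabla_u v = D_u v + Gamma k x u v. *)

Definition christoffel (R : realType) : Type :=
  'I_3 -> 'rV[R]_4 -> 'rV[R]_4 -> 'rV[R]_4 -> 'rV[R]_4.

(* Gamma^l_(ij) = 1/2 g^(lm) (d_i g_(jm) + d_j g_(im) - d_m g_(ij)) *)
Definition levi_civita (R : realType) (g : cotensor2 R) : christoffel R :=
  fun k x u v =>
    (\row_m (2^-1 * ('D_u (fun y => bil (g k y) v (delta_mx 0 m)) x
                     + 'D_v (fun y => bil (g k y) u (delta_mx 0 m)) x
                     - 'D_(delta_mx 0 m) (fun y => bil (g k y) u v) x)))
    *m invmx (g k x).

Definition torsion_free (R : realType) (U : set (CP2 R)) (G : christoffel R) :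
    Prop :=
  forall k x u v, chart_img U k x -> G k x u v = G k x v u.

(* nabla J = 0; J has constant components in the (holomorphic) charts. *)
Definition complex_linear (R : realType) (U : set (CP2 R))
    (G : christoffel R) : Prop :=
  forall k x u v, chart_img U k x ->
    G k x u (v *m Jmx R) = G k x u v *m Jmx R.

Definition immersed_curve (R : realType) (U : set (CP2 R)) (I : set R)
    (gamma : R -> CP2 R) : Prop :=
  [/\ open I, is_interval I,
      forall t, I t -> U (gamma t),
      forall t, I t -> {for t, continuous gamma}
    & forall k : 'I_3,
        let c := chart k \o gamma in
        let Ik := [set t | I t /\ chart_dom k (gamma t)] in
        smooth_on Ik c /\ forall t, Ik t -> derive1 c t != 0].

(* u /\ v /\ w = 0: the components of a trivector are the 3 x 3 minors. *)
Definition wedge3_eq0 (R : realType) (u v w : 'rV[R]_4) : Prop :=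
  forall f : 'I_3 -> 'I_4,
    \det (\matrix_(i < 3, j < 3) [:: u; v; w]`_i 0 (f j)) = 0.

Definition generalised_geodesic (R : realType) (G : christoffel R) (I : set R)
    (gamma : R -> CP2 R) : Prop :=
  forall (k : 'I_3) (t : R), I t -> chart_dom k (gamma t) ->
    let c := chart k \o gamma in
    let c' := derive1 c t in
    wedge3_eq0 (derive1 (derive1 c) t + G k (c t) c' c') c' (c' *m Jmx R).

Definition cproj_equiv (R : realType) (U : set (CP2 R))
    (G G' : christoffel R) : Prop :=
  forall (I : set R) (gamma : R -> CP2 R), immersed_curve U I gamma ->
    generalised_geodesic G I gamma <-> generalised_geodesic G' I gamma.

(* Fubini-Study metric: at [z], on the images of tangent vectors u, v of
   C^3 \ {0} at z, it is Re ((<z,z><u,v> - <u,z><z,v>) / <z,z>^2). *)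

Definition herm (R : realType) (z w : 'cV[R[i]]_3) : R[i] :=
  \sum_i z i 0 * (w i 0)^*.

Definition fubini_study (R : realType) : cotensor2 R := fun k x =>
  let z := insert_coord k 1 (toC x) in
  let e (a : 'I_4) := insert_coord k 0 (toC (delta_mx 0 a)) in
  \matrix_(a, b) complex.Re
    ((herm z z * herm (e a) (e b) - herm (e a) z * herm z (e b))
     / herm z z ^+ 2).

(* The Levi-Civita connection of g lies in the restriction to U of the standard
   complex projective structure. *)
Definition compatible (R : realType) (U : set (CP2 R)) (g : cotensor2 R) :
    Prop :=
  [/\ complex_linear U (levi_civita g), torsion_free U (levi_civita g)
    & cproj_equiv U (levi_civita g) (levi_civita (@fubini_study R))].

(* PSL(3,C) is represented by the matrices a with determinant 1; the vectors
   tangent to it at a are the X with a^-1 X traceless. All objects below are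
   unchanged when a and X are multiplied by a cube root of unity. *)

Definition maurer_cartan (R : realType) (a : 'M[R[i]]_3) (p q : 'I_3)
    (X : 'M[R[i]]_3) : R[i] :=
  (invmx a *m X) p q.

Definition tangentSL (R : realType) (a X : 'M[R[i]]_3) : Prop :=
  \tr (invmx a *m X) = 0.

Definition pi_SL (R : realType) (a : 'M[R[i]]_3) : CP2 R := proj_pt (col 0 a).

(* The differential of pi_SL at a, read in the chart k; as pi_SL extends to the
   matrices with nonzero first column, it can be computed along a + t X. *)
Definition dpi_SL (R : realType) (k : 'I_3) (a X : 'M[R[i]]_3) : 'rV[R]_4 :=
  derive1 (fun t : R => chart k (pi_SL (a + t%:C%C *: X))) 0.

(* Normalised so that (al o al) (X, X) = al (X) ^+ 2. *)
Definition sym_prod (T : Type) (R : realType) (al be : T -> R[i]) (X Y : T) :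
    R[i] :=
  (al X * be Y + al Y * be X) / 2.

Definition hermitian3 (R : realType) (C : 'M[R[i]]_3) : Prop := C = C ^t*.

Definition Hmx (R : realType) (C a : 'M[R[i]]_3) : 'M[R[i]]_3 :=
  invmx a *m C *m (invmx a) ^t*.

(* hmx H i j is the coefficient with indices i + 1 and (j + 1)-bar. *)
Definition hmx (R : realType) (H : 'M[R[i]]_3) : 'M[R[i]]_2 :=
  \matrix_(i, j)
    match val i, val j with
    | 0%N, 0%N => - H 2 2
    | 0%N, _ => H 2 1
    | _, 0%N => H 1 2
    | _, _ => - H 1 1
    end.

Definition induced_by (R : realType) (U : set (CP2 R)) (g : cotensor2 R)
    (C : 'M[R[i]]_3) : Prop :=
  forall a : 'M[R[i]]_3, \det a = 1 -> U (pi_SL a) ->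
    let h := hmx (Hmx C a) in
    let d := h 0 0 * h 1 1 - `|h 0 1| ^+ 2 in
    let theta (i : 'I_2) := maurer_cartan a (lift 0 i) 0 in
    d != 0 /\
    forall (k : 'I_3) (X Y : 'M[R[i]]_3), chart_dom k (pi_SL a) ->
      tangentSL a X -> tangentSL a Y ->
      (bil (g k (chart k (pi_SL a))) (dpi_SL k a X) (dpi_SL k a Y))%:C%C =
      (\sum_i \sum_j
         h i j * sym_prod (theta i) (fun Z => (theta j Z)^*) X Y) / d ^+ 2.

(* Main.v *)
(* For a hermitian matrix C put N(z; u, v) = - (z x u)^T C conj(z x v) and
   d(z) = z^* adj(C) z. On the columns of a in SL(3) these are h_(i jbar) and det h, and
   Re (N / d^2) is homogeneous of degree 0, so it descends to the induced metric; in an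
   affine chart it is G = h / d^2 with h the cofactor matrix of a hermitian 2 x 2 block H
   that is quadratic in the coordinates, and d = det H = det G^(-1/3). Differentiating d
   and N yields the Levi-Civita connection Gamma(u, v) = b(u) v + b(v) u with
   b(w) = - z^* adj(C) w / d, for every C. As the Fubini-Study metric is the case
   C = - 1, all induced metrics are compatible with the standard structure; d does not
   vanish identically exactly when the rank of C is at least two.

   Conversely, complex lines are generalised geodesics of a compatible metric g, which
   forces Gamma(u, v) = b(u) v + b(v) u for a complex-valued 1-form b. Then
   the cofactors of the hermitian 2 x 2 matrix of g, multiplied by the power -2/3 of its
   determinant, form a hermitian matrix tau with D_w tau = w r^* + r w^* for some r.
   Equality of mixed partial derivatives gives D_w r = mu w with a constant mu, so that
   tau is a quadratic polynomial, namely - H for a unique C. Since g determines H and H on an open set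
   determines C, the local matrices agree on the connected set U. *)

Require Import Defs.
From mathcomp Require Import all_boot all_order all_algebra complex.
From mathcomp Require Import all_classical all_reals all_analysis.
From mathcomp Require Import ring lra.

Set Implicit Arguments.
Unset Strict Implicit.
Unset Printing Implicit Defensive.

Import Order.TTheory GRing.Theory Num.Theory.
Import numFieldNormedType.Exports.

Local Open Scope classical_set_scope.
Local Open Scope quotient_scope.
Local Open Scope sesquilinear_scope.
Local Open Scope ring_scope.

(** * Smooth functions of several real variables *)

(** Why every [C] gives a connection of the same shape: let ξ be the row z^* adj(C). Then ξ(z) w × u
    - ξ(w) z × u + ξ(u) z × w = det(z, w, u) ξ^T, and the right side pairs to zero with z × v under
    [C], because adj(C) C is the scalar det C and z is orthogonal to z × v. Differentiating N
    replaces one z by w, and this identity brings the result back to values of N.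

    The power -2/3 comes from D_v log det = 6 Re b(v) for the hermitian matrix of g, while its
    diagonal entry s1 has derivative 4 p_0 s1 along x_0, where p_0 = Re b(e_0): the square of
    det^(-1/3) contributes exactly -4 p_0 and cancels it. The metric may be indefinite, so the cube
    root has to be odd.

    The vector r is first known only pointwise; before it can be differentiated it has to be read
    off from first derivatives of tau, which makes it smooth.

    That g determines H rests on the same power: the determinant of the hermitian matrix of g is
    d^(-3), and cubing is injective on the reals.

    Smoothness is expressed by real directional derivatives and all functions involve conjugates, so
    the calculus is done on real and imaginary parts. *)

Lemma near_eq_continuous (T U : topologicalType) (f g : T -> U) (x : T) :
  (\near x, f x = g x) -> {for x, continuous f} -> {for x, continuous g}.
Proof.
move=> e cf; rewrite /prop_for /continuous_at -(nbhs_singleton e).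
exact: cvg_trans (near_eq_cvg e) cf.
Qed.

Section Ck.
Variables (R : realType) (V : normedModType R).
Implicit Types (A : set V).

Lemma open_near A (x : V) : open A -> A x -> \near x, A x.
Proof. by rewrite openE => oA /oA. Qed.

Lemma Ck_on_ext (W : normedModType R) n A (f g : V -> W) :
  open A -> (forall x, A x -> f x = g x) -> Ck_on n A f -> Ck_on n A g.
Proof.
move=> oA; elim: n f g => [|n IH] f g fg /= [cf df]; split => //.
- move=> x Ax; apply: near_eq_continuous (cf _ Ax).
  by near=> y; apply: fg; near: y; exact: open_near.
- move=> x Ax; apply: near_eq_continuous (cf _ Ax).
  by near=> y; apply: fg; near: y; exact: open_near.
move=> v; have [dfv Cf] := df v; split.
  move=> x Ax; apply: near_eq_derivable (dfv _ Ax).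
  by near=> y; apply: fg; near: y; exact: open_near.
apply: IH Cf => x Ax; apply: near_eq_derive.
by near=> y; apply: fg; near: y; exact: open_near.
Unshelve. all: by end_near. Qed.

Lemma Ck_onW (W : normedModType R) n A (f : V -> W) :
  Ck_on n.+1 A f -> Ck_on n A f.
Proof.
elim: n f => [|n IH] f [cf df]; split => //.
by move=> v; have [dfv /IH] := df v.
Qed.

Lemma Ck_on_sub (W : normedModType R) n A B (f : V -> W) :
  B `<=` A -> Ck_on n A f -> Ck_on n B f.
Proof.
move=> BA; elim: n f => [|n IH] f [cf df]; split => //; try by move=> x /BA/cf.
by move=> v; have [dfv Cf] := df v; split=> [x /BA/dfv//|]; exact: IH.
Qed.

Lemma Ck_on_cst (W : normedModType R) n A (c : W) : Ck_on n A (fun _ : V => c).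
Proof.
elim: n c => [|n IH] c; split=> //; try by move=> x _; exact: cst_continuous.
move=> v; split=> [x _|]; first exact: derivable_cst.
rewrite (_ : 'D_v _ = fun _ => 0); first exact: IH.
by apply/funext => x; rewrite derive_cst.
Qed.

(** The derivative depends on the direction only, so all further derivatives vanish. *)
Lemma Ck_on_lin n A (f : V -> R) (df : V -> R) :
  continuous f -> (forall x v, is_derive x v f (df v)) -> Ck_on n A f.
Proof.
move=> cf dfE; case: n => [|n]; split=> //; try by move=> x _; exact: cf.
move=> v; split=> [x _|]; first by have [] := dfE x v.
rewrite (_ : 'D_v _ = fun _ => df v); first exact: Ck_on_cst.
by apply/funext => x; have [_ ->] := dfE x v.
Qed.

Lemma Ck_onD n A (f g : V -> R) : open A ->
  Ck_on n A f -> Ck_on n A g -> Ck_on n A (fun x => f x + g x).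
Proof.
move=> oA; elim: n f g => [|n IH] f g [cf df] [cg dg]; split => //.
- by move=> x Ax; apply: continuousD; [exact: cf|exact: cg].
- by move=> x Ax; apply: continuousD; [exact: cf|exact: cg].
move=> v; have [dfv Cf] := df v; have [dgv Cg] := dg v; split.
  by move=> x Ax; apply: derivableD; [exact: dfv|exact: dgv].
apply: Ck_on_ext (IH _ _ Cf Cg) => // x Ax.
by rewrite -deriveD//; [exact: dfv|exact: dgv].
Qed.

Lemma Ck_onM n A (f g : V -> R) : open A ->
  Ck_on n A f -> Ck_on n A g -> Ck_on n A (fun x => f x * g x).
Proof.
move=> oA; elim: n f g => [|n IH] f g Cf0 Cg0; move: (Cf0) (Cg0) => [cf df] [cg dg];
  split => //.
- by move=> x Ax; apply: continuousM; [exact: cf|exact: cg].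
- by move=> x Ax; apply: continuousM; [exact: cf|exact: cg].
move=> v; have [dfv Cf] := df v; have [dgv Cg] := dg v; split.
  by move=> x Ax; apply: derivableM; [exact: dfv|exact: dgv].
have := Ck_onD oA (IH _ _ (Ck_onW Cf0) Cg) (IH _ _ (Ck_onW Cg0) Cf).
apply: Ck_on_ext => // x Ax.
by rewrite (@deriveM _ _ f g)//; [exact: dfv|exact: dgv].
Qed.

Lemma Ck_onN n A (f : V -> R) : open A ->
  Ck_on n A f -> Ck_on n A (fun x => - f x).
Proof.
move=> oA Cf; have := Ck_onM oA (Ck_on_cst n A (-1 : R)) Cf.
by apply: Ck_on_ext => // x _; rewrite mulN1r.
Qed.

(** The derivative of 1/f is a product of 1/f, 1/f and a derivative of f, so regularity of 1/f at
    one order feeds the next. *)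
Lemma Ck_onV n A (f : V -> R) : open A -> (forall x, A x -> f x != 0) ->
  Ck_on n A f -> Ck_on n A (fun x => (f x)^-1).
Proof.
move=> oA f0; elim: n => [|n IH] Cf0; move: (Cf0) => [cf df]; split => //.
- by move=> x Ax; apply: cvgV; [exact: f0|exact: cf].
- by move=> x Ax; apply: cvgV; [exact: f0|exact: cf].
move=> v; have [dfv Cf] := df v; split.
  by move=> x Ax; apply: derivableV; [exact: f0|exact: dfv].
have Ci := IH (Ck_onW Cf0).
have := Ck_onM oA (Ck_onN oA (Ck_onM oA Ci Ci)) Cf.
apply: Ck_on_ext => // x Ax.
by rewrite deriveV ?f0//; [rewrite expr2 invfM|exact: dfv].
Qed.

Lemma Ck_on_mxP m p n A (f : V -> 'M[R]_(m.+1, p.+1)) : open A ->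
  (Ck_on n A f <-> forall i j, Ck_on n A (fun x => f x i j)).
Proof.
have cmx (g : V -> 'M[R]_(m.+1, p.+1)) x :
    {for x, continuous g} <-> forall i j, {for x, continuous (fun x => g x i j)}.
  split=> [cg i j|cg].
    exact: (continuous_comp cg (@coord_continuous _ _ _ i j _)).
  apply/cvgrPdist_le => /= e e0; near=> y.
  rewrite [leLHS]/Num.Def.normr/= mx_normrE (bigmax_le _ (ltW e0))//= => i _.
  rewrite !mxE/=; move: i; near: y; apply: filter_forall => /= i.
  exact: ((cvgrPdist_le _ _).1 (cg i.1 i.2)).
move=> oA; elim: n f => [|n IH] f; split.
- by move=> [cf _] i j; split=> // x /cf/cmx.
- by move=> Cf; split=> // x Ax; apply/cmx => i j; have [+ _] := Cf i j; exact.
- move=> [cf df] i j; split=> [x /cf/cmx//|v].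
  have [dfv /IH Cf] := df v; split=> [x /dfv/derivable_mxP//|].
  apply: Ck_on_ext (Cf i j) => // x Ax.
  by rewrite derive_mx ?mxE//; exact: dfv.
move=> Cf; split=> [x Ax|v].
  by apply/cmx => i j; have [+ _] := Cf i j; exact.
have dfv x : A x -> derivable f x v.
  by move=> Ax; apply/derivable_mxP => i j; have [_ /(_ v)[+ _]] := Cf i j; exact.
split=> //; apply/IH => i j; have [_ /(_ v)[_]] := Cf i j.
by apply: Ck_on_ext => // x Ax; rewrite derive_mx ?mxE//; exact: dfv.
Unshelve. all: by end_near. Qed.

Lemma Ck_on_derivable (W : normedModType R) n A (f : V -> W) x v :
  Ck_on n.+1 A f -> A x -> derivable f x v.
Proof. by case=> _ /(_ v)[+ _]; exact. Qed.

Lemma smooth_on_derive (W : normedModType R) A (f : V -> W) v :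
  smooth_on A f -> smooth_on A ('D_v f).
Proof. by move=> sf n; have [_ /(_ v)[]] := sf n.+1. Qed.

Lemma smooth_on_derivable (W : normedModType R) A (f : V -> W) x v :
  smooth_on A f -> A x -> derivable f x v.
Proof. by move=> sf; exact: (Ck_on_derivable (sf 1%N)). Qed.

End Ck.

(** * Directional derivatives: mean value theorem, additivity in the direction, symmetry of second
    derivatives *)

Section Directional.
Variables (R : realType) (V : normedModType R).
Implicit Types (A : set V) (f : V -> R) (x u v : V).

(** The difference quotients of [f] along [v] and of its restriction to the line are the same
    function of [h]; this transfers one-variable calculus to directional derivatives. *)
Lemma growth_lineE f x v t :
  (fun h : R => h^-1 *: ((f \o shift (t *: v + x)) (h *: v) - f (t *: v + x))) =
  (fun h : R => h^-1 *: (((fun s : R => f (s *: v + x)) \o shift t) (h *: (1 : R))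
                 - f (t *: v + x))).
Proof.
by apply/funext => h /=; rewrite [_%:A]mulr1 scalerDl addrA.
Qed.

Lemma derivable_lineP f x v t :
  derivable f (t *: v + x) v <-> derivable (fun s : R => f (s *: v + x)) t 1.
Proof. by rewrite /derivable growth_lineE. Qed.

Lemma derive_line f x v t :
  'D_v f (t *: v + x) = 'D_1 (fun s : R => f (s *: v + x)) t.
Proof. by rewrite /derive growth_lineE. Qed.

(** Only the derivative along [v] is available, so the chain rule is applied on the line, to the
    restriction of [f] composed with multiplication by [c]. *)
Lemma is_derive_scale f x v (c df : R) :
  is_derive x v f df -> is_derive x (c *: v) f (c * df).
Proof.
move=> [fxv <-].
pose F := fun s : R => f (s *: v + x).
have dF : derivable F (0 * c) 1 by apply/derivable_lineP; rewrite mul0r scale0r add0r.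
have [dc Dc] : is_derive (0 : R) (1 : R) (fun s : R => s * c) c.
  have := is_deriveM (is_derive_id (0 : R) (1 : R)) (is_derive_cst c (0 : R) (1 : R)).
  by rewrite scaler0 add0r [_ *: _]mulr1.
have FE : (fun s : R => f (s *: (c *: v) + x)) = F \o (fun s => s * c).
  by apply/funext => s; rewrite /F /= scalerA.
have x0 w : x = 0 *: w + x by rewrite scale0r add0r.
split.
  rewrite (x0 (c *: v)); apply/derivable_lineP; rewrite FE.
  apply/derivable1_diffP; apply: differentiable_comp.
    by move/derivable1_diffP: dc.
  by move/derivable1_diffP: dF.
have := derive1_comp dc dF; rewrite !derive1E Dc -derive_line mul0r scale0r add0r.
by rewrite mulrC => <-; rewrite -FE -derive_line scale0r add0r.
Qed.

Lemma MVT_dir f x u : (forall t, 0 <= t <= 1 -> derivable f (t *: u + x) u) ->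
  exists2 t, 0 <= t <= 1 & f (u + x) - f x = 'D_u f (t *: u + x).
Proof.
move=> df; pose F := fun s : R => f (s *: u + x).
have dF t : 0 <= t <= 1 -> derivable F t 1 by move=> /df/derivable_lineP.
have [| |t] := @MVT_segment R F (fun t => 'D_1 F t) 0 1 ler01.
- by move=> t; rewrite in_itv /= => /andP[t0 t1]; apply/derivableP/dF; rewrite !ltW.
- apply: derivable_within_continuous => t.
  by rewrite in_itv /= => /dF.
rewrite in_itv /= => t01; rewrite subr0 mulr1 -derive_line => e.
by exists t => //; rewrite -e /F scale1r scale0r add0r.
Qed.

Lemma nbhs_plane x u v (P : set V) : (\near x, P x) ->
  exists2 r : R, 0 < r &
    forall s t : R, `|s| <= r -> `|t| <= r -> P (s *: u + (t *: v + x)).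
Proof.
move=> /nbhs_ballP[e /= e0 Pe].
(* The summand 1 keeps the denominator positive for [u = v = 0] and makes the last inequality
   strict. *)
exists (e / (`|u| + `|v| + 1)).
  by rewrite divr_gt0// ltr_wpDl// addr_ge0.
move=> s t; set r := e / _ => sr tr; apply: Pe.
have uv0 : 0 < `|u| + `|v| + 1 by rewrite ltr_wpDl// addr_ge0.
have r0 : 0 < r by rewrite divr_gt0.
rewrite -ball_normE /ball_ /= -opprB normrN addrA addrK.
apply: le_lt_trans (ler_normD _ _) _; rewrite !normrZ.
apply: (@le_lt_trans _ _ (r * `|u| + r * `|v|)).
  by apply: lerD; apply: ler_wpM2r.
rewrite -mulrDr /r mulrAC ltr_pdivrMr// ltr_pM2l//.
by rewrite ltrDl ltr01.
Qed.

(** Applying the mean value theorem along [h *: v] on the unit interval treats both signs of [h] at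
    once. *)
Lemma derivable_step A f x v (h : R) :
  Ck_on 1 A f -> (forall t, `|t| <= `|h| -> A (t *: v + x)) ->
  exists2 t, `|t| <= `|h| & f (h *: v + x) - f x = h * 'D_v f (t *: v + x).
Proof.
move=> Cf Ah.
have Ah' t : 0 <= t <= 1 -> A (t *: (h *: v) + x).
  move=> /andP[t0 t1]; rewrite scalerA; apply: Ah.
  by rewrite normrM ger0_norm// ler_piMl.
have dfA y : A y -> is_derive y v f ('D_v f y).
  by move=> Ay; apply: derivableP; exact: (Ck_on_derivable Cf Ay).
have [|t t01 ->] := @MVT_dir f x (h *: v).
  by move=> t /Ah' /dfA dA; have [] := is_derive_scale h dA.
exists (t * h).
  by case/andP: t01 => t0 t1; rewrite normrM ger0_norm// ler_piMl.
by have [_ ->] := is_derive_scale h (dfA _ (Ah' _ t01)); rewrite scalerA.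
Qed.

(** The increment along [h *: (u + v)] splits into a step along [v] and a step along [u]; each is
    [h] times a derivative at a nearby point, and continuity of ['D_u f] and ['D_v f] at [x] gives
    the limit. *)
Lemma C1_deriveD A f x u v : open A -> A x -> Ck_on 1 A f ->
  'D_(u + v) f x = 'D_u f x + 'D_v f x.
Proof.
move=> oA Ax Cf; apply/cvg_lim => //; apply/cvgrPdist_lt => e e0.
have e2 : 0 < e / 2 by rewrite divr_gt0.
have nD w : \forall y \near x, `|'D_w f x - 'D_w f y| < e / 2.
  by have [_ /(_ w)[_ [cw _]]] := Cf; have /cvgrPdist_lt := cw _ Ax; apply.
have [r r0 rP] := nbhs_plane u v
  (filterI (open_near oA Ax) (filterI (nD u) (nD v))).
have r00 : `|0 : R| <= r by rewrite normr0 ltW.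
near=> h.
have hr : `|h| <= r.
  by near: h; apply: dnbhs0_le.
have h0 : h != 0 by near: h; exact: nbhs_dnbhs_neq.
have [s sh es] : exists2 s, `|s| <= `|h| &
    f (h *: u + (h *: v + x)) - f (h *: v + x) = h * 'D_u f (s *: u + (h *: v + x)).
  apply: (derivable_step Cf) => t th.
  by have [] := rP t h (le_trans th hr) hr.
have [t th et] : exists2 t, `|t| <= `|h| &
    f (h *: v + x) - f x = h * 'D_v f (t *: v + x).
  apply: (derivable_step Cf) => t th.
  by have [] := rP 0 t r00 (le_trans th hr); rewrite scale0r add0r.
have [_ [Us _]] := rP s h (le_trans sh hr) hr.
have [_ [_]] := rP 0 t r00 (le_trans th hr); rewrite scale0r add0r => Vt.
have E : f (h *: u + (h *: v + x)) - f x =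
    h * ('D_u f (s *: u + (h *: v + x)) + 'D_v f (t *: v + x)).
  by rewrite mulrDr -es -et subrKA.
have -> : (f \o shift x) (h *: (u + v)) = f (h *: u + (h *: v + x)).
  by rewrite /= scalerDr addrA.
rewrite E [h^-1 *: _]mulrA mulVf// mul1r.
rewrite opprD addrACA (le_lt_trans (ler_normD _ _))// (splitr e).
exact: ltrD.
Unshelve. all: by end_near. Qed.

(** The second difference of [f] over a small parallelogram is symmetric in [u] and [v]; it equals
    [r ^+ 2] times either mixed derivative at some point of the parallelogram, and both are
    continuous at [x]. *)
Lemma Schwarz A f x u v : open A -> A x -> Ck_on 2 A f ->
  'D_u ('D_v f) x = 'D_v ('D_u f) x.
Proof.
move=> oA Ax Cf.
have Cf1 := Ck_onW Cf.
have CD w : Ck_on 1 A ('D_w f) by have [_ /(_ w)[]] := Cf.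
suff H e : 0 < e -> `|'D_u ('D_v f) x - 'D_v ('D_u f) x| < e.
  apply/eqP; rewrite -subr_eq0 -normr_eq0; apply/negPn/negP => n0.
  by have := H _ _; move=> /(_ `|'D_u ('D_v f) x - 'D_v ('D_u f) x|);
    rewrite ltxx lt_def n0 normr_ge0 => /(_ isT).
move=> e0; have e2 : 0 < e / 2 by rewrite divr_gt0.
have nD w z : \forall y \near x, `|'D_w ('D_z f) x - 'D_w ('D_z f) y| < e / 2.
  by have [_ /(_ w)[_ [cw _]]] := CD z; have /cvgrPdist_lt := cw _ Ax; apply.
have [r r0 rP] := nbhs_plane u v
  (filterI (open_near oA Ax) (filterI (nD u v) (nD v u))).
(* two mean value steps on the second difference of f *)
have S w z : (forall s t : R, `|s| <= r -> `|t| <= r -> A (s *: w + (t *: z + x))) ->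
    exists s t, [/\ `|s| <= r, `|t| <= r &
    f (r *: w + (r *: z + x)) - f (r *: z + x) - f (r *: w + x) + f x =
    r * (r * 'D_z ('D_w f) (s *: w + (t *: z + x)))].
  move=> AP.
  have rr : `|r| = r by rewrite gtr0_norm.
  pose F y := f (r *: z + y) - f y.
  have AP0 s : `|s| <= r -> A (s *: w + x).
    by move=> sr; have := AP s 0 sr; rewrite scale0r add0r normr0 ltW//; exact.
  have dF s : `|s| <= r -> is_derive (s *: w + x) w F
      ('D_w f (s *: w + (r *: z + x)) - 'D_w f (s *: w + x)).
    move=> sr; apply: is_deriveB; last first.
      by apply: derivableP; apply: (Ck_on_derivable Cf1); exact: AP0.
    have As : A (s *: w + (r *: z + x)) by apply: AP; rewrite ?rr.
    have df : derivable f (s *: w + (r *: z + x)) w by exact: Ck_on_derivable Cf1 As.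
    have -> : (fun y => f (r *: z + y)) = f \o shift (r *: z).
      by apply/funext => y /=; rewrite addrC.
    have g0 (h : R) : h *: w + (s *: w + (r *: z + x)) =
        h *: w + (s *: w + x) + r *: z by rewrite -!addrA [x + _]addrC.
    have g1 : (s *: w + (r *: z + x)) = (s *: w + x) + r *: z.
      by have := g0 0; rewrite scale0r !add0r.
    have g2 : (fun h : R => h^-1 *: ((f \o shift (s *: w + (r *: z + x))) (h *: w)
        - f (s *: w + (r *: z + x)))) =
      (fun h : R => h^-1 *: (((f \o shift (r *: z)) \o shift (s *: w + x)) (h *: w)
        - (f \o shift (r *: z)) (s *: w + x))).
      by apply/funext => h /=; rewrite g0 g1.
    by split; [move: df|]; rewrite /derivable /derive g2.
  have [|s s01 es] := @MVT_dir F x (r *: w).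
    move=> t /andP[t0 t1]; rewrite scalerA.
    have tr : `|t * r| <= r by rewrite normrM (ger0_norm t0) rr ger_pMl.
    by have [] := is_derive_scale r (dF _ tr).
  have sr : `|s * r| <= r.
    by case/andP: s01 => s0 s1; rewrite normrM (ger0_norm s0) rr ger_pMl.
  have [t tr et] : exists2 t, `|t| <= `|r| & 'D_w f (r *: z + ((s * r) *: w + x)) -
      'D_w f ((s * r) *: w + x) = r * 'D_z ('D_w f) (t *: z + ((s * r) *: w + x)).
    apply: (derivable_step (CD w)) => t tr.
    by rewrite addrCA; apply: AP => //; rewrite -rr.
  exists (s * r), t; split => //; first by rewrite -rr.
  have [_ ds] := is_derive_scale r (dF _ sr).
  have -> : (s * r) *: w + (t *: z + x) = t *: z + ((s * r) *: w + x).
    exact: addrCA.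
  rewrite -et; have -> : r *: z + ((s * r) *: w + x) = (s * r) *: w + (r *: z + x).
    exact: addrCA.
  rewrite -ds -scalerA -es /F.
  have -> : r *: z + (r *: w + x) = r *: w + (r *: z + x) by exact: addrCA.
  have abel (a b c d : R) : a - b - c + d = a - c - (b - d) by ring.
  exact: abel.
have Puv s t : `|s| <= r -> `|t| <= r -> A (s *: u + (t *: v + x)).
  by move=> sr tr; have [] := rP s t sr tr.
have Pvu s t : `|s| <= r -> `|t| <= r -> A (s *: v + (t *: u + x)).
  by move=> sr tr; rewrite addrCA; exact: Puv.
have [s [t [sr tr est]]] := S u v Puv.
have [s' [t' [s'r t'r est']]] := S v u Pvu.
(* The two mixed derivatives agree at two possibly different points, both close to [x]. *)
have E : 'D_v ('D_u f) (s *: u + (t *: v + x)) =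
         'D_u ('D_v f) (t' *: u + (s' *: v + x)).
  have r1 : r != 0 by rewrite gt_eqF.
  have mI (a b : R) : r * (r * a) = r * (r * b) -> a = b by move=> /(mulfI r1)/(mulfI r1).
  apply: mI; apply: (etrans (esym est)).
  have -> : t' *: u + (s' *: v + x) = s' *: v + (t' *: u + x) by exact: addrCA.
  rewrite -est'; have -> : r *: v + (r *: u + x) = r *: u + (r *: v + x).
    exact: addrCA.
  by congr (_ + _); exact: addrAC.
have [_ [_ H1]] := rP s t sr tr.
have [_ [H2 _]] := rP t' s' t'r s'r.
move: H1 H2; rewrite -E; set m := 'D_v ('D_u f) (s *: u + _) => H1 H2.
rewrite distrC in H1; move: H1 H2; move: ('D_u ('D_v f) x) ('D_v ('D_u f) x) m.
move=> a b m mb am; rewrite -(subrKA m) (splitr e).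
apply: le_lt_trans (ler_normD _ _) _; exact: ltrD am mb.
Qed.

Lemma derive0_cst A f x y :
  (forall t : R, 0 <= t <= 1 -> A (t *: (y - x) + x)) ->
  (forall z v, A z -> is_derive z v f 0) -> f y = f x.
Proof.
move=> At df0; have [|t t01] := @MVT_dir f x (y - x).
  by move=> t /At Az; have [] := df0 _ (y - x) Az.
by rewrite subrK; have [_ ->] := df0 _ (y - x) (At _ t01) => /eqP; rewrite subr_eq0 => /eqP.
Qed.

End Directional.

(** * Complex-valued functions *)

Section ComplexParts.
Variable R : realType.
Implicit Types z w : R[i].

Lemma conjE z : z^* = conjc z.
Proof. by []. Qed.

Lemma cReD z w : complex.Re (z + w) = complex.Re z + complex.Re w.
Proof. by case: z; case: w. Qed.
Lemma cImD z w : complex.Im (z + w) = complex.Im z + complex.Im w.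
Proof. by case: z; case: w. Qed.
Lemma cReN z : complex.Re (- z) = - complex.Re z.
Proof. by case: z. Qed.
Lemma cImN z : complex.Im (- z) = - complex.Im z.
Proof. by case: z. Qed.
Lemma cReM z w : complex.Re (z * w) =
  complex.Re z * complex.Re w - complex.Im z * complex.Im w.
Proof. by case: z; case: w. Qed.
Lemma cImM z w : complex.Im (z * w) =
  complex.Re z * complex.Im w + complex.Im z * complex.Re w.
Proof. by case: z; case: w. Qed.
Lemma cReJ z : complex.Re z^* = complex.Re z.
Proof. by rewrite conjE; case: z. Qed.
Lemma cImJ z : complex.Im z^* = - complex.Im z.
Proof. by rewrite conjE; case: z. Qed.
Lemma cReV z : complex.Re z^-1 =
  complex.Re z / (complex.Re z ^+ 2 + complex.Im z ^+ 2).
Proof. by case: z. Qed.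
Lemma cImV z : complex.Im z^-1 =
  - (complex.Im z / (complex.Re z ^+ 2 + complex.Im z ^+ 2)).
Proof. by case: z. Qed.
Lemma cReR (r : R) : complex.Re r%:C%C = r.
Proof. by []. Qed.
Lemma cImR (r : R) : complex.Im r%:C%C = 0.
Proof. by []. Qed.

Lemma complex_eqP z w :
  complex.Re z = complex.Re w -> complex.Im z = complex.Im w -> z = w.
Proof. by case: z w => a b [c d] /= -> ->. Qed.

Lemma normsq_neq0 z : z != 0 -> complex.Re z ^+ 2 + complex.Im z ^+ 2 != 0.
Proof.
by apply: contraNN => /eqP h; rewrite -sqrf_eq0 -(normr_eq0 (_ ^+ 2)) normrX -add_Re2_Im2 h.
Qed.

Lemma conj_eq0 z : (z^* == 0) = (z == 0).
Proof. exact: conjc_eq0. Qed.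
Lemma conjR (r : R) : (r%:C%C)^* = r%:C%C :> R[i].
Proof. exact: conjc_real. Qed.
End ComplexParts.

Section RealRules.
Variables (R : realType) (V : normedModType R).
Implicit Types (f g : V -> R) (x v : V).

Lemma is_derive_add f g x v (df dg : R) :
  is_derive x v f df -> is_derive x v g dg ->
  is_derive x v (fun y => f y + g y) (df + dg).
Proof. exact: is_deriveD. Qed.

Lemma is_derive_opp f x v (df : R) :
  is_derive x v f df -> is_derive x v (fun y => - f y) (- df).
Proof. exact: is_deriveN. Qed.

Lemma is_derive_mul f g x v (df dg : R) :
  is_derive x v f df -> is_derive x v g dg ->
  is_derive x v (fun y => f y * g y) (f x * dg + g x * df).
Proof. exact: is_deriveM. Qed.

Lemma is_derive_inv f x v (df : R) : f x != 0 ->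
  is_derive x v f df -> is_derive x v (fun y => (f y)^-1) (- ((f x) ^+ 2)^-1 * df).
Proof. by move=> f0 [dfx <-]; split; [exact: derivableV|exact: deriveV]. Qed.

End RealRules.

Section ComplexCalculus.
Variables (R : realType) (V : normedModType R).
Implicit Types (A : set V) (f g : V -> R[i]) (x v : V).

(** Differentiability over the reals, as conjugates occur everywhere. Both parts are Fréchet
    differentiable, and [df] records the directional derivatives. *)
Definition cdiff f x (df : V -> R[i]) : Prop :=
  [/\ differentiable (fun y => complex.Re (f y)) x,
      differentiable (fun y => complex.Im (f y)) x
    & forall v, 'D_v (fun y => complex.Re (f y)) x = complex.Re (df v) /\
                'D_v (fun y => complex.Im (f y)) x = complex.Im (df v)].

Lemma cdiff_eq f x df dg : cdiff f x df -> df =1 dg -> cdiff f x dg.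
Proof. by move=> [dr di D] e; split=> // v; rewrite -e. Qed.

Lemma cdiff_ext f g x df : cdiff f x df -> f =1 g -> cdiff g x df.
Proof. by move=> D /funext <-. Qed.

Lemma cdiff_cst (c : R[i]) x : cdiff (fun=> c) x (fun=> 0).
Proof. by split=> [||v]; [exact: differentiable_cst.. | rewrite !derive_cst]. Qed.

Lemma is_derive_diff (h : V -> R) x v :
  differentiable h x -> is_derive x v h ('D_v h x).
Proof. by move=> dh; apply: derivableP; exact: diff_derivable. Qed.

Lemma cdiffD f g x df dg : cdiff f x df -> cdiff g x dg ->
  cdiff (fun y => f y + g y) x (fun v => df v + dg v).
Proof.
move=> [fr fi fD] [gr gi gD].
split.
- have -> : (fun y => complex.Re (f y + g y)) =
      (fun y => complex.Re (f y)) + (fun y => complex.Re (g y)).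
    by apply/funext => y; rewrite cReD.
  exact: differentiableD.
- have -> : (fun y => complex.Im (f y + g y)) =
      (fun y => complex.Im (f y)) + (fun y => complex.Im (g y)).
    by apply/funext => y; rewrite cImD.
  exact: differentiableD.
move=> v; have [fv1 fv2] := fD v; have [gv1 gv2] := gD v.
have [fr' fi' gr' gi'] := And4 (is_derive_diff v fr) (is_derive_diff v fi)
  (is_derive_diff v gr) (is_derive_diff v gi).
rewrite cReD cImD -fv1 -fv2 -gv1 -gv2; split.
  under eq_fun do rewrite cReD; have [_ ->] := is_derive_add fr' gr'; exact: erefl.
under eq_fun do rewrite cImD; have [_ ->] := is_derive_add fi' gi'; exact: erefl.
Qed.

Lemma cdiffM f g x df dg : cdiff f x df -> cdiff g x dg ->
  cdiff (fun y => f y * g y) x (fun v => df v * g x + f x * dg v).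
Proof.
move=> [fr fi fD] [gr gi gD]; split.
- have -> : (fun y => complex.Re (f y * g y)) =
      (fun y => complex.Re (f y)) * (fun y => complex.Re (g y)) -
      (fun y => complex.Im (f y)) * (fun y => complex.Im (g y)).
    by apply/funext => y; rewrite cReM.
  by apply: differentiableB; exact: differentiableM.
- have -> : (fun y => complex.Im (f y * g y)) =
      (fun y => complex.Re (f y)) * (fun y => complex.Im (g y)) +
      (fun y => complex.Im (f y)) * (fun y => complex.Re (g y)).
    by apply/funext => y; rewrite cImM.
  by apply: differentiableD; exact: differentiableM.
move=> v; have [fv1 fv2] := fD v; have [gv1 gv2] := gD v.
have [fr' fi' gr' gi'] := And4 (is_derive_diff v fr) (is_derive_diff v fi)
  (is_derive_diff v gr) (is_derive_diff v gi).
rewrite cReD cImD !cReM !cImM -fv1 -fv2 -gv1 -gv2; split.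
  under eq_fun do rewrite cReM.
  have [_ ->] := is_derive_add (is_derive_mul fr' gr') (is_derive_opp (is_derive_mul fi' gi')).
  ring.
under eq_fun do rewrite cImM.
have [_ ->] := is_derive_add (is_derive_mul fr' gi') (is_derive_mul fi' gr').
ring.
Qed.

Lemma cdiffN f x df : cdiff f x df -> cdiff (fun y => - f y) x (fun v => - df v).
Proof.
move=> fD; have := cdiffM (cdiff_cst (-1) x) fD.
rewrite (_ : (fun y => -1 * f y) = fun y => - f y); last first.
  by apply/funext => y; rewrite mulN1r.
by move/cdiff_eq; apply => v; rewrite mul0r add0r mulN1r.
Qed.

Lemma cdiffJ f x df : cdiff f x df -> cdiff (fun y => (f y)^*) x (fun v => (df v)^*).
Proof.
move=> [fr fi fD].
split.
- by under eq_fun do rewrite cReJ.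
- have -> : (fun y => complex.Im (f y)^*) = - (fun y => complex.Im (f y)).
    by apply/funext => y; rewrite cImJ.
  exact: differentiableN.
move=> v; have [fv1 fv2] := fD v; rewrite cReJ cImJ -fv1 -fv2; split.
  by under eq_fun do rewrite cReJ.
under eq_fun do rewrite cImJ.
by have [_ ->] := is_derive_opp (is_derive_diff v fi).
Qed.

Lemma cdiffV f x df : f x != 0 -> cdiff f x df ->
  cdiff (fun y => (f y)^-1) x (fun v => - df v / f x ^+ 2).
Proof.
move=> f0 [fr fi fD].
pose n y := complex.Re (f y) * complex.Re (f y) + complex.Im (f y) * complex.Im (f y).
have n0 : n x != 0 by have := normsq_neq0 f0; rewrite !expr2.
have dn : differentiable n x by apply: differentiableD; exact: differentiableM.
have dV : differentiable (fun y => (n y)^-1) x by exact: differentiableV.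
split.
- have -> : (fun y => complex.Re (f y)^-1) = (fun y => complex.Re (f y)) * (fun y => (n y)^-1).
    by apply/funext => y; rewrite cReV !expr2.
  exact: differentiableM.
- have -> : (fun y => complex.Im (f y)^-1) = - ((fun y => complex.Im (f y)) * (fun y => (n y)^-1)).
    by apply/funext => y; rewrite cImV !expr2.
  by apply: differentiableN; exact: differentiableM.
move=> v; have [fv1 fv2] := fD v.
have fr' := is_derive_diff v fr; have fi' := is_derive_diff v fi.
have n' := is_derive_inv n0 (is_derive_add (is_derive_mul fr' fr') (is_derive_mul fi' fi')).
rewrite !expr2 !invfM !(cReM, cImM, cReN, cImN, cReV, cImV) -fv1 -fv2.
have {}n0 := normsq_neq0 f0.
split.
  under eq_fun do rewrite cReV !expr2.
  have [_ ->] := is_derive_mul fr' n'; rewrite /n.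
  move: n0; move: ('D_v (fun y => complex.Re _) x) ('D_v (fun y => complex.Im _) x).
  by move: (complex.Re _) (complex.Im _) => a b c d n0 /=; field.
under eq_fun do rewrite cImV !expr2.
have [_ ->] := is_derive_opp (is_derive_mul fi' n'); rewrite /n.
move: n0; move: ('D_v (fun y => complex.Re _) x) ('D_v (fun y => complex.Im _) x).
  move: (complex.Re _) (complex.Im _) => a b c d n0 /=. field; exact: n0. 
Qed.

Lemma cdiff_sum n (f : 'I_n -> V -> R[i]) x (df : 'I_n -> V -> R[i]) :
  (forall i, cdiff (f i) x (df i)) ->
  cdiff (fun y => \sum_i f i y) x (fun v => \sum_i df i v).
Proof.
elim: n f df => [|n IH] f df D.
  have D0 : cdiff (fun y => \sum_i f i y) x (fun=> 0).
    by apply: cdiff_ext (cdiff_cst 0 x) _ => y; rewrite big_ord0.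
  by apply: cdiff_eq D0 _ => v; rewrite big_ord0.
have DS := cdiffD (IH _ _ (fun i => D (widen_ord (leqnSn n) i))) (D ord_max).
apply: cdiff_eq (cdiff_ext DS _) _ => [y|v]; by rewrite [RHS]big_ord_recr.
Qed.

Definition csmooth A f : Prop :=
  smooth_on A (fun y => complex.Re (f y)) /\ smooth_on A (fun y => complex.Im (f y)).

Lemma csmooth_cst A (c : R[i]) : csmooth A (fun=> c).
Proof. by split=> n; exact: Ck_on_cst. Qed.

Lemma csmooth_ext A f g : open A -> (forall x, A x -> f x = g x) ->
  csmooth A f -> csmooth A g.
Proof.
by move=> oA fg [fr fi]; split=> n;
  [apply: Ck_on_ext (fr n)|apply: Ck_on_ext (fi n)] => // x /fg ->.
Qed.

Lemma csmoothD A f g : open A -> csmooth A f -> csmooth A g ->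
  csmooth A (fun x => f x + g x).
Proof.
move=> oA [fr fi] [gr gi]; split=> n.
  by apply: Ck_on_ext (Ck_onD oA (fr n) (gr n)) => // x _; rewrite cReD.
by apply: Ck_on_ext (Ck_onD oA (fi n) (gi n)) => // x _; rewrite cImD.
Qed.

Lemma csmoothM A f g : open A -> csmooth A f -> csmooth A g ->
  csmooth A (fun x => f x * g x).
Proof.
move=> oA [fr fi] [gr gi]; split=> n.
  have := Ck_onD oA (Ck_onM oA (fr n) (gr n)) (Ck_onN oA (Ck_onM oA (fi n) (gi n))).
  by apply: Ck_on_ext => // x _; rewrite cReM.
have := Ck_onD oA (Ck_onM oA (fr n) (gi n)) (Ck_onM oA (fi n) (gr n)).
by apply: Ck_on_ext => // x _; rewrite cImM.
Qed.

Lemma csmoothJ A f : open A -> csmooth A f -> csmooth A (fun x => (f x)^*).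
Proof.
move=> oA [fr fi]; split=> n.
  by apply: Ck_on_ext (fr n) => // x _; rewrite cReJ.
by apply: Ck_on_ext (Ck_onN oA (fi n)) => // x _; rewrite cImJ.
Qed.

Lemma csmoothV A f : open A -> (forall x, A x -> f x != 0) -> csmooth A f ->
  csmooth A (fun x => (f x)^-1).
Proof.
move=> oA f0 [fr fi].
have ni n : Ck_on n A (fun x => (complex.Re (f x) ^+ 2 + complex.Im (f x) ^+ 2)^-1).
  apply: Ck_onV => // [x /f0/normsq_neq0//|].
  have := Ck_onD oA (Ck_onM oA (fr n) (fr n)) (Ck_onM oA (fi n) (fi n)).
  by apply: Ck_on_ext => // x _; rewrite !expr2.
split=> n.
  by apply: Ck_on_ext (Ck_onM oA (fr n) (ni n)) => // x _; rewrite cReV.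
by apply: Ck_on_ext (Ck_onN oA (Ck_onM oA (fi n) (ni n))) => // x _; rewrite cImV.
Qed.

Lemma csmoothN A f : open A -> csmooth A f -> csmooth A (fun x => - f x).
Proof.
move=> oA sf; apply: csmooth_ext (csmoothM oA (csmooth_cst A (-1)) sf) => // x _.
by rewrite mulN1r.
Qed.

Lemma csmooth_sum A n (f : 'I_n -> V -> R[i]) : open A ->
  (forall i, csmooth A (f i)) -> csmooth A (fun y => \sum_i f i y).
Proof.
move=> oA; elim: n f => [|n IH] f sf.
  by apply: csmooth_ext (csmooth_cst A 0) => // y _; rewrite big_ord0.
apply: csmooth_ext (csmoothD oA (IH _ (fun i => sf (widen_ord (leqnSn n) i))) (sf ord_max)) => //.
by move=> y _; rewrite big_ord_recr.
Qed.

End ComplexCalculus.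

(** * Hermitian forms on C^3 *)

Lemma ord3P (P : 'I_3 -> Prop) : P 0 -> P 1 -> P 2 -> forall i, P i.
Proof.
move=> P0 P1 P2 [[|[|[|//]]] Hi]; [move: P0|move: P1|move: P2];
  by congr (P _); apply/val_inj.
Qed.

Lemma ord2P (P : 'I_2 -> Prop) : P 0 -> P 1 -> forall i, P i.
Proof.
by move=> P0 P1 [[|[|//]] Hi]; [move: P0|move: P1]; congr (P _); apply/val_inj.
Qed.

Lemma sum3E (M : nmodType) (F : 'I_3 -> M) : \sum_i F i = F 0 + F 1 + F 2.
Proof.
rewrite !big_ord_recl big_ord0 addr0 addrA.
by congr (F _ + F _ + F _); apply/val_inj.
Qed.

Lemma sum2E (M : nmodType) (F : 'I_2 -> M) : \sum_i F i = F 0 + F 1.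
Proof.
by rewrite !big_ord_recl big_ord0 addr0; congr (F _ + F _); apply/val_inj.
Qed.

Lemma ord3E : (((0 + 1)%R = 1%R :> 'I_3) * ((1 + 1)%R = 2%R :> 'I_3) * ((2 + 1)%R = 0%R :> 'I_3) *
  ((0 + 2)%R = 2%R :> 'I_3) * ((1 + 2)%R = 0%R :> 'I_3) * ((2 + 2)%R = 1%R :> 'I_3))%type.
Proof. by do !split; apply/val_inj. Qed.

Lemma lift3E : ((lift 0%R 0%R = 1%R :> 'I_3) * (lift 0%R 1%R = 2%R :> 'I_3) *
  (lift 1%R 0%R = 0%R :> 'I_3) * (lift 1%R 1%R = 2%R :> 'I_3) *
  (lift 2%R 0%R = 0%R :> 'I_3) * (lift 2%R 1%R = 1%R :> 'I_3))%type.
Proof. by do !split; apply/val_inj. Qed.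

Lemma det2E (A : comNzRingType) (M : 'M[A]_2) : \det M = M 0 0 * M 1 1 - M 0 1 * M 1 0.
Proof.
rewrite (expand_det_row _ 0) sum2E /cofactor !det_mx11 !mxE /=.
rewrite (_ : lift (0 : 'I_2) 0 = 1); last exact/val_inj.
rewrite (_ : lift (1 : 'I_2) 0 = 0); last exact/val_inj.
by rewrite /= !expr0 !expr1; ring.
Qed.

Lemma det3E (A : comNzRingType) (a : 'M[A]_3) : \det a =
  a 0 0 * (a 1 1 * a 2 2 - a 1 2 * a 2 1)
  - a 0 1 * (a 1 0 * a 2 2 - a 1 2 * a 2 0)
  + a 0 2 * (a 1 0 * a 2 1 - a 1 1 * a 2 0).
Proof.
rewrite (expand_det_row _ 0) sum3E /cofactor !det2E !mxE !lift3E /=.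
by rewrite !add0n ?addn0 /= expr0 expr1 sqrrN expr1n; ring.
Qed.

(** * Cross products and the two forms attached to a hermitian matrix *)

Section CrossProduct.
Variable K : numClosedFieldType.
Implicit Types (z u v w p q : 'cV[K]_3) (C a H : 'M[K]_3).

(** Indices are added modulo 3, so one formula gives the three components. *)
Definition crossv z u : 'cV[K]_3 :=
  \col_i (z (i + 1) 0 * u (i + 2) 0 - z (i + 2) 0 * u (i + 1) 0).

Definition hform C p q : K := (p^T *m C *m map_mx Num.conj q) 0 0.

(** The adjugate; cyclic indices absorb the signs of the cofactors. *)
Definition adj3 C : 'M[K]_3 := \matrix_(i, j)
  (C (j + 1) (i + 1) * C (j + 2) (i + 2) - C (j + 1) (i + 2) * C (j + 2) (i + 1)).

Definition pform C z w : K := ((map_mx Num.conj z)^T *m adj3 C *m w) 0 0.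

(* On the columns of a in SL(3), nform C (a_0; a_i, a_j) = h_(i jbar) and
   dform C a_0 = det h. *)
Definition nform C z u v : K := - hform C (crossv z u) (crossv z v).

Definition dform C z : K := pform C z z.

Lemma hformE C p q : hform C p q =
  \sum_i \sum_j p i 0 * C i j * (q j 0)^*.
Proof.
rewrite /hform mxE exchange_big; apply: eq_bigr => j _.
by rewrite !mxE big_distrl /=; apply: eq_bigr => i _; rewrite !mxE.
Qed.

Lemma pformE C z w : pform C z w =
  \sum_i \sum_j (z i 0)^* * adj3 C i j * w j 0.
Proof.
rewrite /pform mxE exchange_big; apply: eq_bigr => j _.
by rewrite [in LHS]mxE big_distrl /=; apply: eq_bigr => i _; rewrite !mxE.
Qed.

(** The i-th component on the left is the determinant of the columns a e_i, a p, a q. *)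
Lemma crossv_mul a p q :
  a^T *m crossv (a *m p) (a *m q) = \det a *: crossv p q.
Proof.
apply/colP; elim/ord3P; rewrite !mxE !sum3E !mxE !sum3E !ord3E det3E; ring.
Qed.

Lemma crossvZD z u (l m : K) : crossv (l *: z) (l *: u + m *: z) = l ^+ 2 *: crossv z u.
Proof. by apply/colP => i; rewrite !mxE; ring. Qed.

(* Responsible for the Levi-Civita connection of the induced metric being projectively
   flat. *)
Lemma pform_derive C z w u v :
  dform C z * hform C (crossv w u) (crossv z v) =
  pform C z w * hform C (crossv z u) (crossv z v)
  - pform C z u * hform C (crossv z w) (crossv z v).
Proof.
rewrite /dform !pformE !hformE !sum3E !mxE !ord3E !rmorphB !rmorphM /=.
move: (C 0 0) (C 0 1) (C 0 2) (C 1 0) (C 1 1) (C 1 2) (C 2 0) (C 2 1) (C 2 2).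
move: (z 0 0)^* (z 1 0)^* (z 2 0)^* (v 0 0)^* (v 1 0)^* (v 2 0)^*.
move: (z 0 0) (z 1 0) (z 2 0) (u 0 0) (u 1 0) (u 2 0) (w 0 0) (w 1 0) (w 2 0).
intros; ring.
Qed.

Lemma crossvDr z u v (l : K) : crossv z (l *: u + v) = l *: crossv z u + crossv z v.
Proof. by apply/colP => i; rewrite !mxE; ring. Qed.

Lemma crossvv z : crossv z z = 0.
Proof. by apply/colP => i; rewrite !mxE mulrC subrr. Qed.

Lemma trDZ p q (l : K) : (l *: p + q)^T = l *: p^T + q^T.
Proof. by apply/rowP => i; rewrite !mxE. Qed.

Lemma trZ p (l : K) : (l *: p)^T = l *: p^T.
Proof. by apply/rowP => i; rewrite !mxE. Qed.

Lemma nformDl C z u u' v (l : K) :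
  nform C z (l *: u + u') v = l * nform C z u v + nform C z u' v.
Proof.
rewrite /nform /hform crossvDr trDZ !mulmxDl -!scalemxAl.
by rewrite [in LHS]mxE [in LHS]mxE mulrN opprD.
Qed.

Lemma nformDr C z u v v' (l : K) :
  nform C z u (l *: v + v') = l^* * nform C z u v + nform C z u v'.
Proof.
rewrite /nform /hform crossvDr map_mxD map_mxZ mulmxDr -scalemxAr.
by rewrite [in LHS]mxE [in LHS]mxE mulrN opprD.
Qed.

Lemma nform0l C z v : nform C z 0 v = 0.
Proof.
rewrite /nform hformE big1 ?oppr0// => i _; rewrite big1// => j _.
by rewrite !mxE !mulr0 subr0 !mul0r.
Qed.

Lemma nform0r C z v : nform C z v 0 = 0.
Proof.
rewrite /nform hformE big1 ?oppr0// => i _; rewrite big1// => j _.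
by rewrite !mxE !mulr0 subr0 conjC0 mulr0.
Qed.

Lemma nformZl C z u v (l : K) : nform C z (l *: u) v = l * nform C z u v.
Proof. by rewrite -[l *: u]addr0 nformDl nform0l addr0. Qed.

Lemma nformZr C z u v (l : K) : nform C z u (l *: v) = l^* * nform C z u v.
Proof. by rewrite -[l *: v]addr0 nformDr nform0r addr0. Qed.

Lemma nform_zl C z v : nform C z z v = 0.
Proof. by rewrite /nform /hform crossvv trmx0 !mul0mx mxE oppr0. Qed.

Lemma nform_zr C z u : nform C z u z = 0.
Proof. by rewrite /nform /hform crossvv map_mx0 mulmx0 mxE oppr0. Qed.

(** Multiples of [z] disappear in cross products with [z], and each product scales by [l ^+ 2]. The
    resulting factor is also that of [dform C z ^+ 2], so the quotient descends to tangent vectors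
    of the projective plane. *)
Lemma nform_scale C z u v (l m m' : K) :
  nform C (l *: z) (l *: u + m *: z) (l *: v + m' *: z) =
  (l * l^*) ^+ 2 * nform C z u v.
Proof.
rewrite /nform /hform !crossvZD trZ map_mxZ -!scalemxAl -scalemxAr.
by rewrite !mxE rmorphXn /=; ring.
Qed.

Lemma dform_scale C z (l : K) : dform C (l *: z) = l * l^* * dform C z.
Proof.
rewrite /dform /pform map_mxZ trZ -!scalemxAl -scalemxAr !mxE.
by rewrite mulrA [l^* * l]mulrC.
Qed.

Lemma nform_conj C z u v : C = C^t* -> (nform C z u v)^* = nform C z v u.
Proof.
move=> hC; rewrite /nform rmorphN !hformE rmorph_sum exchange_big /=; congr (- _).
apply: eq_bigr => i _; rewrite rmorph_sum; apply: eq_bigr => j _.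
rewrite {2}hC !mxE !rmorphM /= conjCK; ring.
Qed.

Lemma dform_conj C z : C = C^t* -> (dform C z)^* = dform C z.
Proof.
move=> hC; rewrite /dform !pformE rmorph_sum exchange_big /=.
apply: eq_bigr => i _; rewrite rmorph_sum; apply: eq_bigr => j _.
rewrite ![adj3 _ _ _]mxE [in RHS]hC !mxE !rmorphM !rmorphB !rmorphM /= !conjCK; ring.
Qed.

(** The Gram determinant of [C] on two vectors is the adjugate form on their cross product, and (a_0
    × a_1) × (a_0 × a_2) = det(a) a_0. *)
Lemma nform_gram C a :
  nform C (col 0 a) (col 1 a) (col 1 a) * nform C (col 0 a) (col 2 a) (col 2 a)
  - nform C (col 0 a) (col 1 a) (col 2 a) * nform C (col 0 a) (col 2 a) (col 1 a)
  = \det a * (\det a)^* * dform C (col 0 a).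
Proof.
rewrite /dform /nform pformE !hformE !sum3E det3E !mxE !ord3E !(rmorphB, rmorphD, rmorphM) /=.
move: (C 0 0) (C 0 1) (C 0 2) (C 1 0) (C 1 1) (C 1 2) (C 2 0) (C 2 1) (C 2 2).
move: (a 0 0)^* (a 0 1)^* (a 0 2)^* (a 1 0)^* (a 1 1)^* (a 1 2)^*
  (a 2 0)^* (a 2 1)^* (a 2 2)^*.
move: (a 0 0) (a 0 1) (a 0 2) (a 1 0) (a 1 1) (a 1 2) (a 2 0) (a 2 1) (a 2 2).
intros; ring.
Qed.

(** A matrix of determinant 1 acts on cross products by its inverse transpose, which turns [C] into
    the matrix [H] of the frame. *)
Lemma nform_frame C a p q r : \det a = 1 ->
  nform C (a *m p) (a *m q) (a *m r) =
  nform (invmx a *m C *m (invmx a)^t*) p q r.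
Proof.
move=> a1; have aU : a \in unitmx by rewrite unitmxE a1 unitr1.
have E x y : crossv (a *m x) (a *m y) = (invmx a)^T *m crossv x y.
  rewrite -[crossv x y]scale1r -a1 -crossv_mul mulmxA -trmx_mul mulmxV//.
  by rewrite trmx1 mul1mx.
rewrite /nform /hform !E trmx_mul trmxK map_mxM !mulmxA.
by [].
Qed.

Lemma hform_conj C p q : C = C^t* -> (hform C p q)^* = hform C q p.
Proof.
move=> hC; rewrite !hformE rmorph_sum exchange_big /=.
apply: eq_bigr => i _; rewrite rmorph_sum; apply: eq_bigr => j _.
rewrite {2}hC !mxE !rmorphM /= conjCK; ring.
Qed.

Lemma pform_conj C z w : C = C^t* -> (pform C z w)^* = pform C w z.
Proof.
move=> hC; rewrite !pformE rmorph_sum exchange_big /=.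
apply: eq_bigr => i _; rewrite rmorph_sum; apply: eq_bigr => j _.
rewrite ![adj3 _ _ _]mxE [in RHS]hC !mxE !rmorphM !rmorphB !rmorphM /= !conjCK; ring.
Qed.

(** The conjugate of [pform_derive] with [u] and [v] exchanged; it governs the antiholomorphic half
    of the derivative. *)
Lemma pform_derive_conj C z w u v : C = C^t* ->
  dform C z * hform C (crossv z u) (crossv w v) =
  pform C w z * hform C (crossv z u) (crossv z v)
  - pform C v z * hform C (crossv z u) (crossv z w).
Proof.
move=> hC; have := congr1 Num.conj (pform_derive C z w v u).
by rewrite rmorphB !rmorphM /= dform_conj// !hform_conj// !pform_conj.
Qed.

(** Lagrange's identity; the right side is the numerator of the Fubini-Study metric. *)
Lemma nformN1 z u v : nform (- 1%:M) z u v =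
  (\sum_i z i 0 * (z i 0)^*) * (\sum_i u i 0 * (v i 0)^*)
  - (\sum_i u i 0 * (z i 0)^*) * (\sum_i z i 0 * (v i 0)^*).
Proof.
rewrite /nform hformE !sum3E !mxE !ord3E !rmorphB !rmorphM /=; ring.
Qed.

Lemma dformN1 z : dform (- 1%:M) z = \sum_i z i 0 * (z i 0)^*.
Proof.
rewrite /dform pformE !sum3E !mxE !ord3E /=; ring.
Qed.

(** [insert_coord] over a general [K]; the two are convertible for [K = R[i]]. *)
Definition ins3 (k : 'I_3) (c : K) (w : 'rV[K]_2) : 'cV[K]_3 :=
  \col_i (if unlift k i is Some j then w 0 j else c).

Lemma ins3E (c : K) (w : 'rV[K]_2) :
  ((ins3 0 c w 0 0 = c) * (ins3 0 c w 1 0 = w 0 0) * (ins3 0 c w 2 0 = w 0 1) *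
   (ins3 1 c w 0 0 = w 0 0) * (ins3 1 c w 1 0 = c) * (ins3 1 c w 2 0 = w 0 1) *
   (ins3 2 c w 0 0 = w 0 0) * (ins3 2 c w 1 0 = w 0 1) * (ins3 2 c w 2 0 = c))%type.
Proof.
have E k (j : 'I_2) : ins3 k c w (lift k j) 0 = w 0 j by rewrite mxE liftK.
have Ek k : ins3 k c w k 0 = c by rewrite mxE unlift_none.
by do !split; rewrite ?Ek//; [have := E 0 0|have := E 0 1|have := E 1 0|
  have := E 1 1|have := E 2 0|have := E 2 1]; rewrite lift3E.
Qed.

(* The block of H = a^-1 C (a^-1)^* with indices 1, 2, for the a with columns
   (1, w), e_1, e_2 in the coordinates of the chart k. *)
Definition chartH C (k : 'I_3) (w : 'rV[K]_2) : 'M[K]_2 := \matrix_(i, j)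
  (C (lift k i) (lift k j) - w 0 i * C k (lift k j) - (w 0 j)^* * C (lift k i) k
   + w 0 i * (w 0 j)^* * C k k).

(** The formula is the same for all [k]: in the middle chart the two remaining indices are in
    anticyclic order, which changes the sign of both cross products. *)
Lemma nform_chart C k (w u v : 'rV[K]_2) :
  nform C (ins3 k 1 w) (ins3 k 0 u) (ins3 k 0 v) =
  - (chartH C k w 1 1 * (u 0 0 * (v 0 0)^*) - chartH C k w 0 1 * (u 0 1 * (v 0 0)^*)
     - chartH C k w 1 0 * (u 0 0 * (v 0 1)^*) + chartH C k w 0 0 * (u 0 1 * (v 0 1)^*)).
Proof.
have cE z p i : crossv z p i 0 = z (i + 1) 0 * p (i + 2) 0 - z (i + 2) 0 * p (i + 1) 0.
  by rewrite mxE.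
have HE i j : chartH C k w i j = C (lift k i) (lift k j) - w 0 i * C k (lift k j)
    - (w 0 j)^* * C (lift k i) k + w 0 i * (w 0 j)^* * C k k by rewrite mxE.
rewrite /nform hformE !sum3E !cE !HE !ord3E; move: k {HE}.
elim/ord3P; rewrite !lift3E !ins3E !rmorphB !rmorphM ?conjC0 ?conjC1 /=; ring.
Qed.

Lemma dform_chart C k (w : 'rV[K]_2) :
  dform C (ins3 k 1 w) = chartH C k w 0 0 * chartH C k w 1 1
                         - chartH C k w 0 1 * chartH C k w 1 0.
Proof.
have aE i j : adj3 C i j =
    C (j + 1) (i + 1) * C (j + 2) (i + 2) - C (j + 1) (i + 2) * C (j + 2) (i + 1).
  by rewrite mxE.
have HE i j : chartH C k w i j = C (lift k i) (lift k j) - w 0 i * C k (lift k j)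
    - (w 0 j)^* * C (lift k i) k + w 0 i * (w 0 j)^* * C k k by rewrite mxE.
rewrite /dform pformE !sum3E !aE !HE !ord3E; move: k {HE}.
elim/ord3P; rewrite !lift3E !ins3E ?conjC0 ?conjC1 /=; ring.
Qed.

End CrossProduct.

(** * Charts of the projective plane *)

Section Charts.
Variable R : realType.
Implicit Types (z u v : 'cV[R[i]]_3) (p : CP2 R) (k j : 'I_3) (x : 'rV[R]_4).

Lemma hcoord_neq0 p : hcoord p != 0.
Proof.
rewrite /hcoord; case: (repr p) => z zP /=.
by move: zP; rewrite inE.
Qed.

Lemma proj_pt_hcoord p : proj_pt (hcoord p) = p.
Proof.
rewrite /proj_pt /hcoord valKd; exact: reprK.
Qed.

Lemma insubd_C3x z : z != 0 -> val (insubd (C3x_default R) z) = z.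
Proof. by move=> z0; rewrite insubdK// inE. Qed.

Lemma pi_CP2_eqP (s t : C3x R) :
  \pi_(CP2 R) s = \pi_(CP2 R) t <-> exists l : R[i], l != 0 /\ val t = l *: val s.
Proof.
have -> : (\pi_(CP2 R) s = \pi_(CP2 R) t) = (s = t %[mod {eq_quot (@same_line R)}]).
  by [].
split=> [/eqmodP/asboolP//|h]; exact/eqmodP/asboolP.
Qed.

Lemma hcoord_proj_pt z : z != 0 -> exists2 l : R[i], l != 0 & hcoord (proj_pt z) = l *: z.
Proof.
move=> z0; rewrite /hcoord /proj_pt.
set s := insubd _ z.
have /pi_CP2_eqP[l [l0 e]] : \pi_(CP2 R) s = \pi_(CP2 R) (repr (\pi_(CP2 R) s)).
  by rewrite reprK.
by exists l => //; rewrite e /s insubd_C3x.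
Qed.

Lemma proj_ptZ z (l : R[i]) : z != 0 -> l != 0 -> proj_pt (l *: z) = proj_pt z.
Proof.
move=> z0 l0; rewrite /proj_pt.
have lz0 : l *: z != 0 by rewrite scaler_eq0 negb_or l0.
by apply/esym/pi_CP2_eqP; exists l; rewrite !insubd_C3x.
Qed.

Lemma insert_coordk k (c : R[i]) w : insert_coord k c w k 0 = c.
Proof. by rewrite mxE unlift_none. Qed.

Lemma insert_coord_lift k (c : R[i]) w (j : 'I_2) : insert_coord k c w (lift k j) 0 = w 0 j.
Proof. by rewrite mxE liftK. Qed.

Lemma insert_coord1_neq0 k (w : 'rV[R[i]]_2) : insert_coord k 1 w != 0.
Proof.
by apply/eqP => /colP/(_ k); rewrite insert_coordk mxE => /eqP; rewrite oner_eq0.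
Qed.

Lemma col3_eq k z u : z k 0 = u k 0 -> (forall j : 'I_2, z (lift k j) 0 = u (lift k j) 0) -> z = u.
Proof.
move=> ek el; apply/colP => i.
by case: (unliftP k i) => [j ->|->].
Qed.

Lemma toCE x (j : 'I_2) :
  toC x 0 j = (x 0 (lshift 2 j : 'I_4) +i* x 0 (rshift 2 j : 'I_4))%C.
Proof. by rewrite mxE. Qed.

Lemma ofC_lshift (w : 'rV[R[i]]_2) (j : 'I_2) :
  ofC w 0 (lshift 2 j : 'I_4) = complex.Re (w 0 j).
Proof. by rewrite /ofC (@row_mxEl _ 1 2 2) mxE. Qed.

Lemma ofC_rshift (w : 'rV[R[i]]_2) (j : 'I_2) :
  ofC w 0 (rshift 2 j : 'I_4) = complex.Im (w 0 j).
Proof. by rewrite /ofC (@row_mxEr _ 1 2 2) mxE. Qed.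

Lemma ofCK : cancel (@ofC R) (@toC R).
Proof.
by move=> w; apply/rowP => j; rewrite toCE ofC_lshift ofC_rshift; case: (w 0 j).
Qed.

Lemma ord4P (P : 'I_4 -> Prop) :
  (forall j : 'I_2, P (lshift 2 j)) -> (forall j : 'I_2, P (rshift 2 j)) -> forall i, P i.
Proof.
by move=> Pl Pr i; case: (@split_ordP 2 2 i) => j ->.
Qed.

Lemma toCK : cancel (@toC R) (@ofC R).
Proof.
move=> x; apply/rowP; elim/ord4P => j; rewrite ?ofC_lshift ?ofC_rshift toCE//.
Qed.

Lemma chart_proj k z : z != 0 ->
  chart k (proj_pt z) = ofC (\row_j (z (lift k j) 0 / z k 0)).
Proof.
move=> z0; rewrite /chart; have [l l0 ->] := hcoord_proj_pt z0.
congr ofC; apply/rowP => j; rewrite !mxE.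
by rewrite invfM mulrACA divff// mul1r.
Qed.

Lemma chart_dom_proj k z : z != 0 -> chart_dom k (proj_pt z) <-> z k 0 != 0.
Proof.
move=> z0; rewrite /chart_dom /=; have [l l0 ->] := hcoord_proj_pt z0.
by rewrite mxE mulf_eq0 (negPf l0).
Qed.

Lemma chart_dom_inv k x : chart_dom k (chart_inv k x).
Proof.
by apply/chart_dom_proj; rewrite ?insert_coord1_neq0// insert_coordk oner_eq0.
Qed.

Lemma chart_invK k : cancel (chart_inv k) (@chart R k).
Proof.
move=> x; rewrite chart_proj ?insert_coord1_neq0// -[RHS]toCK; congr ofC.
by apply/rowP => j; rewrite mxE insert_coordk divr1 insert_coord_lift.
Qed.

Lemma insert_chart k z : z != 0 -> z k 0 != 0 ->
  insert_coord k 1 (toC (chart k (proj_pt z))) = (z k 0)^-1 *: z.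
Proof.
move=> z0 zk; apply: (@col3_eq k); rewrite ?insert_coordk ?mxE ?mulVf// => j.
by rewrite insert_coord_lift chart_proj// ofCK !mxE mulrC.
Qed.

Lemma chartK k p : chart_dom k p -> chart_inv k (chart k p) = p.
Proof.
move=> pk; rewrite -[p in RHS]proj_pt_hcoord /chart_inv -{1}[p]proj_pt_hcoord.
by rewrite insert_chart ?hcoord_neq0// proj_ptZ ?hcoord_neq0// invr_eq0.
Qed.

Lemma exists_chart p : exists k, chart_dom k p.
Proof.
apply: contrapT => H; have /eqP := hcoord_neq0 p; apply; apply/colP => i.
by rewrite mxE; apply/eqP/negPn/negP => h; apply: H; exists i.
Qed.

End Charts.

(** * Continuity of matrix-valued and complex-valued maps *)

Section Topology.
Variable R : realType.
Local Notation K := (R[i] : numFieldType).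

Lemma continuous_mxP (T U : topologicalType) m n (f : T -> 'M[U]_(m, n)) x :
  {for x, continuous f} <-> forall i j, {for x, continuous (fun y => f y i j)}.
Proof.
split=> [cf i j A fA|cf A [P fP PA]].
  rewrite /= nbhs_simpl /=; apply: (cf [set M | A (M i j)]).
  exists (fun i' j' => if (i' == i) && (j' == j) then A else setT).
    move=> i' j'; case: ifP => [/andP[/eqP -> /eqP ->]//|_]; exact: filterT.
  by move=> M /(_ i j); rewrite !eqxx.
rewrite /= nbhs_simpl /=; near=> y; apply: PA => i j.
suff : (forall ij : 'I_m * 'I_n, P ij.1 ij.2 (f y ij.1 ij.2)) by move/(_ (i, j)).
near: y; apply: filter_forall => -[i' j'] /=.
exact: (cf i' j' _ (fP i' j')).
Unshelve. all: by end_near. Qed.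

Lemma nbhs_dist_lt (z : K) (e : R) : 0 < e ->
  \forall w \near z, `|z - w| < e%:C%C :> R[i].
Proof.
move=> e0; have e0' : 0 < e%:C%C :> K by rewrite ltcR.
have := nbhsx_ballx z _ e0'.
by apply: (@filterS _ _ (nbhs_filter z)) => w; rewrite -ball_normE.
Qed.

Lemma Re_continuous : continuous (@complex.Re R : K -> R).
Proof.
move=> z; apply/(@cvgrPdist_lt _ _ _ _ (nbhs_filter z)) => e e0.
apply: (@filterS _ _ (nbhs_filter z)) (nbhs_dist_lt z e0) => w zw; rewrite -ltcR; apply: le_lt_trans zw.
by rewrite -cReN -cReD; exact: normc_ge_Re.
Qed.

Lemma Im_continuous : continuous (@complex.Im R : K -> R).
Proof.
move=> z; apply/(@cvgrPdist_lt _ _ _ _ (nbhs_filter z)) => e e0.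
apply: (@filterS _ _ (nbhs_filter z)) (nbhs_dist_lt z e0) => w zw; rewrite -ltcR; apply: le_lt_trans zw.
rewrite -cImN -cImD -normrN -ReiNIm.
by apply: le_trans (normc_ge_Re _) _; rewrite normrM complexiE normCi mulr1.
Qed.

Lemma complex_of_real_continuous : continuous (fun r : R => r%:C%C : K).
Proof.
move=> r; apply/cvgrPdist_lt => e e0.
(* In the order of [R[i]] a positive number is real. *)
have eE : e = (complex.Re e)%:C%C.
  by case: e e0 => a b; rewrite ltcE /= => /andP[/eqP -> _].
have re0 : 0 < complex.Re e by move: e0; rewrite {1}eE ltcR.
have : \forall s \near r, `|r - s| < complex.Re e.
  by have := nbhsx_ballx r _ re0; apply: filterS => w; rewrite -ball_normE.
apply: filterS => s rs.
by rewrite -rmorphB /= normc_def /= expr0n /= addr0 sqrtr_sqr eE ltcR.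
Qed.

Lemma continuous_complexP (T : topologicalType) (f : T -> K) x :
  {for x, continuous f} <->
  {for x, continuous (fun y => complex.Re (f y))} /\ {for x, continuous (fun y => complex.Im (f y))}.
Proof.
split=> [cf|[cr ci]].
  split; first exact: (continuous_comp cf (@Re_continuous (f x))).
  exact: (continuous_comp cf (@Im_continuous (f x))).
have -> : f = (fun y => (complex.Re (f y))%:C%C + 'i%C * (complex.Im (f y))%:C%C).
  by apply/funext => y; rewrite -complexE.
apply: continuousD; last apply: continuousM.
- exact: (continuous_comp cr (@complex_of_real_continuous _)).
- exact: cst_continuous.
- exact: (continuous_comp ci (@complex_of_real_continuous _)).
Qed.

End Topology.

Lemma line_continuous (R : realType) (V : normedModType R) (x v : V) :
  continuous (fun t : R => t *: v + x).
Proof.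
move=> t; have c1 : {for t, continuous (fun t : R => t *: v)} by exact: scalel_continuous.
have c2 : {for t, continuous (fun _ : R => x)} by exact: cst_continuous.
exact: (continuousD c1 c2).
Qed.

Section ChartTopology.
Variable R : realType.
Local Notation K := (R[i] : numFieldType).
Implicit Types (p : CP2 R) (k j : 'I_3) (x : 'rV[R]_4).

Lemma val_C3x_continuous : continuous (val : C3x R -> 'cV[K]_3).
Proof. exact: initial_continuous. Qed.

(** The subtype has the initial topology for [val], and [insubd] never takes its default because [f]
    has no zero. The projection to the quotient is continuous. *)
Lemma proj_pt_continuous (T : topologicalType) (f : T -> 'cV[K]_3) :
  continuous f -> (forall y, f y != 0) -> continuous (fun y => proj_pt (f y)).
Proof.
move=> cf f0.
pose g y : C3x R := insubd (C3x_default R) (f y).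
have vg : (val : C3x R -> 'cV[K]_3) \o g = f.
  by apply/funext => y; rewrite /= insubd_C3x.
have cg : continuous g.
  apply/continuousP => A [B oB <-].
  rewrite -comp_preimage vg.
  by move/continuousP: cf; apply.
move=> y; apply: (continuous_comp (cg y)); exact: pi_continuous.
Qed.

Lemma insert_toC_continuous k (c : R[i]) :
  continuous (fun x : 'rV[R]_4 => insert_coord k c (toC x) : 'cV[K]_3).
Proof.
move=> x; apply/continuous_mxP => i j; rewrite [j]ord1.
have [i' ->|->] := unliftP k i; last first.
  rewrite (_ : (fun y => _) = fun=> c); first exact: cst_continuous.
  by apply/funext => y; rewrite insert_coordk.
rewrite (_ : (fun y => _) = fun y : 'rV[R]_4 => toC y 0 i' : K); last first.
  by apply/funext => y; rewrite insert_coord_lift.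
apply/continuous_complexP; split.
  rewrite (_ : (fun y => _) = fun y : 'rV[R]_4 => y 0 (lshift 2 i' : 'I_4)); first exact: coord_continuous.
  by apply/funext => y; rewrite toCE.
rewrite (_ : (fun y => _) = fun y : 'rV[R]_4 => y 0 (rshift 2 i' : 'I_4)); first exact: coord_continuous.
by apply/funext => y; rewrite toCE.
Qed.

Lemma chart_inv_continuous k : continuous (@chart_inv R k).
Proof.
apply: proj_pt_continuous; last by move=> y; exact: insert_coord1_neq0.
exact: insert_toC_continuous.
Qed.

Lemma pi_CP2E (s : C3x R) : \pi_(CP2 R) s = proj_pt (val s).
Proof. by rewrite /proj_pt valKd. Qed.

Lemma val_C3x_neq0 (s : C3x R) : val s != 0.
Proof. by case: s => z zP /=; move: zP; rewrite inE. Qed.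

(** Openness in the quotient is openness of the preimage among nonzero vectors. There the chart,
    defined through an arbitrary representative, becomes the continuous ratio map [F]. *)
Lemma open_chart k (B : set 'rV[R]_4) : open B ->
  open [set p | chart_dom k p /\ B (chart k p)].
Proof.
move=> oB; pose F (z : 'cV[K]_3) : 'rV[R]_4 := ofC (\row_j (z (lift k j) 0 / z k 0)).
pose S := [set z : 'cV[K]_3 | z k 0 != 0 /\ B (F z)].
have cz (i : 'I_3) (z : 'cV[K]_3) : {for z, continuous (fun z : 'cV[K]_3 => z i 0 : K)}.
  exact: coord_continuous.
have oS : open S.
  rewrite openE => z [zk Bz]; rewrite /interior.
  have cF : {for z, continuous F}.
    apply/continuous_mxP => i0 i; rewrite [i0]ord1.
    have cq (j : 'I_2) : {for z, continuous (fun z : 'cV[K]_3 => z (lift k j) 0 / z k 0 : K)}.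
      by apply: continuousM; [exact: cz|exact: (cvgV zk (cz k z))].
    elim/ord4P: i => j.
      rewrite (_ : (fun y => _) = fun y : 'cV[K]_3 => complex.Re (y (lift k j) 0 / y k 0)).
        by have /continuous_complexP[] := cq j.
      by apply/funext => y; rewrite ofC_lshift mxE.
    rewrite (_ : (fun y => _) = fun y : 'cV[K]_3 => complex.Im (y (lift k j) 0 / y k 0)).
      by have /continuous_complexP[] := cq j.
    by apply/funext => y; rewrite ofC_rshift mxE.
  apply: filterI; last by apply: cF; move: oB; rewrite openE; apply.
  exact: (cvgr_neq0 _ (cz k z) zk).
rewrite /open /= /quotient_open.
rewrite (_ : _ @^-1` _ = (val : C3x R -> 'cV[K]_3) @^-1` S); last first.
  apply/seteqP; split=> s /=; rewrite pi_CP2E.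
    by move=> [/chart_dom_proj]; rewrite val_C3x_neq0 => /(_ isT) sk;
      rewrite chart_proj ?val_C3x_neq0.
  by move=> [sk Bs]; split; [apply/chart_dom_proj => //; exact: val_C3x_neq0|
    rewrite chart_proj ?val_C3x_neq0].
by move/continuousP: val_C3x_continuous; apply.
Qed.

Lemma chart_img_open (U : set (CP2 R)) k : open U -> open (chart_img U k).
Proof. by move=> oU; move/continuousP: (@chart_inv_continuous k); apply. Qed.

(** The ball is the union of the segments from its centre. *)
Lemma ball_connected (x : 'rV[R]_4) (r : R) : connected (ball x r).
Proof.
have -> : ball x r = \bigcup_(y in ball x r) ((fun t : R => t *: (y - x) + x) @` `[0, 1]).
  apply/seteqP; split=> y.
    move=> xy; exists y => //; exists 1; first by rewrite /= in_itv /= lexx ler01.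
    by rewrite scale1r subrK.
  move=> [z xz [t]]; rewrite /= in_itv /= => /andP[t0 t1] <-.
  move: xz; rewrite -!ball_normE /= opprD addrCA subrr addr0 normrN normrZ => xz.
  rewrite ger0_norm//; apply: le_lt_trans xz.
  by rewrite [leRHS]distrC ler_piMl.
apply: bigcup_connected.
  exists x => y _; exists 0; first by rewrite /= in_itv /= lexx ler01.
  by rewrite scale0r add0r.
move=> y _; apply: connected_continuous_connected; first exact: segment_connected.
exact/continuous_subspaceT/line_continuous.
Qed.

End ChartTopology.

(** * The metric of a hermitian matrix *)

Lemma differentiable_rV (R : realType) (V : normedModType R) n (f : V -> 'rV[R]_n.+1) x :
  (forall i, differentiable (fun y => f y 0 i) x) -> differentiable f x.
Proof.
move=> df.
rewrite (_ : f = \sum_(i < n.+1) (fun y => f y 0 i *: delta_mx 0 i)); last first.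
  by apply/funext => y; rewrite fct_sumE; exact: row_sum_delta.
by apply: differentiable_sum => i; exact: differentiableZl.
Qed.

Section Metric.
Variable R : realType.
Implicit Types (z : 'cV[R[i]]_3) (C : 'M[R[i]]_3) (p : CP2 R) (k j : 'I_3).
Implicit Types (x : 'rV[R]_4).

Definition gmet C z u v : R := complex.Re (nform C z u v / dform C z ^+ 2).

Definition affpt k x : 'cV[R[i]]_3 := insert_coord k 1 (toC x).

(** The differential of [affpt k], the same at every point. *)
Definition tang k x : 'cV[R[i]]_3 := insert_coord k 0 (toC x).

Definition gC C : cotensor2 R := fun k x =>
  \matrix_(a, b) gmet C (affpt k x) (tang k (delta_mx 0 a)) (tang k (delta_mx 0 b)).

Lemma tangDl k (l : R) x y : tang k (l *: x + y) = l%:C%C *: tang k x + tang k y.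
Proof.
apply: (@col3_eq _ k) => [|j]; rewrite 2![in RHS]mxE ?insert_coordk ?mulr0 ?addr0//.
rewrite !insert_coord_lift !toCE !mxE.
by apply: complex_eqP; rewrite /= ?mul0r ?subr0 ?addr0 ?add0r.
Qed.

Lemma tang0 k : tang k 0 = 0.
Proof.
apply: (@col3_eq _ k) => [|j]; rewrite [in RHS]mxE ?insert_coordk//.
by rewrite insert_coord_lift toCE !mxE.
Qed.

Lemma tang_inj k : injective (tang k).
Proof.
move=> x y e; rewrite -[x]toCK -[y]toCK; congr ofC; apply/rowP => j.
by move/colP/(_ (lift k j)): e; rewrite !insert_coord_lift.
Qed.

Lemma tang_sum k x : tang k x = \sum_a (x 0 a)%:C%C *: tang k (delta_mx 0 a).
Proof.
rewrite {1}[x]row_sum_delta.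
elim: (index_enum 'I_4) => [|i s IH]; first by rewrite !big_nil tang0.
by rewrite !big_cons tangDl IH.
Qed.

Lemma cReZ (r : R) (c : R[i]) : complex.Re (r%:C%C * c) = r * complex.Re c.
Proof. by rewrite cReM cReR cImR mul0r subr0. Qed.

Lemma gmetDl C z u u' v (l : R) :
  gmet C z (l%:C%C *: u + u') v = l * gmet C z u v + gmet C z u' v.
Proof.
by rewrite /gmet nformDl mulrDl -mulrA cReD cReZ.
Qed.

Lemma gmetDr C z u v v' (l : R) :
  gmet C z u (l%:C%C *: v + v') = l * gmet C z u v + gmet C z u v'.
Proof.
by rewrite /gmet nformDr conjR mulrDl -mulrA cReD cReZ.
Qed.

Lemma gmet0l C z v : gmet C z 0 v = 0.
Proof. by rewrite /gmet nform0l mul0r. Qed.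

Lemma gmet0r C z v : gmet C z v 0 = 0.
Proof. by rewrite /gmet nform0r mul0r. Qed.

Lemma bilE (G : 'M[R]_4) x y : bil G x y = \sum_a \sum_b x 0 a * G a b * y 0 b.
Proof.
rewrite /bil mxE exchange_big; apply: eq_bigr => b _.
by rewrite !mxE big_distrl; apply: eq_bigr => a _.
Qed.

Lemma bil_delta (G : 'M[R]_4) (a b : 'I_4) : bil G (delta_mx 0 a) (delta_mx 0 b) = G a b.
Proof.
rewrite bilE (bigD1 a)//= (bigD1 b)//= !mxE !eqxx mul1r mulr1.
rewrite !big1 ?addr0// => [i|i] /negPf ia.
  by rewrite big1// => j _; rewrite !mxE ia andbF !mul0r.
by rewrite !mxE ia andbF mulr0.
Qed.

Lemma bil_eq (G H : 'M[R]_4) : (forall x y, bil G x y = bil H x y) -> G = H.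
Proof. by move=> e; apply/matrixP => a b; rewrite -!bil_delta. Qed.

Lemma bil_gC C k x (u v : 'rV[R]_4) :
  bil (gC C k x) u v = gmet C (affpt k x) (tang k u) (tang k v).
Proof.
rewrite bilE [in RHS]tang_sum.
have -> : gmet C (affpt k x) (\sum_a (u 0 a)%:C%C *: tang k (delta_mx 0 a)) (tang k v) =
    \sum_a u 0 a * gmet C (affpt k x) (tang k (delta_mx 0 a)) (tang k v).
  elim: (index_enum 'I_4) => [|i s IH]; first by rewrite !big_nil gmet0l.
  by rewrite !big_cons gmetDl IH.
apply: eq_bigr => a _; rewrite [in RHS](tang_sum k v).
elim: (index_enum 'I_4) => [|i s IH]; first by rewrite !big_nil gmet0r mulr0.
by rewrite !big_cons gmetDr IH mulrDr mxE mulrA mulrAC.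
Qed.

Lemma gmet_scale C z u v (l m m' : R[i]) : l != 0 ->
  gmet C (l *: z) (l *: u + m *: z) (l *: v + m' *: z) = gmet C z u v.
Proof.
move=> l0; have c0 : (l * l^*) ^+ 2 != 0 by rewrite expf_neq0// mulf_neq0// conj_eq0.
rewrite /gmet nform_scale dform_scale [(_ * dform _ _) ^+ 2]exprMn; congr complex.Re.
by rewrite invfM mulrACA divff ?mul1r.
Qed.

(* chart j o proj_pt *)
Definition affine j z : 'rV[R]_4 := ofC (\row_i (z (lift j i) 0 / z j 0)).

Lemma affpt_affine j z : z j 0 != 0 -> affpt j (affine j z) = (z j 0)^-1 *: z.
Proof.
move=> zj; apply: (@col3_eq _ j) => [|i]; first by rewrite [in RHS]mxE insert_coordk mulVf.
by rewrite insert_coord_lift ofCK !mxE mulrC.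
Qed.

Section AffineDerivative.
Variables (V : normedModType R) (Z dZ : V -> 'cV[R[i]]_3) (x : V) (j : 'I_3).
Hypothesis DZ : forall i, cdiff (fun y => Z y i 0) x (fun v => dZ v i 0).
Hypothesis Zj : Z x j 0 != 0.

Let Dq (i : 'I_2) := cdiffM (DZ (lift j i)) (cdiffV Zj (DZ j)).

Lemma differentiable_affine : differentiable (fun y => affine j (Z y)) x.
Proof.
apply: differentiable_rV; elim/ord4P => i; have [dr di _] := Dq i.
  by under eq_fun do rewrite ofC_lshift mxE.
by under eq_fun do rewrite ofC_rshift mxE.
Qed.

(** The quotient rule for Z / Z_j, whose j-th component is the constant 1 that [affine j] omits. *)
Lemma derive_affine v : tang j ('D_v (fun y => affine j (Z y)) x) =
  (Z x j 0)^-1 *: dZ v - (dZ v j 0 / Z x j 0 ^+ 2) *: Z x.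
Proof.
have dF : derivable (fun y => affine j (Z y)) x v.
  exact/diff_derivable/differentiable_affine.
apply: (@col3_eq _ j) => [|i].
  rewrite insert_coordk !mxE.
  by field.
rewrite insert_coord_lift toCE derive_mx// !mxE.
have [_ _ /(_ v)[er ei]] := Dq i.
rewrite (_ : (fun y => _) = fun y => complex.Re (Z y (lift j i) 0 / Z y j 0)); last first.
  by apply/funext => y; rewrite ofC_lshift mxE.
rewrite (_ : (fun y => affine j (Z y) 0 (rshift 2 i : 'I_4)) =
    fun y => complex.Im (Z y (lift j i) 0 / Z y j 0)); last first.
  by apply/funext => y; rewrite ofC_rshift mxE.
rewrite er ei -[LHS]/((complex.Re _) +i* (complex.Im _))%C.
rewrite (_ : forall c : R[i], (complex.Re c +i* complex.Im c)%C = c); last by case.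
by field.
Qed.

End AffineDerivative.

Lemma cdiff_affpt k x i : cdiff (fun y => affpt k y i 0) x (fun v => tang k v i 0).
Proof.
case: (unliftP k i) => [j|] ->; last first.
  apply: cdiff_ext (cdiff_eq (cdiff_cst 1 x) _) _ => y; by rewrite insert_coordk.
split.
- rewrite (_ : (fun y => _) = fun y : 'rV[R]_4 => y 0 (lshift 2 j : 'I_4)).
    exact: differentiable_coord.
  by apply/funext => y; rewrite insert_coord_lift toCE.
- rewrite (_ : (fun y => _) = fun y : 'rV[R]_4 => y 0 (rshift 2 j : 'I_4)).
    exact: differentiable_coord.
  by apply/funext => y; rewrite insert_coord_lift toCE.
move=> v.
rewrite (_ : (fun y => complex.Re _) = fun y : 'rV[R]_4 => y 0 (lshift 2 j : 'I_4)); last first.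
  by apply/funext => y; rewrite insert_coord_lift toCE.
rewrite (_ : (fun y => complex.Im _) = fun y : 'rV[R]_4 => y 0 (rshift 2 j : 'I_4)); last first.
  by apply/funext => y; rewrite insert_coord_lift toCE.
have dI : derivable (id : 'rV[R]_4 -> 'rV[R]_4) x v by exact: derivable_id.
have := derive_mx dI; rewrite derive_id => /rowP e.
by rewrite insert_coord_lift toCE; split; rewrite [RHS]e mxE.
Qed.

Lemma affpt_neq0 k x : affpt k x != 0.
Proof. exact: insert_coord1_neq0. Qed.

Lemma transitionE k j : transition k j = (fun y => affine j (affpt k y)).
Proof. by apply/funext => y; rewrite /transition chart_proj// affpt_neq0. Qed.

Lemma chart_dom_affpt k j x : chart_dom j (chart_inv k x) <-> affpt k x j 0 != 0.
Proof. by apply: chart_dom_proj; exact: affpt_neq0. Qed.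

(** A change of chart rescales the homogeneous vector and its tangent lifts by the same factor, up
    to multiples of the vector; [gmet] is invariant under this. *)
Lemma gC_cotensor2 C (U : set (CP2 R)) : is_cotensor2 U (gC C).
Proof.
move=> k j x _ /chart_dom_affpt xj D.
have dT := differentiable_affine (cdiff_affpt k x) xj.
have DE u : tang j (u *m D) =
    (affpt k x j 0)^-1 *: tang k u + (- (tang k u j 0 / affpt k x j 0 ^+ 2)) *: affpt k x.
  rewrite scaleNr -(derive_affine (cdiff_affpt k x) xj) -transitionE deriveEjacobian//.
  by rewrite transitionE.
apply: bil_eq => u v.
have -> : bil (D *m gC C j (transition k j x) *m D^T) u v =
    bil (gC C j (transition k j x)) (u *m D) (v *m D).
  by rewrite /bil trmx_mul !mulmxA.
rewrite bil_gC bil_gC DE DE transitionE affpt_affine//.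
by rewrite gmet_scale// invr_eq0.
Qed.

End Metric.

(** * Comparison with the metric written in the Maurer-Cartan form *)

Section Induced.
Variable R : realType.
Implicit Types (z : 'cV[R[i]]_3) (C a : 'M[R[i]]_3) (p : CP2 R) (k : 'I_3).
Implicit Types (x : 'rV[R]_4).

Lemma hform_delta C (i j : 'I_3) : hform C (delta_mx i 0) (delta_mx j 0) = C i j.
Proof.
by rewrite /hform trmx_delta -rowE map_delta_mx -colE !mxE.
Qed.

Lemma hformN C u v : ((hform C (- u) v = - hform C u v) * (hform C u (- v) = - hform C u v))%type.
Proof.
rewrite /hform linearN /= map_mxN !mulNmx mulmxN !mxE; split=> //.
Qed.

Lemma crossv_delta1 :
  crossv (delta_mx 0 0 : 'cV[R[i]]_3) (delta_mx (1 : 'I_3) 0) = delta_mx (2 : 'I_3) 0.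
Proof.
apply/colP; elim/ord3P; rewrite !mxE !ord3E /=; ring.
Qed.

Lemma crossv_delta2 :
  crossv (delta_mx 0 0 : 'cV[R[i]]_3) (delta_mx (2 : 'I_3) 0) = - delta_mx (1 : 'I_3) 0.
Proof.
apply/colP; elim/ord3P; rewrite !mxE !ord3E /=; ring.
Qed.

(** From e_0 × e_1 = e_2 and e_0 × e_2 = - e_1: this accounts for the signs and the exchanged
    indices in [hmx]. *)
Lemma hmx_nform C a i j : \det a = 1 ->
  hmx (Hmx C a) i j = nform C (col 0 a) (col (lift 0 i) a) (col (lift 0 j) a).
Proof.
move=> a1; rewrite !colE nform_frame// -/(Hmx C a) mxE /nform.
move: i j; elim/ord2P; elim/ord2P; rewrite !lift3E ?crossv_delta1
  ?crossv_delta2 ?hformN ?hform_delta ?opprK //.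
Qed.

Lemma induced_det C a : hermitian3 C -> \det a = 1 ->
  let h := hmx (Hmx C a) in
  h 0 0 * h 1 1 - `|h 0 1| ^+ 2 = dform C (col 0 a).
Proof.
move=> hC a1 h; rewrite normCK /h !hmx_nform// nform_conj// !lift3E nform_gram a1.
by rewrite conjC1 !mul1r.
Qed.

Lemma col0_frame a (X : 'M[R[i]]_3) : \det a = 1 ->
  col 0 X = maurer_cartan a 1 0 X *: col 1 a +
    (maurer_cartan a 2 0 X *: col 2 a + maurer_cartan a 0 0 X *: col 0 a).
Proof.
move=> a1; have aU : a \in unitmx by rewrite unitmxE a1 unitr1.
have e l : maurer_cartan a l 0 X = (invmx a *m col 0 X) l 0.
  by rewrite /maurer_cartan !mxE; apply: eq_bigr => m _; rewrite mxE.
have {1}-> : col 0 X = a *m (invmx a *m col 0 X) by rewrite mulmxA mulmxV// mul1mx.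
rewrite !e; move: (invmx a *m col 0 X) => y.
by apply/colP => i; rewrite !mxE sum3E; ring.
Qed.

(** Expand both first columns in the frame [a]; the components along [col 0 a] do not contribute. *)
Lemma nform_frame_sum C a (X Y : 'M[R[i]]_3) : \det a = 1 ->
  nform C (col 0 a) (col 0 X) (col 0 Y) =
  \sum_i \sum_j hmx (Hmx C a) i j * (maurer_cartan a (lift 0 i) 0 X *
     (maurer_cartan a (lift 0 j) 0 Y)^*).
Proof.
move=> a1; rewrite (col0_frame X a1) (col0_frame Y a1).
rewrite !nformDl !nformDr !nformZl !nformZr !nform_zl !nform_zr.
have e := hmx_nform C _ _ a1.
rewrite !sum2E !e !lift3E.
move: (nform _ _ _ _) (nform _ _ _ _) (nform _ _ _ _) (nform _ _ _ _) => n1 n2 n3 n4.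
move: (maurer_cartan _ _ _ _) (maurer_cartan _ _ _ _) => x1 x2.
ring.
Qed.

(** Half the sum with the conjugate; [nform] is hermitian and [dform] is real. The same
    symmetrisation is built into [sym_prod]. *)
Lemma gmetE C z u v : hermitian3 C ->
  (gmet C z u v)%:C%C = (nform C z u v + nform C z v u) / 2 / dform C z ^+ 2.
Proof.
move=> hC; rewrite /gmet ReJ_add -conjE rmorphM fmorphV rmorphXn /= dform_conj// nform_conj//.
by rewrite -mulrDl mulrAC.
Qed.

Lemma induced_sum C a (X Y : 'M[R[i]]_3) : hermitian3 C -> \det a = 1 ->
  let theta (i : 'I_2) := maurer_cartan a (lift 0 i) 0 in
  (gmet C (col 0 a) (col 0 X) (col 0 Y))%:C%C =
  (\sum_i \sum_j hmx (Hmx C a) i j *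
    sym_prod (theta i) (fun Z => (theta j Z)^*) X Y) / dform C (col 0 a) ^+ 2.
Proof.
move=> hC a1 theta; rewrite gmetE//; congr (_ / _).
rewrite !nform_frame_sum// -big_split /= mulr_suml; apply: eq_bigr => i _.
rewrite -big_split /= mulr_suml; apply: eq_bigr => j _.
by rewrite /sym_prod /theta; ring.
Qed.

(** Only the first column enters, and it moves along a straight line, so the quotient rule of
    [derive_affine] applies. *)
Lemma dpi_SL_tang k a (X : 'M[R[i]]_3) : a k 0 != 0 ->
  tang k (dpi_SL k a X) = (a k 0)^-1 *: col 0 X + (- (X k 0 / a k 0 ^+ 2)) *: col 0 a.
Proof.
move=> ak.
pose Z (t : R) := col 0 (a + t%:C%C *: X).
have DZ i : cdiff (fun t : R => Z t i 0) 0 (fun h : R => (h%:C%C *: col 0 X) i 0).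
  have D0 : cdiff (fun t : R => t%:C%C : R[i]) 0 (fun h : R => h%:C%C).
    split=> [||h]; [by apply/derivable1_diffP; exact: derivable_id|exact: differentiable_cst|].
    by rewrite derive_cst derive_id.
  have := cdiffD (cdiff_cst (a i 0) (0 : R)) (cdiffM D0 (cdiff_cst (X i 0) (0 : R))).
  move=> D; apply: cdiff_ext (cdiff_eq D _) _ => [h|t]; rewrite /Z !mxE//.
  by rewrite mulr0 addr0 add0r.
have Z0 : Z 0 = col 0 a by rewrite /Z scale0r addr0.
have Zk : Z 0 k 0 != 0 by rewrite Z0 mxE.
have := derive_affine DZ Zk 1; rewrite scale1r Z0 !mxE scaleNr => <-.
rewrite /dpi_SL derive1E; congr tang; apply: near_eq_derive.
have [dr di _] := DZ k.
(* The formula for the chart holds where the first column is nonzero, which is ensured near [t = 0]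
   by its k-th entry. *)
have cZ : {for (0 : R), continuous (fun t : R => Z t k 0 : (R[i] : numFieldType))}.
  by apply/continuous_complexP; split; exact: differentiable_continuous.
near=> t; rewrite /pi_SL chart_proj//.
apply/eqP => /colP/(_ k); rewrite [in RHS]mxE; apply/eqP.
by near: t; exact: (cvgr_neq0 _ cZ Zk).
Unshelve. all: by end_near. Qed.

Lemma induced_by_of (U : set (CP2 R)) (g : cotensor2 R) C : hermitian3 C ->
  (forall p, U p -> dform C (hcoord p) != 0 /\
     forall k, chart_dom k p -> g k (chart k p) = gC C k (chart k p)) ->
  induced_by U g C.
Proof.
move=> hC H a a1 Ua h d theta.
have a0 : col 0 a != 0.
  apply: contra_eq_neq a1 => a0; rewrite (expand_det_col _ 0) big1 ?(eq_sym 0) ?oner_eq0//.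
  by move=> i _; move/colP/(_ i): a0; rewrite !mxE => ->; rewrite mul0r.
have dE : d = dform C (col 0 a) by exact: induced_det.
have [+ gE] := H _ Ua.
have [l l0 ->] := hcoord_proj_pt a0.
rewrite dform_scale => d0; have {}d0 : d != 0.
  by rewrite dE; apply: contraNneq d0 => ->; rewrite mulr0.
split=> // k X Y kp _ _; rewrite gE// dE /h /theta -induced_sum//.
have ak : a k 0 != 0 by move/chart_dom_proj: kp => /(_ a0); rewrite mxE.
have zE : affpt k (chart k (pi_SL a)) = (a k 0)^-1 *: col 0 a.
  have ck : (col 0 a) k 0 = a k 0 by rewrite mxE.
  by have := insert_chart a0; rewrite -ck; apply; rewrite ck.
have ak' : (a k 0)^-1 != 0 by rewrite invr_eq0.
move: (dpi_SL k a X) (dpi_SL k a Y) (dpi_SL_tang X ak) (dpi_SL_tang Y ak).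
move=> dX dY eX eY; rewrite bil_gC zE eX eY.
by rewrite (gmet_scale C _ _ _ _ _ ak').
Qed.

Lemma frame_at k x : exists a, \det a = 1 /\ col 0 a = affpt k x.
Proof.
pose e i : R[i] := (i == lift k 0)%:R; pose f i : R[i] := (i == lift k 1)%:R.
(* The columns are the affine point and the two other basis vectors; the sign [(-1) ^+ k] is that of
   the permutation [k, lift k 0, lift k 1] and makes the determinant 1. *)
exists (\matrix_(i, j) if j == 0 then affpt k x i 0 else
  if j == 1 then (-1) ^+ k * e i else f i); split; last first.
  by apply/colP => i; rewrite !mxE.
have := insert_coordk k 1 (toC x); rewrite -/(affpt k x) det3E !mxE /= /e /f.
move: k (affpt k x) {e f}; elim/ord3P => z z1; rewrite !lift3E z1 /= ?expr0 ?expr1 ?sqrrN ?expr1n; ring.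
Qed.

(** Over each affine point there is a frame in SL(3), and each tangent vector of the chart lifts to
    a vector tangent to SL(3) there; the defining equation on these lifts gives all components of
    [g]. *)
Lemma induced_by_at (U : set (CP2 R)) (g : cotensor2 R) C : hermitian3 C ->
  induced_by U g C -> forall k x, chart_img U k x ->
  dform C (affpt k x) != 0 /\ g k x = gC C k x.
Proof.
move=> hC gi k x Ux; have [a [a1 az]] := frame_at k x.
have aU : a \in unitmx by rewrite unitmxE a1 unitr1.
have pE : pi_SL a = chart_inv k x by rewrite /pi_SL az.
have [] := gi a a1; first by rewrite pE.
rewrite induced_det// az => d0 E; split => //.
have ak : a k 0 = 1 by have /colP/(_ k) := az; rewrite mxE insert_coordk.
have lift_tang u : exists X, tangentSL a X /\ dpi_SL k a X = u.
  pose y := invmx a *m tang k u.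
  (* The first column determines the image in the plane; the entry [- y 0 0] on the diagonal makes
     the trace vanish. *)
  pose M : 'M[R[i]]_3 := \matrix_(i, j)
    if j == 0 then y i 0 else if (i == 1) && (j == 1) then - y 0 0 else 0.
  have colM : col 0 (a *m M) = tang k u.
    rewrite colE -mulmxA -colE (_ : col 0 M = y).
      by rewrite mulmxA mulmxV// mul1mx.
    by apply/colP => i; rewrite !mxE.
  exists (a *m M); split.
    by rewrite /tangentSL mulmxA mulVmx// mul1mx /mxtrace sum3E !mxE /=; ring.
  have aMk : (a *m M) k 0 = 0 by have /colP/(_ k) := colM; rewrite mxE insert_coordk.
  apply: (@tang_inj _ k); rewrite dpi_SL_tang ak ?oner_eq0// colM aMk.
  by rewrite mul0r oppr0 scale0r addr0 invr1 scale1r.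
apply: bil_eq => u v.
have [X [tX <-]] := lift_tang u; have [Y [tY <-]] := lift_tang v.
have := E k X Y; rewrite pE chart_invK => /(_ (chart_dom_inv _ _) tX tY).
have dE : dform C (affpt k x) = dform C (col 0 a) by rewrite az.
rewrite dE -induced_sum// => /(congr1 (@complex.Re R)) /= ->.
have ak0 : a k 0 != 0 by rewrite ak oner_eq0.
move: (dpi_SL k a X) (dpi_SL k a Y) (dpi_SL_tang X ak0) (dpi_SL_tang Y ak0).
move=> dX dY eX eY; rewrite bil_gC eX eY ak -az.
have o1 : (1 : R[i]) != 0 by exact: oner_neq0.
have := gmet_scale C (col 0 a) (col 0 X) (col 0 Y) (- (X k 0 / 1 ^+ 2)) (- (Y k 0 / 1 ^+ 2)) o1.
by rewrite !scale1r invr1 !scale1r => ->.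
Qed.

End Induced.

(** * Its Levi-Civita connection *)

Section Bilinear.
Variable R : realType.
Implicit Types (G : 'M[R]_4) (u v w x : 'rV[R]_4) (l : R[i]) (k : 'I_3).

Definition cact l u : 'rV[R]_4 := ofC (l *: toC u).

Lemma mulJ_lshift u (j : 'I_2) :
  (u *m Jmx R) 0 (lshift 2 j : 'I_4) = - u 0 (rshift 2 j : 'I_4).
Proof.
rewrite /Jmx -[u in LHS](@hsubmxK _ 1 2 2) (@mul_row_block _ 1 2 2 2 2).
by rewrite (@row_mxEl _ 1 2 2) mulmx0 add0r mulmxN mulmx1 !mxE.
Qed.

Lemma mulJ_rshift u (j : 'I_2) :
  (u *m Jmx R) 0 (rshift 2 j : 'I_4) = u 0 (lshift 2 j : 'I_4).
Proof.
rewrite /Jmx -[u in LHS](@hsubmxK _ 1 2 2) (@mul_row_block _ 1 2 2 2 2).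
by rewrite (@row_mxEr _ 1 2 2) mulmx0 addr0 mulmx1 !mxE.
Qed.

Lemma cactE l u : cact l u = complex.Re l *: u + complex.Im l *: (u *m Jmx R).
Proof.
apply/rowP; elim/ord4P => j; rewrite [in RHS]mxE [X in _ = X + _]mxE [X in _ = _ + X]mxE.
  rewrite mulJ_lshift ofC_lshift mxE toCE cReM /=; ring.
rewrite mulJ_rshift ofC_rshift mxE toCE cImM /=; ring.
Qed.

Lemma toC_cact l u : toC (cact l u) = l *: toC u.
Proof. exact: ofCK. Qed.

Lemma tang_cact k l u : tang k (cact l u) = l *: tang k u.
Proof.
apply: (@col3_eq _ k) => [|j]; rewrite [in RHS]mxE ?insert_coordk ?mulr0//.
by rewrite !insert_coord_lift toC_cact mxE.
Qed.

Lemma mulJE u : u *m Jmx R = cact 'i%C u.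
Proof. by rewrite cactE /= scale0r add0r scale1r. Qed.

Lemma cactA l l' u : cact l (cact l' u) = cact (l * l') u.
Proof. by rewrite /cact ofCK scalerA. Qed.

Lemma bilDl G u u' v : bil G (u + u') v = bil G u v + bil G u' v.
Proof. by rewrite /bil !mulmxDl mxE. Qed.
Lemma bilZl G (r : R) u v : bil G (r *: u) v = r * bil G u v.
Proof. by rewrite /bil -!scalemxAl mxE. Qed.
Lemma bilC G u v : G^T = G -> bil G u v = bil G v u.
Proof.
move=> Gs; rewrite /bil.
have -> : (u *m G *m v^T) 0 0 = ((u *m G *m v^T)^T) 0 0 by rewrite [RHS]mxE.
by rewrite !trmx_mul trmxK Gs mulmxA.
Qed.

Lemma bil_mulmx G u (m : 'I_4) : (u *m G) 0 m = bil G u (delta_mx 0 m).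
Proof. by rewrite /bil trmx_delta -colE [RHS]mxE. Qed.

(** nabla g = 0 at [x] for the Christoffel form [Ga], tested on constant vector fields. *)
Definition parallel_at (G : 'rV[R]_4 -> 'M[R]_4) x
    (Ga : 'rV[R]_4 -> 'rV[R]_4 -> 'rV[R]_4) : Prop :=
  forall w u v, is_derive x w (fun y => bil (G y) u v)
    (bil (G x) (Ga w u) v + bil (G x) u (Ga w v)).

(** Uniqueness of the torsion-free metric connection: after substitution and cancellation by
    symmetry, the three derivatives leave twice the product of [Ga u v] with the basis vector. *)
Lemma levi_civita_parallel (g : cotensor2 R) k x Ga :
  (g k x)^T = g k x -> g k x \in unitmx ->
  (forall u v, Ga u v = Ga v u) -> parallel_at (g k) x Ga ->
  levi_civita g k x = Ga.
Proof.
move=> gs gU Gs Gp; apply/funext => u; apply/funext => v.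
rewrite /levi_civita -[RHS](mulmxK gU); congr (_ *m _).
apply/rowP => m; rewrite mxE bil_mulmx.
have [_ ->] := Gp u v (delta_mx 0 m).
have [_ ->] := Gp v u (delta_mx 0 m).
have [_ ->] := Gp (delta_mx 0 m) u v.
rewrite (Gs (delta_mx 0 m) u) (Gs (delta_mx 0 m) v) (Gs v u) (bilC (Ga u (delta_mx 0 m)) v gs).
by field.
Qed.

(** For a torsion-free connection with g and J parallel, the exterior derivative of the fundamental
    form is a cyclic sum whose terms cancel by skew-symmetry. *)
Lemma closed_parallel (G : 'rV[R]_4 -> 'M[R]_4) x Ga u v w :
  (G x)^T = G x ->
  (forall a b, bil (G x) (a *m Jmx R) (b *m Jmx R) = bil (G x) a b) ->
  (forall a b, Ga a b = Ga b a) ->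
  (forall a b, Ga a (b *m Jmx R) = Ga a b *m Jmx R) ->
  parallel_at G x Ga -> ext_deriv2 (fun y => Jmx R *m G y) x u v w = 0.
Proof.
move=> Gs GJ Gas GaJ Gp.
have JJ (a : 'rV[R]_4) : a *m Jmx R *m Jmx R = - a.
  rewrite !mulJE cactA -expr2 sqr_i cactE cReN cImN /= oppr0 scale0r addr0.
  by rewrite scaleN1r.
have E a b c : 'D_a (fun y => bil (Jmx R *m G y) b c) x =
    bil (G x) (Ga a b *m Jmx R) c + bil (G x) (b *m Jmx R) (Ga a c).
  rewrite (_ : (fun y => _) = fun y => bil (G y) (b *m Jmx R) c); last first.
    by apply/funext => y; rewrite /bil mulmxA.
  by have [_ ->] := Gp a (b *m Jmx R) c; rewrite GaJ.
have om a b : bil (G x) (a *m Jmx R) b = - bil (G x) (b *m Jmx R) a.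
  by rewrite -GJ JJ -scaleN1r bilZl mulN1r bilC.
rewrite /ext_deriv2 !E (Gas w u) (Gas w v) (Gas v u).
rewrite (om (Ga u v)) (om (Ga u w)) (om (Ga v w)); ring.
Qed.

End Bilinear.

(** * First derivatives of the induced metric *)

Section Derivative.
Variables (R : realType) (C : 'M[R[i]]_3) (k : 'I_3).
Hypothesis hC : hermitian3 C.
Implicit Types (u v w x : 'rV[R]_4).

Section Forms.
Variables (x : 'rV[R]_4) (P Q dP dQ : 'rV[R]_4 -> 'cV[R[i]]_3).
Hypothesis DP : forall i, cdiff (fun y => P y i 0) x (fun v => dP v i 0).
Hypothesis DQ : forall i, cdiff (fun y => Q y i 0) x (fun v => dQ v i 0).

Lemma cdiff_hform : cdiff (fun y => hform C (P y) (Q y)) x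
  (fun v => hform C (dP v) (Q x) + hform C (P x) (dQ v)).
Proof.
have D := cdiff_sum (fun i => cdiff_sum (fun j =>
  cdiffM (cdiffM (DP i) (cdiff_cst (C i j) x)) (cdiffJ (DQ j)))).
apply: cdiff_ext (cdiff_eq D _) _ => [v|y]; last by rewrite hformE.
rewrite !hformE -big_split; apply: eq_bigr => i _; rewrite -big_split; apply: eq_bigr => j _ /=.
by rewrite mulr0 addr0.
Qed.

Lemma cdiff_pform : cdiff (fun y => pform C (P y) (Q y)) x
  (fun v => pform C (dP v) (Q x) + pform C (P x) (dQ v)).
Proof.
have D := cdiff_sum (fun i => cdiff_sum (fun j =>
  cdiffM (cdiffM (cdiffJ (DP i)) (cdiff_cst (adj3 C i j) x)) (DQ j))).
apply: cdiff_ext (cdiff_eq D _) _ => [v|y]; last by rewrite pformE.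
rewrite !pformE -big_split; apply: eq_bigr => i _; rewrite -big_split; apply: eq_bigr => j _ /=.
by rewrite mulr0 addr0.
Qed.

Lemma cdiff_crossv t i : cdiff (fun y => crossv (P y) t i 0) x (fun v => crossv (dP v) t i 0).
Proof.
have D := cdiffD (cdiffM (DP (i + 1)) (cdiff_cst (t (i + 2) 0) x))
  (cdiffN (cdiffM (DP (i + 2)) (cdiff_cst (t (i + 1) 0) x))).
by apply: cdiff_ext (cdiff_eq D _) _ => [v|y]; rewrite mxE ?mulr0 ?addr0.
Qed.

End Forms.

(** Minus the complex-linear part of the logarithmic differential of [dform C (affpt k x)]. *)
Definition lcform x u : R[i] := - (pform C (affpt k x) (tang k u) / dform C (affpt k x)).

Definition lcC x u v : 'rV[R]_4 := cact (lcform x u) v + cact (lcform x v) u.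

Lemma lcCC x u v : lcC x u v = lcC x v u.
Proof. by rewrite /lcC addrC. Qed.

Lemma lcform_cact x l u : lcform x (cact l u) = l * lcform x u.
Proof.
by rewrite /lcform tang_cact /pform -scalemxAr mxE -mulrA mulrN.
Qed.

Lemma lcCJ x u v : lcC x u (v *m Jmx R) = lcC x u v *m Jmx R.
Proof.
rewrite /lcC mulmxDl !mulJE lcform_cact !cactA.
by rewrite [lcform x u * _]mulrC.
Qed.

Lemma tang_lcC x u v :
  tang k (lcC x u v) = lcform x u *: tang k v + lcform x v *: tang k u.
Proof.
have := tangDl k 1 (cact (lcform x u) v) (cact (lcform x v) u).
by rewrite rmorph1 !scale1r !tang_cact.
Qed.

(** The quotient rule for N / d^2: [h1] and [h2] are the derivatives of the form in its two
    arguments, [m] is its value, and [pw + pw'] is the derivative of [d]. The two hypotheses are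
    [pform_derive] and its conjugate. *)
Lemma quotient_identity (d h1 h2 m hwv huw pw pu pw' pv' : R[i]) : d != 0 ->
  d * h1 = pw * m - pu * hwv -> d * h2 = pw' * m - pv' * huw ->
  - (h1 + h2) / (d * d)
  + - m * (- ((pw' + pw) * d + d * (pw' + pw)) / (d * d) ^+ 2) =
  (- (pw / d) * - m + - (pu / d) * - hwv) / d ^+ 2
  + (- (pw' / d) * - m + - (pv' / d) * - huw) / d ^+ 2.
Proof.
move=> d0 e1 e2.
have -> : h1 = (pw * m - pu * hwv) / d by rewrite -e1 mulrAC divff// mul1r.
have -> : h2 = (pw' * m - pv' * huw) / d by rewrite -e2 mulrAC divff// mul1r.
by field.
Qed.

Lemma gC_parallel x : dform C (affpt k x) != 0 -> parallel_at (gC C k) x (lcC x).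
Proof.
move=> d0 w u v.
pose z := affpt k x; pose d := dform C z; pose N a b := nform C z (tang k a) (tang k b).
pose p a := pform C z (tang k a).
have DZ := cdiff_affpt k x.
have Dh := cdiff_hform (cdiff_crossv DZ (tang k u)) (cdiff_crossv DZ (tang k v)).
have Dd := cdiff_pform DZ DZ.
have DG := cdiffM (cdiffN Dh) (cdiffV (mulf_neq0 d0 d0) (cdiffM Dd Dd)).
have [dr _ /(_ w)[er _]] := DG.
have fE : (fun y => complex.Re (- hform C (crossv (affpt k y) (tang k u))
      (crossv (affpt k y) (tang k v)) / (pform C (affpt k y) (affpt k y)
      * pform C (affpt k y) (affpt k y)))) = fun y => bil (gC C k y) u v.
  by apply/funext => y; rewrite bil_gC /gmet expr2.
rewrite fE in dr er; split; first exact: diff_derivable.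
rewrite er; move: (lcC x w u) (lcC x w v) (tang_lcC x w u) (tang_lcC x w v) => a b ea eb.
rewrite (bil_gC C k x a v) (bil_gC C k x u b) ea eb /gmet -cReD; congr complex.Re.
rewrite nformDl nformDr !nformZl !nformZr.
have e1 := pform_derive C z (tang k w) (tang k u) (tang k v).
have e2 := pform_derive_conj z (tang k w) (tang k u) (tang k v) hC.
have lE t : (lcform x t)^* = - (pform C (tang k t) z / d).
  by rewrite /lcform rmorphN rmorphM fmorphV /= dform_conj// pform_conj.
rewrite (lE w) (lE v) /lcform /nform.
rewrite -/z -/(dform C z) -/d.
exact: (quotient_identity d0 e1 e2).
Qed.
End Derivative.

Lemma unitmx_ker (F : fieldType) n (M : 'M[F]_n) :
  (forall u : 'rV_n, u *m M = 0 -> u = 0) -> M \in unitmx.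
Proof.
move=> H; rewrite -row_free_unit -kermx_eq0; apply/eqP/row_matrixP => i.
by rewrite row0; apply: H; rewrite -row_mul mulmx_ker row0.
Qed.

(** * The Kähler property of the induced metrics *)

Section GC.
Variables (R : realType) (C : 'M[R[i]]_3).
Hypothesis hC : hermitian3 C.
Implicit Types (k : 'I_3) (x u v : 'rV[R]_4).

Lemma gmetC z (u v : 'cV[R[i]]_3) : gmet C z u v = gmet C z v u.
Proof.
by rewrite /gmet -cReJ rmorphM fmorphV rmorphXn /= dform_conj// nform_conj.
Qed.

Lemma gC_sym k x : (gC C k x)^T = gC C k x.
Proof. by apply/matrixP => a b; rewrite !mxE gmetC. Qed.

Lemma gC_J k x u v : bil (gC C k x) (u *m Jmx R) (v *m Jmx R) = bil (gC C k x) u v.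
Proof.
rewrite !bil_gC !mulJE !tang_cact /gmet nformZl nformZr mulrA.
have -> : ('i%C : R[i]) * ('i%C)^* = 1 by rewrite conjE -sqr_normc complexiE normCi expr1n.
by rewrite mul1r.
Qed.

(** A real part that vanishes for all [v] vanishes also on i v, so the complex form is zero. Its
    values on the two basis vectors are a linear system for [u] whose determinant is [dform]. *)
Lemma gC_unit k x : dform C (affpt k x) != 0 -> gC C k x \in unitmx.
Proof.
move=> d0; apply: unitmx_ker => u uG.
have B v : gmet C (affpt k x) (tang k u) (tang k v) = 0.
  by rewrite -bil_gC /bil uG mul0mx mxE.
have N0 v : nform C (affpt k x) (tang k u) (tang k v) = 0.
  have d2 : dform C (affpt k x) ^+ 2 != 0 by rewrite expf_neq0.
  suff : nform C (affpt k x) (tang k u) (tang k v) / dform C (affpt k x) ^+ 2 = 0.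
    by move/eqP; rewrite mulf_eq0 invr_eq0 (negPf d2) orbF => /eqP.
  apply: complex_eqP; first exact: B.
  have := B (cact 'i%C v); rewrite tang_cact /gmet nformZr conjE -mulrA cReM /=.
  by rewrite mul0r sub0r mulN1r opprK.
have e0 := N0 (ofC (delta_mx 0 0)); have e1 := N0 (ofC (delta_mx 0 1)).
move: d0 e0 e1; rewrite -[affpt k x]/(ins3 k 1 (toC x)) dform_chart.
rewrite -[tang k u]/(ins3 k 0 (toC u)) -[tang k (ofC (delta_mx 0 0))]/(ins3 k 0 (toC _)).
rewrite -[tang k (ofC (delta_mx 0 1))]/(ins3 k 0 (toC _)) !nform_chart !ofCK.
have dE i j : (delta_mx 0 i : 'rV[R[i]]_2) 0 j = (i == j)%:R by rewrite mxE eq_sym.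
rewrite !dE /= conjC0 conjC1 !mulr0 !mulr1.
move: (chartH C k (toC x)) => H d0 e0 e1.
have [a0 a1] : toC u 0 0 = 0 /\ toC u 0 1 = 0.
  move: (toC u 0 0) (toC u 0 1) (H 0 0) (H 0 1) (H 1 0) (H 1 1) d0 e0 e1 => {H}.
  move=> a b p q r s d0 /eqP; rewrite oppr_eq0 => /eqP e0 /eqP; rewrite oppr_eq0 => /eqP e1.
  split; apply: (mulfI d0); rewrite mulr0.
    transitivity (p * (s * a - q * b - 0 + 0) + q * (0 - 0 - r * a + p * b)); first by ring.
    by rewrite e0 e1 !mulr0 addr0.
  transitivity (r * (s * a - q * b - 0 + 0) + s * (0 - 0 - r * a + p * b)); first by ring.
  by rewrite e0 e1 !mulr0 addr0.
rewrite -[u]toCK -[RHS]toCK; congr ofC; apply/rowP.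
by elim/ord2P; rewrite ?a0 ?a1 toCE !mxE.
Qed.

End GC.

Section GC2.
Variables (R : realType) (C : 'M[R[i]]_3).
Hypothesis hC : hermitian3 C.
Implicit Types (k : 'I_3).

Lemma csmooth_affpt (A : set 'rV[R]_4) k i : csmooth A (fun y => affpt k y i 0).
Proof.
have S (a : 'I_4) : smooth_on A (fun y : 'rV[R]_4 => y 0 a).
  move=> n; apply: (@Ck_on_lin _ _ n A _ (fun v => v 0 a)); first exact: coord_continuous.
  move=> x v; have dI : derivable (id : 'rV[R]_4 -> 'rV[R]_4) x v by exact: derivable_id.
  have := derive_mx dI; rewrite derive_id => /rowP/(_ a) e.
  split; last by rewrite [RHS]e mxE.
  by move/derivable_mxP: dI => /(_ 0 a).
case: (unliftP k i) => [j|] ->.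
  rewrite (_ : (fun y => _) = fun y : 'rV[R]_4 =>
    (y 0 (lshift 2 j : 'I_4) +i* y 0 (rshift 2 j : 'I_4))%C); first by split; exact: S.
  by apply/funext => y; rewrite insert_coord_lift toCE.
rewrite (_ : (fun y => _) = fun=> 1); first exact: csmooth_cst.
by apply/funext => y; rewrite insert_coordk.
Qed.

Lemma csmooth_gC (A : set 'rV[R]_4) k (u v : 'cV[R[i]]_3) : open A ->
  (forall x, A x -> dform C (affpt k x) != 0) ->
  csmooth A (fun y => nform C (affpt k y) u v / dform C (affpt k y) ^+ 2).
Proof.
move=> oA d0; have SZ i := csmooth_affpt A k i.
have Scr t i : csmooth A (fun y => crossv (affpt k y) t i 0).
  have := csmoothD oA (csmoothM oA (SZ (i + 1)) (csmooth_cst A (t (i + 2) 0)))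
    (csmoothN oA (csmoothM oA (SZ (i + 2)) (csmooth_cst A (t (i + 1) 0)))).
  by apply: csmooth_ext => // y _; rewrite [RHS]mxE.
have Sh : csmooth A (fun y => nform C (affpt k y) u v).
  have := csmoothN oA (csmooth_sum oA (fun i => csmooth_sum oA (fun j =>
    csmoothM oA (csmoothM oA (Scr u i) (csmooth_cst A (C i j))) (csmoothJ oA (Scr v j))))).
  by apply: csmooth_ext => // y _; rewrite /nform hformE.
have Sd : csmooth A (fun y => dform C (affpt k y)).
  have := csmooth_sum oA (fun i => csmooth_sum oA (fun j =>
    csmoothM oA (csmoothM oA (csmoothJ oA (SZ i)) (csmooth_cst A (adj3 C i j))) (SZ j))).
  by apply: csmooth_ext => // y _; rewrite /dform pformE.
apply: csmoothM => //; apply: csmoothV => //.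
  by move=> x /d0 dx; rewrite expf_neq0.
exact: csmoothM.
Qed.

Lemma smooth_gC (A : set 'rV[R]_4) k : open A ->
  (forall x, A x -> dform C (affpt k x) != 0) -> smooth_on A (gC C k).
Proof.
move=> oA d0 n; apply/(Ck_on_mxP _ _ oA) => a b.
have [+ _] := csmooth_gC (tang k (delta_mx 0 a)) (tang k (delta_mx 0 b)) oA d0.
by move=> /(_ n); apply: Ck_on_ext => // y _; rewrite mxE.
Qed.

Lemma levi_civita_gC k x : dform C (affpt k x) != 0 ->
  levi_civita (gC C) k x = lcC C k x.
Proof.
move=> d0; apply: levi_civita_parallel; first exact: gC_sym.
- exact: gC_unit.
- by move=> u v; rewrite lcCC.
- exact: gC_parallel.
Qed.

Lemma gC_pseudo_kahler (U : set (CP2 R)) : open U ->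
  (forall k x, chart_img U k x -> dform C (affpt k x) != 0) ->
  pseudo_kahler U (gC C).
Proof.
move=> oU d0; split; first exact: gC_cotensor2.
move=> k; split; first by apply: smooth_gC; [exact: chart_img_open|exact: d0].
move=> x Ux; have dx := d0 k x Ux; split.
- exact: gC_sym.
- exact: gC_unit.
- exact: gC_J.
- move=> u v w; apply: (@closed_parallel _ _ _ (lcC C k x)).
  + exact: gC_sym.
  + exact: gC_J.
  + exact: lcCC.
  + exact: lcCJ.
  + exact: gC_parallel.
Qed.

End GC2.

(** * Compatibility of the induced metrics with the Fubini-Study class *)

Section Compatible.
Variable R : realType.

Lemma wedge3_add (a u w : 'rV[R]_4) (r s : R) :
  wedge3_eq0 (a + (r *: u + s *: w)) u w <-> wedge3_eq0 a u w.
Proof.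
have E b f : \det (\matrix_(i < 3, j < 3) [:: b; u; w]`_i 0 (f j)) =
    b 0 (f 0) * (u 0 (f 1) * w 0 (f 2) - u 0 (f 2) * w 0 (f 1))
    - b 0 (f 1) * (u 0 (f 0) * w 0 (f 2) - u 0 (f 2) * w 0 (f 0))
    + b 0 (f 2) * (u 0 (f 0) * w 0 (f 1) - u 0 (f 1) * w 0 (f 0)) :> R.
  by rewrite det3E !mxE.
by split=> H f; have := H f; rewrite !E => <-; rewrite !mxE; ring.
Qed.

Lemma wedge3_cact (a u : 'rV[R]_4) (l : R[i]) :
  wedge3_eq0 (a + cact l u) u (u *m Jmx R) <-> wedge3_eq0 a u (u *m Jmx R).
Proof. by rewrite cactE; exact: wedge3_add. Qed.

Lemma hermN1 : hermitian3 (- 1%:M : 'M[R[i]]_3).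
Proof.
apply/matrixP => i j; rewrite !mxE rmorphN rmorph_nat /= eq_sym.
by case: eqP.
Qed.

Lemma dformN1_neq0 (z : 'cV[R[i]]_3) : z != 0 -> dform (- 1%:M) z != 0.
Proof.
move=> z0; rewrite dformN1; apply: contra_neq z0 => e.
apply/colP => i; rewrite mxE; apply/eqP; rewrite -normr_eq0 -sqrf_eq0 normCK; apply/eqP.
move/eqP: e; rewrite psumr_eq0; last by move=> j _; rewrite -normCK exprn_ge0.
by move/allP => /(_ i); rewrite mem_index_enum => /(_ isT)/eqP.
Qed.

Lemma fubini_studyE : @fubini_study R = gC (- 1%:M).
Proof.
apply/funext => k; apply/funext => x; apply/matrixP => a b; rewrite !mxE /gmet.
by rewrite nformN1 dformN1.
Qed.

Lemma levi_civita_fs k (x : 'rV[R]_4) :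
  levi_civita (@fubini_study R) k x = lcC (- 1%:M) k x.
Proof.
by rewrite fubini_studyE levi_civita_gC//; [exact: hermN1|exact/dformN1_neq0/affpt_neq0].
Qed.

(** The term [lcC C k x c c] is a complex multiple of [c], hence lies in the span of [c] and J c. *)
Lemma geodesic_lcC (C : 'M[R[i]]_3) (a c : 'rV[R]_4) k x :
  wedge3_eq0 (a + lcC C k x c c) c (c *m Jmx R) <-> wedge3_eq0 a c (c *m Jmx R).
Proof.
have -> : lcC C k x c c = cact (lcform C k x c + lcform C k x c) c.
  by rewrite /lcC !cactE cReD cImD !scalerDl addrACA.
exact: wedge3_cact.
Qed.

Lemma gC_compatible (U : set (CP2 R)) (C : 'M[R[i]]_3) : hermitian3 C ->
  (forall k x, chart_img U k x -> dform C (affpt k x) != 0) ->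
  compatible U (gC C).
Proof.
move=> hC d0; split.
- move=> k x u v /d0 dx; rewrite !(levi_civita_gC hC dx); exact: lcCJ.
- move=> k x u v /d0 dx; rewrite !(levi_civita_gC hC dx); exact: lcCC.
move=> I gamma [_ _ gU _ _].
have E k t : I t -> chart_dom k (gamma t) ->
    levi_civita (gC C) k (chart k (gamma t)) = lcC C k (chart k (gamma t)).
  by move=> It kt; apply: levi_civita_gC => //; apply: d0; rewrite /chart_img /= chartK//; exact: gU.
split=> H k t It kt; have Et := E k t It kt;
  pose a := derive1 (derive1 (chart k \o gamma)) t;
  pose b := derive1 (chart k \o gamma) t; set x := chart k (gamma t) in Et.
- suff : wedge3_eq0 (a + levi_civita (@fubini_study R) k x b b) b (b *m Jmx R) by [].
  have : wedge3_eq0 (a + levi_civita (gC C) k x b b) b (b *m Jmx R) := H k t It kt.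
  move: a b x Et => a b x Et {H}.
  by rewrite Et levi_civita_fs => /geodesic_lcC h; apply/geodesic_lcC.
- suff : wedge3_eq0 (a + levi_civita (gC C) k x b b) b (b *m Jmx R) by [].
  have : wedge3_eq0 (a + levi_civita (@fubini_study R) k x b b) b (b *m Jmx R) := H k t It kt.
  move: a b x Et => a b x Et {H}.
  by rewrite Et levi_civita_fs => /geodesic_lcC h; apply/geodesic_lcC.
Qed.

End Compatible.

(** * Rank at least two and nonvanishing of [dform] *)

Section Rank.
Variable K : numClosedFieldType.
Implicit Types (C : 'M[K]_3) (z w : 'cV[K]_3).

(** Two distinct indices are [j + 1] and [j + 2] in some order, so the entries of the adjugate are
    all the 2 × 2 minors up to sign. *)
Lemma adj3_eq0_minor C : adj3 C = 0 -> forall a b c d, C a b * C c d = C a d * C c b.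
Proof.
move=> A0.
have m j i : C (j + 1) (i + 1) * C (j + 2) (i + 2) = C (j + 1) (i + 2) * C (j + 2) (i + 1).
  by apply/eqP; rewrite -subr_eq0; have /matrixP/(_ i j) := A0; rewrite !mxE => ->.
have cases (a c : 'I_3) : a = c \/ exists j,
    (a = j + 1 /\ c = j + 2) \/ (a = j + 2 /\ c = j + 1).
  move: a c; elim/ord3P; elim/ord3P; try (by left); right;
    by [exists 0; rewrite !ord3E; auto|exists 1; rewrite !ord3E; auto|exists 2; rewrite !ord3E; auto].
move=> a b c d; have [->|[j ac]] := cases a c; first by rewrite mulrC.
have [->|[i bd]] := cases b d; first by [].
by case: ac bd => -[-> ->] [] [-> ->]; rewrite ?m// ![C (j + 2) _ * _]mulrC m.
Qed.

Lemma adj3_eq0_rank C : adj3 C = 0 -> (\rank C <= 1)%N.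
Proof.
move=> A0; have [->|C0] := eqVneq C 0; first by rewrite mxrank0.
have [p [q Cpq]] : exists p q, C p q != 0.
  apply: contrapT => H; move/eqP: C0; apply; apply/matrixP => p q; rewrite mxE.
  by apply/eqP/negPn/negP => h; apply: H; exists p, q.
(* By vanishing of the minors, [C] is the product of its pivot column and its pivot row divided by
   the pivot. *)
have -> : C = col q C *m ((C p q)^-1 *: row p C).
  apply/matrixP => i j; rewrite mxE big_ord1 !mxE.
  rewrite mulrCA -(adj3_eq0_minor A0 i j p q) mulrCA.
  by rewrite mulVf// mulr1.
exact: mulmx_max_rank.
Qed.

Lemma pform_delta C (i j : 'I_3) : pform C (delta_mx i 0) (delta_mx j 0) = adj3 C i j.
Proof. by rewrite /pform map_delta_mx trmx_delta -rowE -colE !mxE. Qed.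

Lemma pformD C z w (c : K) : dform C (z + c *: w) =
  dform C z + c * pform C z w + c^* * pform C w z + c * c^* * dform C w.
Proof.
rewrite /dform /pform map_mxD map_mxZ [map_mx _ _ + _]addrC trDZ !mulmxDl !mulmxDr -!scalemxAl -!scalemxAr.
rewrite !mxE; ring.
Qed.

(** Polarisation with the scalars 1 and i recovers each entry of the adjugate from values of
    [dform]; the adjugate is nonzero when the rank is at least two. *)
Lemma exists_dform_neq0 C : (2 <= \rank C)%N -> exists z, dform C z != 0.
Proof.
move=> rC; apply: contrapT => H.
have d0 z : dform C z = 0 by apply/eqP/negPn/negP => h; apply: H; exists z.
suff A0 : adj3 C = 0 by move: rC; rewrite ltnNge adj3_eq0_rank.
apply/matrixP => i j; rewrite [RHS]mxE -!pform_delta.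
have := d0 (delta_mx i 0 + 1 *: delta_mx j 0).
have := d0 (delta_mx i 0 + 'i *: delta_mx j 0).
rewrite !pformD !d0 conjC1 conjCi !mulr0 !addr0 !add0r !mul1r mulNr -mulrBr.
move/eqP; rewrite mulf_eq0 (negPf (neq0Ci _)) /= subr_eq0 => /eqP <- /eqP.
by rewrite -mulr2n mulrn_eq0 /= => /eqP.
Qed.

Lemma dform_rank C z : dform C z != 0 -> (2 <= \rank C)%N.
Proof.
apply: contraNT; rewrite -leqNgt => rC; apply/eqP.
suff A0 : adj3 C = 0 by rewrite /dform /pform A0 mulmx0 mul0mx mxE.
have [u [v ->]] : exists (u : 'cV[K]_3) (v : 'rV[K]_3), C = u *m v.
  have := mulmx_base C.
  move: (col_base C) (row_base C); move: rC; case: (\rank C) => [|[|//]] _ P Q <-.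
    by exists 0, 0; rewrite mulmx0; apply/matrixP => i j; rewrite !mxE big_ord0.
  by exists P, Q.
apply/matrixP => i j; rewrite !mxE !big_ord1; ring.
Qed.

End Rank.

(** * A metric for each hermitian matrix of rank at least two *)

Section Existence.
Variable R : realType.
Implicit Types (C : 'M[R[i]]_3) (k : 'I_3).

Lemma dform_hcoord C k (x : 'rV[R]_4) :
  (dform C (hcoord (chart_inv k x)) != 0) = (dform C (affpt k x) != 0).
Proof.
rewrite /chart_inv; have [l l0 ->] := hcoord_proj_pt (affpt_neq0 k x).
by rewrite dform_scale !mulf_eq0 conj_eq0 (negPf l0).
Qed.

Lemma dform_affpt_continuous C k :
  continuous (fun x : 'rV[R]_4 => dform C (affpt k x) : (R[i] : numFieldType)).
Proof.
move=> x; have [dr di _] := cdiff_pform C (cdiff_affpt k x) (cdiff_affpt k x).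
by apply/continuous_complexP; split; exact: differentiable_continuous.
Qed.

Lemma exists_metric C : hermitian3 C -> (2 <= \rank C)%N ->
  exists (U : set (CP2 R)) (g : cotensor2 R),
    [/\ domain U, pseudo_kahler U g, compatible U g & induced_by U g C].
Proof.
move=> hC /exists_dform_neq0[z dz].
have z0 : z != 0.
  by apply: contraNneq dz => ->; rewrite /dform /pform mulmx0 mxE.
have [k kp] := exists_chart (proj_pt z); pose x0 := chart k (proj_pt z).
have dx0 : dform C (affpt k x0) != 0.
  rewrite -dform_hcoord chartK//; have [l l0 ->] := hcoord_proj_pt z0.
  by rewrite dform_scale !mulf_neq0// conj_eq0.
have : \forall x \near x0, dform C (affpt k x) != 0.
  have cx : {for x0, continuous (fun x : 'rV[R]_4 => dform C (affpt k x) :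
    (R[i] : numFieldType))} by exact: dform_affpt_continuous.
  exact: (cvgr_neq0 _ cx dx0).
move=> /nbhs_ballP[r /= r0 rB].
(* A coordinate ball around a point with nonzero [dform], small enough for [dform] to have no zero
   in it. *)
pose U := [set p : CP2 R | chart_dom k p /\ ball x0 r (chart k p)].
have dU p : U p -> dform C (hcoord p) != 0.
  by move=> [pk /rB]; rewrite /= -dform_hcoord chartK.
have d0 j x : chart_img U j x -> dform C (affpt j x) != 0.
  by rewrite -dform_hcoord => /dU.
have oU : open U by apply: open_chart; exact: ball_open.
exists U, (gC C); split.
- split=> //; last by exists (proj_pt z); split => //; exact: ballxx.
  have -> : U = chart_inv k @` ball x0 r.
    apply/seteqP; split=> [p [pk pB]|_ [x xB <-]].
      by exists (chart k p) => //; rewrite chartK.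
    by split; [exact: chart_dom_inv|rewrite chart_invK].
  apply: connected_continuous_connected; first exact: ball_connected.
  exact/continuous_subspaceT/chart_inv_continuous.
- exact: gC_pseudo_kahler.
- exact: gC_compatible.
- by apply: induced_by_of => // p /dU; split.
Qed.

End Existence.

(** * Connections with the generalised geodesics of the Fubini-Study metric *)

Lemma is_derive_comb (R : realType) (a b : R -> R) (v w : 'rV[R]_4) (t da db : R) :
  is_derive t 1 a da -> is_derive t 1 b db ->
  is_derive t 1 (fun s => a s *: v + b s *: w) (da *: v + db *: w).
Proof.
move=> Da Db.
have De i : is_derive t 1 (fun s => (a s *: v + b s *: w) 0 i) (da * v 0 i + db * w 0 i).
  have -> : (fun s => (a s *: v + b s *: w) 0 i) = (fun s => a s * v 0 i + b s * w 0 i).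
    by apply/funext => s; rewrite !mxE.
  have := is_derive_add (is_derive_mul Da (is_derive_cst (v 0 i) t 1))
    (is_derive_mul Db (is_derive_cst (w 0 i) t 1)).
  by rewrite !mulr0 !add0r [_ * da]mulrC [_ * db]mulrC.
have dF : derivable (fun s => a s *: v + b s *: w) t 1.
  by apply/derivable_mxP => i0 i; rewrite [i0]ord1; have [] := De i.
split => //; rewrite derive_mx//; apply/rowP => i; rewrite !mxE.
by have [_ ->] := De i.
Qed.

(** * Straight lines of one chart, seen in all charts *)

Section Lines.
Variables (R : realType) (k : 'I_3) (x u : 'rV[R]_4).

Let Z (t : R) : 'cV[R[i]]_3 := affpt k (t *: u + x).
Let c (j : 'I_3) (t : R) : 'rV[R]_4 := affine j (Z t).

Lemma line_affptE t : Z t = affpt k x + t%:C%C *: tang k u.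
Proof.
have E i : (affpt k x + t%:C%C *: tang k u) i 0 = affpt k x i 0 + t%:C%C * tang k u i 0.
  by rewrite [LHS]mxE [X in _ + X]mxE.
apply: (@col3_eq _ k) => [|j]; rewrite E.
  by rewrite !insert_coordk mulr0 addr0.
rewrite !insert_coord_lift !toCE !mxE.
by apply: complex_eqP; rewrite /= ?mul0r ?subr0 ?addr0 ?add0r addrC.
Qed.

Lemma cdiff_line i t : cdiff (fun t => Z t i 0) t (fun h : R => h%:C%C * tang k u i 0).
Proof.
have D0 : cdiff (fun t : R => t%:C%C : R[i]) t (fun h : R => h%:C%C).
  split=> [||h]; [by apply/derivable1_diffP; exact: derivable_id|exact: differentiable_cst|].
  by rewrite derive_cst derive_id.
have D := cdiffD (cdiff_cst (affpt k x i 0) t) (cdiffM D0 (cdiff_cst (tang k u i 0) t)).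
apply: cdiff_ext (cdiff_eq D _) _ => [h|s]; first by rewrite mulr0 addr0 add0r.
by rewrite line_affptE [RHS]mxE [X in _ = _ + X]mxE.
Qed.

Lemma csmooth_line (A : set R) i : csmooth A (fun t => Z t i 0).
Proof.
have S (a b : R) : smooth_on A (fun t : R => a + t * b).
  move=> n; apply: (@Ck_on_lin _ _ n A _ (fun h => h * b)) => [t|t h].
    have ca : {for t, continuous (fun _ : R => a)} by exact: cst_continuous.
    have cb : {for t, continuous (fun t : R => t *: b)} by exact: scalel_continuous.
    exact: (continuousD ca cb).
  have := is_derive_add (is_derive_cst a t h) (is_derive_mul (is_derive_id t h) (is_derive_cst b t h)).
  by rewrite mulr0 !add0r mulrC.
have ZE t : Z t i 0 = affpt k x i 0 + t%:C%C * tang k u i 0.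
  by rewrite line_affptE [LHS]mxE [X in _ + X]mxE.
split.
  rewrite (_ : (fun t => _) = fun t =>
    complex.Re (affpt k x i 0) + t * complex.Re (tang k u i 0)); first exact: S.
  by apply/funext => t; rewrite ZE cReD cReZ.
rewrite (_ : (fun t => _) = fun t =>
  complex.Im (affpt k x i 0) + t * complex.Im (tang k u i 0)); first exact: S.
by apply/funext => t; rewrite ZE cImD cImM cReR cImR mul0r addr0.
Qed.

Lemma chart_lineE j : chart j \o (fun t => chart_inv k (t *: u + x)) = c j.
Proof. by apply/funext => t; rewrite /= chart_proj// affpt_neq0. Qed.

Lemma line_smooth j (A : set R) : open A -> (forall t, A t -> Z t j 0 != 0) ->
  smooth_on A (c j).
Proof.
move=> oA Zj n; apply/(Ck_on_mxP _ _ oA) => i0; rewrite [i0]ord1.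
have Sq (i : 'I_2) := csmoothM oA (csmooth_line A (lift j i)) (csmoothV oA Zj (csmooth_line A j)).
elim/ord4P => i; have [sr si] := Sq i.
  by apply: Ck_on_ext (sr n) => // t _; rewrite [in RHS]/c /affine ofC_lshift [in RHS]mxE.
by apply: Ck_on_ext (si n) => // t _; rewrite [in RHS]/c /affine ofC_rshift [in RHS]mxE.
Qed.

(* Z_j u - u_j Z does not depend on t for Z = z + t u, so that the velocity in any
   chart is a complex multiple of a constant vector. *)
Lemma tang_derive_line j t : Z t j 0 != 0 -> tang j (derive1 (c j) t) =
  (Z t j 0 ^+ 2)^-1 *: (affpt k x j 0 *: tang k u - tang k u j 0 *: affpt k x).
Proof.
move=> Zj; rewrite derive1E.
have D i : cdiff (fun t => Z t i 0) t (fun h : R => (h%:C%C *: tang k u) i 0).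
  by apply: cdiff_eq (cdiff_line i t) _ => h; rewrite [RHS]mxE.
rewrite (derive_affine D Zj) rmorph1 !scale1r.
have e : affpt k x = Z t - t%:C%C *: tang k u by rewrite line_affptE addrK.
rewrite e; move: (Z t) (tang k u) Zj => z w zj.
by apply/colP => i; rewrite !mxE; field.
Qed.

(** A zero velocity means x_j u = u_j x for the homogeneous vectors. The k-th component, 1 for x and
    0 for u, forces u_j = 0; then x_j = Z_j is nonzero and u = 0. *)
Lemma derive_line_neq0 j t : Z t j 0 != 0 -> u != 0 -> derive1 (c j) t != 0.
Proof.
move=> Zj; apply: contraNneq => e0; have := tang_derive_line Zj; rewrite e0 tang0.
move/esym/eqP; rewrite scaler_eq0 invr_eq0 expf_eq0 (negPf Zj) /= => /eqP/colP e.
have E (a b : R[i]) (w z : 'cV[R[i]]_3) i : (a *: w - b *: z) i 0 = a * w i 0 - b * z i 0.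
  by rewrite !mxE.
have z0 m : (0 : 'cV[R[i]]_3) m 0 = 0 by rewrite mxE.
have uj : tang k u j 0 = 0.
  have := e k; rewrite E !insert_coordk mulr0 mulr1 sub0r z0 => /eqP.
  by rewrite oppr_eq0 => /eqP.
have xj : affpt k x j 0 != 0.
  move: Zj; rewrite line_affptE.
  have -> : (affpt k x + t%:C%C *: tang k u) j 0 = affpt k x j 0 + t%:C%C * tang k u j 0.
    by rewrite [LHS]mxE [X in _ + X]mxE.
  by rewrite uj mulr0 addr0.
have tu0 : tang k u = 0.
  apply/colP => i; have := e i; rewrite E uj mul0r subr0 !z0.
  by move/eqP; rewrite mulf_eq0 (negPf xj) => /eqP.
by apply/eqP; apply: (@tang_inj _ k); rewrite tu0 tang0.
Qed.

(** Near [t] the velocity is [r s] times the velocity [v] at [t], where [r s] is the ratio of the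
    factors Z_j^(-2); hence the acceleration at [t] is the derivative of [r] acting on [v]. *)
Lemma derive2_line j t : Z t j 0 != 0 ->
  exists l, derive1 (derive1 (c j)) t = cact l (derive1 (c j) t).
Proof.
move=> Zj; have hv := tang_derive_line Zj.
have [v vE] : exists v, v = derive1 (c j) t by eexists.
rewrite -vE in hv *.
pose r s := (Z s j 0 * Z s j 0)^-1 * Z t j 0 ^+ 2.
have Zn : \forall s \near t, Z s j 0 != 0.
  have [dr di _] := cdiff_line j t.
  have cZ : {for t, continuous (fun t : R => Z t j 0 : (R[i] : numFieldType))}.
    by apply/continuous_complexP; split; exact: differentiable_continuous.
  exact: (cvgr_neq0 _ cZ Zj).
have e s : Z s j 0 != 0 -> derive1 (c j) s = cact (r s) v.
  move=> Zs; have hs := tang_derive_line Zs; move: (derive1 (c j) s) hs => w hs.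
  apply: (@tang_inj _ j); rewrite hs tang_cact hv scalerA.
  by congr (_ *: _); rewrite /r expr2 -mulrA divff ?mulr1// expf_neq0.
have Dr := cdiffM (cdiffV (mulf_neq0 Zj Zj) (cdiffM (cdiff_line j t) (cdiff_line j t)))
  (cdiff_cst (Z t j 0 ^+ 2) t).
have [dr di /(_ 1)[er ei]] := Dr.
set l := (X in complex.Re X) in er.
exists l; rewrite derive1E.
pose F s := complex.Re (r s) *: v + complex.Im (r s) *: (v *m Jmx R).
have nF : \near t, derive1 (c j) t = F t.
  by apply: filterS Zn => s /e ->; rewrite cactE.
transitivity ('D_1 F t); first exact: near_eq_derive.
have Da : is_derive t 1 (fun s => complex.Re (r s)) (complex.Re l).
  by rewrite -er; exact: is_derive_diff.
have Db : is_derive t 1 (fun s => complex.Im (r s)) (complex.Im l).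
  by rewrite -ei; exact: is_derive_diff.
by have [_ ->] := is_derive_comb v (v *m Jmx R) Da Db; rewrite cactE.
Qed.

End Lines.

Section LineGeodesics.
Variable R : realType.
Implicit Types (U : set (CP2 R)) (k : 'I_3) (x u : 'rV[R]_4).

Lemma wedge3_0u (a w : 'rV[R]_4) : wedge3_eq0 a 0 w.
Proof. by move=> f; rewrite det3E !mxE /= ?mxE; ring. Qed.

Lemma wedge3_0a (u w : 'rV[R]_4) : wedge3_eq0 0 u w.
Proof. by move=> f; rewrite det3E !mxE /= ?mxE; ring. Qed.

(** The line through [x] with velocity [u] is a generalised geodesic of the Fubini-Study connection,
    hence of that of [g]. In its own chart its acceleration is zero, so at time 0 only the
    Christoffel term remains. *)
Lemma compatible_line U (g : cotensor2 R) k x u : open U -> compatible U g ->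
  chart_img U k x ->
  wedge3_eq0 (levi_civita g k x u u) u (u *m Jmx R).
Proof.
move=> oU [_ _ eqg] Ux.
(* For [u = 0] the line is not an immersed curve. *)
have [->|u0] := eqVneq u 0; first exact: wedge3_0u.
pose ga (t : R) := chart_inv k (t *: u + x).
have cga : continuous ga.
  move=> t; apply: (continuous_comp (@line_continuous _ _ x u t)).
  exact: chart_inv_continuous.
have : \forall t \near (0 : R), U (ga t).
  have oUg : open (ga @^-1` U) by move/continuousP: cga; apply.
  by apply: open_near => //; rewrite /= /ga scale0r add0r.
move=> /nbhs_ballP[e /= e0 eU].
pose I : set R := ball (0 : R) e.
have oI : open I by exact: ball_open.
have odom j : open (ga @^-1` [set p | chart_dom j p]).
  move/continuousP: cga; apply.
  rewrite (_ : [set p | _] = [set p : CP2 R | chart_dom j p /\ setT (chart j p)]).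
    by apply: open_chart; exact: openT.
  by apply/seteqP; split=> p //= [].
have domE j t : chart_dom j (ga t) <-> affpt k (t *: u + x) j 0 != 0.
  exact: chart_dom_affpt.
have imm : immersed_curve U I ga.
  split => //.
  - by apply/connected_intervalP; rewrite /I ball_itv; apply/connected_intervalP/interval_is_interval.
  - by move=> t _; exact: cga.
  move=> j c Ik; rewrite /c chart_lineE; split.
    apply: line_smooth; last by move=> t [_ /domE].
    by apply: openI => //; exact: odom.
  by move=> t [_ /domE Zj]; exact: derive_line_neq0.
have I0 : I 0 by exact: ballxx.
have fs : generalised_geodesic (levi_civita (@fubini_study R)) I ga.
  move=> j t It jt; rewrite chart_lineE => c'.
  rewrite levi_civita_fs; apply/geodesic_lcC.
  have [l ->] := derive2_line ((domE j t).1 jt).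
  by rewrite -[cact _ _]add0r; apply/wedge3_cact; exact: wedge3_0a.
pose c := chart k \o ga.
have H : wedge3_eq0 (derive1 (derive1 c) 0 + levi_civita g k (c 0) (derive1 c 0) (derive1 c 0))
  (derive1 c 0) (derive1 c 0 *m Jmx R) := (eqg I ga imm).2 fs k 0 I0 (chart_dom_inv _ _).
have cE : c = fun t => t *: u + x.
  by apply/funext => t; rewrite /c /ga /= chart_invK.
have dcE : derive1 (fun t : R => t *: u + x) = fun=> u.
  apply/funext => t; rewrite derive1E.
  have [_ D] := is_derive_comb u x (is_derive_id t (1 : R)) (is_derive_cst (1 : R) t (1 : R)).
  have -> : (fun s : R => s *: u + x) = (fun s : R => id s *: u + cst (1 : R) s *: x).
    by apply/funext => s; rewrite /= scale1r.
  by rewrite D scale1r scale0r addr0.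
move: H; rewrite cE dcE.
have -> : derive1 (fun _ : R => u) 0 = 0 by rewrite derive1_cst.
by rewrite add0r scale0r add0r.
Qed.

End LineGeodesics.

(** * The complex 1-form of a connection with these geodesics *)

Section WedgeComplex.
Variable R : realType.

(** Up to sign, four of the real minors are the real and imaginary parts of the complex determinant
    [D] times the conjugates of the two components of [u]; one of these is nonzero unless [u]
    vanishes. *)
Lemma wedge3_toC (a u : 'rV[R]_4) : wedge3_eq0 a u (u *m Jmx R) ->
  toC a 0 0 * toC u 0 1 = toC a 0 1 * toC u 0 0.
Proof.
move=> H; apply/eqP; rewrite -subr_eq0; set D := (X in X == 0).
pose x0 : 'I_4 := lshift 2 (0 : 'I_2); pose x1 : 'I_4 := lshift 2 (1 : 'I_2).
pose y0 : 'I_4 := rshift 2 (0 : 'I_2); pose y1 : 'I_4 := rshift 2 (1 : 'I_2).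
have M p q r : a 0 p * (u 0 q * (u *m Jmx R) 0 r - u 0 r * (u *m Jmx R) 0 q)
    - a 0 q * (u 0 p * (u *m Jmx R) 0 r - u 0 r * (u *m Jmx R) 0 p)
    + a 0 r * (u 0 p * (u *m Jmx R) 0 q - u 0 q * (u *m Jmx R) 0 p) = 0.
  have := H (fun i : 'I_3 => nth p [:: p; q; r] i).
  move: (u *m Jmx R) => w; rewrite det3E !mxE /= => <-; exact: erefl.
have J0 : (u *m Jmx R) 0 x0 = - u 0 y0 by exact: mulJ_lshift.
have J1 : (u *m Jmx R) 0 x1 = - u 0 y1 by exact: mulJ_lshift.
have J2 : (u *m Jmx R) 0 y0 = u 0 x0 by exact: mulJ_rshift.
have J3 : (u *m Jmx R) 0 y1 = u 0 x1 by exact: mulJ_rshift.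
have D0 : D * (toC u 0 0)^* = 0.
  apply: complex_eqP.
    transitivity (- 0 : R); last by rewrite oppr0.
    rewrite -(M x0 y0 x1) J0 J1 J2 /D !toCE -/x0 -/x1 -/y0 -/y1
      !(cReM, cImM, cReN, cReD, cImD, cImN, cReJ, cImJ) /=.
    ring.
  transitivity (- 0 : R); last by rewrite oppr0.
  rewrite -(M x0 y0 y1) J0 J3 J2 /D !toCE -/x0 -/x1 -/y0 -/y1
      !(cReM, cImM, cReN, cReD, cImD, cImN, cReJ, cImJ) /=.
  ring.
have D1 : D * (toC u 0 1)^* = 0.
  apply: complex_eqP.
    transitivity (0 : R); last by [].
    rewrite -(M x1 y1 x0) J0 J1 J3 /D !toCE -/x0 -/x1 -/y0 -/y1
      !(cReM, cImM, cReN, cReD, cImD, cImN, cReJ, cImJ) /=.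
    ring.
  transitivity (0 : R); last by [].
  rewrite -(M x1 y1 y0) J1 J2 J3 /D !toCE -/x0 -/x1 -/y0 -/y1
      !(cReM, cImM, cReN, cReD, cImD, cImN, cReJ, cImJ) /=.
  ring.
have [u0|u0] := eqVneq (toC u 0 0) 0; last first.
  by move/eqP: D0; rewrite mulf_eq0 conj_eq0 (negPf u0) orbF.
have [u1|u1] := eqVneq (toC u 0 1) 0; last first.
  by move/eqP: D1; rewrite mulf_eq0 conj_eq0 (negPf u1) orbF.
by rewrite /D u0 u1 !mulr0 subrr.
Qed.

End WedgeComplex.

Section AbstractForm.
Variable R : realType.
Implicit Types (u v w : 'rV[R]_4).

Definition x0i : 'I_4 := lshift 2 (0 : 'I_2).
Definition x1i : 'I_4 := lshift 2 (1 : 'I_2).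
Definition y0i : 'I_4 := rshift 2 (0 : 'I_2).
Definition y1i : 'I_4 := rshift 2 (1 : 'I_2).

Definition ev (a : 'I_4) : 'rV[R]_4 := delta_mx 0 a.

Lemma evJ0 : ev x0i *m Jmx R = ev y0i.
Proof.
apply/rowP; elim/ord4P; elim/ord2P; by rewrite ?mulJ_lshift ?mulJ_rshift !mxE /= ?oppr0.
Qed.

Lemma evJ1 : ev x1i *m Jmx R = ev y1i.
Proof.
apply/rowP; elim/ord4P; elim/ord2P; by rewrite ?mulJ_lshift ?mulJ_rshift !mxE /= ?oppr0.
Qed.

Lemma toC_ev (j : 'I_2) : toC (ev (lshift 2 j : 'I_4)) = delta_mx 0 j.
Proof.
apply/rowP => i; rewrite toCE !mxE /=.
by move: i j; elim/ord2P; elim/ord2P.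
Qed.

Lemma toCD u v : toC (u + v) = toC u + toC v.
Proof. by apply/rowP => j; rewrite [RHS]mxE !toCE !mxE. Qed.

Section AbstractBeta.
Variable L : 'rV[R]_4 -> 'rV[R]_4 -> 'rV[R]_4.
Hypothesis Ladd : forall u u' v, L (u + u') v = L u v + L u' v.
Hypothesis LS : forall u v, L u v = L v u.
Hypothesis LJ : forall u v, L u (v *m Jmx R) = L u v *m Jmx R.
Hypothesis LW : forall u, wedge3_eq0 (L u u) u (u *m Jmx R).

(* L u u is a complex multiple of u; comparing the values on e0, e1, e0 + e1 and
   e0 - e1 relates the coefficients. *)
Lemma beta_form : exists b0 b1 : R[i],
  [/\ L (ev x0i) (ev x0i) = cact (2 * b0) (ev x0i),
      L (ev x1i) (ev x1i) = cact (2 * b1) (ev x1i)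
    & L (ev x0i) (ev x1i) = cact b1 (ev x0i) + cact b0 (ev x1i)].
Proof.
have Laddr u v v' : L u (v + v') = L u v + L u v' by rewrite LS Ladd !(LS u).
have JJ (a : 'rV[R]_4) : a *m Jmx R *m Jmx R = - a.
  rewrite !mulJE cactA -expr2 sqr_i cactE cReN cImN /= oppr0 scale0r addr0.
  by rewrite scaleN1r.
have LN u v : L u (- v) = - L u v by rewrite -JJ !LJ JJ.
have tN u : toC (- u) = - toC u.
  by apply/rowP => j; rewrite [RHS]mxE !toCE !mxE.
pose e0 := ev x0i; pose e1 := ev x1i; rewrite -/e0 -/e1.
have t0 : toC e0 = delta_mx 0 0 by exact: toC_ev.
have t1 : toC e1 = delta_mx 0 1 by exact: toC_ev.
pose a := toC (L e0 e0); pose b := toC (L e1 e1); pose c := toC (L e0 e1).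
have dE i j : (delta_mx 0 i : 'rV[R[i]]_2) 0 j = (i == j)%:R by rewrite mxE eq_sym.
have E (M N : 'rV[R[i]]_2) j : (M + N) 0 j = M 0 j + N 0 j by rewrite mxE.
have EN (M : 'rV[R[i]]_2) j : (- M) 0 j = - M 0 j by rewrite mxE.
have EZ (M : 'rV[R[i]]_2) l j : (l *: M) 0 j = l * M 0 j by rewrite mxE.
have a1 : a 0 1 = 0.
  have := wedge3_toC (LW e0); rewrite -/a t0 !dE /= mulr0 mulr1; exact/esym.
have b0 : b 0 0 = 0.
  by have := wedge3_toC (LW e1); rewrite -/b t1 !dE /= mulr0 mulr1.
have s1 : a 0 0 + 2 * c 0 0 = b 0 1 + 2 * c 0 1.
  have := wedge3_toC (LW (e0 + e1)).
  rewrite !Ladd !Laddr (LS e1 e0) !toCD -/a -/b -/c t0 t1.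
  rewrite !E !dE /= a1 b0 !(addr0, add0r, mulr1) => e.
  by rewrite mulr_natl mulr2n addrA e; ring.
have s2 : a 0 0 - 2 * c 0 0 = - b 0 1 + 2 * c 0 1.
  have := wedge3_toC (LW (e0 - e1)).
  rewrite !Ladd !Laddr (LS (- e1) e0) !LN (LS (- e1) e1) !LN.
  rewrite !toCD !tN -/a -/b -/c t0 t1.
  rewrite !(E, EN) !dE /= a1 b0 !(addr0, add0r, oppr0, mulr1, sub0r, opprK) => e.
  transitivity (- ((a 0 0 - c 0 0 - c 0 0) * -1)); first by ring.
  by rewrite e; ring.
have n2 : (2 : R[i]) != 0 by rewrite pnatr_eq0.
have ac : a 0 0 = 2 * c 0 1.
  apply: (mulfI n2); transitivity ((a 0 0 + 2 * c 0 0) + (a 0 0 - 2 * c 0 0)); first by ring.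
  by rewrite s1 s2; ring.
have bc : b 0 1 = 2 * c 0 0.
  apply: (mulfI n2); transitivity ((b 0 1 + 2 * c 0 1) - (- b 0 1 + 2 * c 0 1)); first by ring.
  by rewrite -s1 -s2; ring.
(* b(e_0) is the e_1-component of [L e0 e1], and b(e_1) its e_0-component. *)
exists (c 0 1), (c 0 0).
by split; rewrite -[LHS]toCK -[RHS]toCK; congr ofC; apply/rowP; elim/ord2P;
  rewrite ?toCD !toC_cact ?t0 ?t1 -/a -/b -/c ?E !EZ !dE /= ?mulr0 ?mulr1 ?addr0 ?add0r.
Qed.

End AbstractBeta.

End AbstractForm.

Section BetaForm.
Variables (R : realType) (g : cotensor2 R) (k : 'I_3) (A : set 'rV[R]_4).
Hypothesis oA : open A.
Hypothesis sg : smooth_on A (g k).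
Hypothesis gS : forall x, A x -> (g k x)^T = g k x.
Hypothesis gU : forall x, A x -> g k x \in unitmx.
Hypothesis gJ : forall x, A x ->
  forall u v, bil (g k x) (u *m Jmx R) (v *m Jmx R) = bil (g k x) u v.
Local Notation LC := (levi_civita g k).
Hypothesis LJ : forall x u v, A x -> LC x u (v *m Jmx R) = LC x u v *m Jmx R.
Hypothesis LS : forall x u v, A x -> LC x u v = LC x v u.
Hypothesis LW : forall x u, A x -> wedge3_eq0 (LC x u u) u (u *m Jmx R).
Implicit Types (x u v w : 'rV[R]_4).
Local Notation ev := (@ev R).

Lemma smooth_entry a b : smooth_on A (fun y => g k y a b).
Proof. by move=> n; have /(Ck_on_mxP n _ oA) := sg n; exact. Qed.

Lemma smooth_sum n (f : 'I_n -> 'rV[R]_4 -> R) : (forall i, smooth_on A (f i)) ->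
  smooth_on A (fun y => \sum_i f i y).
Proof.
elim: n f => [|n IH] f sf m.
  by apply: Ck_on_ext (Ck_on_cst m A (0 : R)) => // y _; rewrite big_ord0.
apply: Ck_on_ext (Ck_onD oA (IH _ (fun i => sf (widen_ord (leqnSn n) i)) m) (sf ord_max m)) => //.
by move=> y _; rewrite big_ord_recr.
Qed.

Lemma smooth_bil u v : smooth_on A (fun y => bil (g k y) u v).
Proof.
have : smooth_on A (fun y => \sum_a \sum_b u 0 a * g k y a b * v 0 b).
  apply: smooth_sum => a; apply: smooth_sum => b n.
  exact: Ck_onM oA (Ck_onM oA (Ck_on_cst n A (u 0 a)) (smooth_entry a b n))
    (Ck_on_cst n A (v 0 b)).
by move=> + n => /(_ n); apply: Ck_on_ext => // y _; rewrite bilE.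
Qed.

Lemma derive_bilD x u u' v w : A x ->
  'D_w (fun y => bil (g k y) (u + u') v) x =
  'D_w (fun y => bil (g k y) u v) x + 'D_w (fun y => bil (g k y) u' v) x.
Proof.
move=> Ax; have -> : (fun y => bil (g k y) (u + u') v) =
    (fun y => bil (g k y) u v + bil (g k y) u' v) by apply/funext => y; rewrite bilDl.
have D a : is_derive x w (fun y => bil (g k y) a v) ('D_w (fun y => bil (g k y) a v) x).
  by apply: derivableP; exact: smooth_on_derivable (smooth_bil a v) Ax.
by have [_ ->] := is_derive_add (D u) (D u').
Qed.

(** The directional derivative along [u + u'] splits because the components of [g] are continuously
    differentiable; the other two terms are additive by bilinearity. *)
Lemma LC_addl x u u' v : A x -> LC x (u + u') v = LC x u v + LC x u' v.
Proof.
move=> Ax; rewrite /levi_civita -mulmxDl; congr (_ *m _); apply/rowP => m.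
rewrite !mxE !derive_bilD//.
by rewrite (C1_deriveD u u' oA Ax (smooth_bil _ _ 1%N)); field.
Qed.

Lemma LC_beta x : A x -> exists b0 b1 : R[i],
  [/\ LC x (ev x0i) (ev x0i) = cact (2 * b0) (ev x0i),
      LC x (ev x1i) (ev x1i) = cact (2 * b1) (ev x1i)
    & LC x (ev x0i) (ev x1i) = cact b1 (ev x0i) + cact b0 (ev x1i)].
Proof.
move=> Ax; apply: beta_form.
- by move=> u u' v; exact: LC_addl.
- by move=> u v; exact: LS.
- by move=> u v; exact: LJ.
- by move=> u; exact: LW.
Qed.

End BetaForm.

(** * Symmetric J-invariant real matrices as hermitian 2 × 2 matrices *)

Section HermitianMatrix.
Variables (R : realType) (G : 'M[R]_4).
Hypothesis GS : G^T = G.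
Hypothesis GJ : forall u v, bil G (u *m Jmx R) (v *m Jmx R) = bil G u v.
Local Notation ev := (@ev R).
Local Notation J := (Jmx R).

Let bJJ (a : 'rV[R]_4) : a *m J *m J = - a.
Proof.
rewrite !mulJE cactA -expr2 sqr_i cactE cReN cImN /= oppr0 scale0r addr0.
by rewrite scaleN1r.
Qed.

Let bilN u v : bil G (- u) v = - bil G u v.
Proof. by rewrite -scaleN1r bilZl mulN1r. Qed.

Let bilJ u v : bil G (u *m J) v = - bil G u (v *m J).
Proof. by rewrite -GJ bJJ bilN. Qed.

Let bilJv u : bil G (u *m J) u = 0.
Proof.
have := bilJ u u; rewrite (bilC u (u *m J) GS); move: (bil _ _ _) => b; lra.
Qed.

Let bil_cact (l : R[i]) u v :
  bil G (cact l u) v = complex.Re l * bil G u v + complex.Im l * bil G (u *m J) v.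
Proof. by rewrite cactE bilDl !bilZl. Qed.

(** Real parameters of the hermitian form G(u, v) + i G(u, J v): diagonal entries [s1], [s2] and
    off-diagonal entry s + i t. *)
Let s1 := G x0i x0i.
Let s2 := G x1i x1i.
Let s := G x0i x1i.
Let t := G x0i y1i.

Let b00 : bil G (ev x0i) (ev x0i) = s1. Proof. exact: bil_delta. Qed.
Let b11 : bil G (ev x1i) (ev x1i) = s2. Proof. exact: bil_delta. Qed.
Let b01 : bil G (ev x0i) (ev x1i) = s. Proof. exact: bil_delta. Qed.
Let b10 : bil G (ev x1i) (ev x0i) = s. Proof. by rewrite bilC. Qed.
Let b0J : bil G (ev x0i *m J) (ev x1i) = - t.
Proof. by rewrite bilJ evJ1; congr (- _); exact: bil_delta. Qed.
Let b1J : bil G (ev x1i *m J) (ev x0i) = t.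
Proof. by rewrite bilC// evJ1; exact: bil_delta. Qed.

Lemma bil_cact00 l : bil G (cact l (ev x0i)) (ev x0i) = complex.Re l * s1.
Proof. by rewrite bil_cact b00 bilJv mulr0 addr0. Qed.
Lemma bil_cact11 l : bil G (cact l (ev x1i)) (ev x1i) = complex.Re l * s2.
Proof. by rewrite bil_cact b11 bilJv mulr0 addr0. Qed.
Lemma bil_cact01 l : bil G (cact l (ev x0i)) (ev x1i) = complex.Re l * s - complex.Im l * t.
Proof. by rewrite bil_cact b01 b0J mulrN. Qed.
Lemma bil_cact10 l : bil G (cact l (ev x1i)) (ev x0i) = complex.Re l * s + complex.Im l * t.
Proof. by rewrite bil_cact b10 b1J. Qed.
Lemma bil_cact0J l : bil G (cact l (ev x0i)) (ev y1i) = complex.Re l * t + complex.Im l * s.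
Proof. by rewrite -evJ1 bil_cact GJ b01 bilC// b1J. Qed.
Lemma bil_cact1J l : bil G (cact l (ev x1i)) (ev y1i) = complex.Im l * s2.
Proof. by rewrite -evJ1 bil_cact GJ b11 bilC// bilJv mulr0 add0r. Qed.

Lemma hermitian_entries :
  ((G y0i y0i = s1) * (G y1i y1i = s2) * (G y0i y1i = s) * (G y0i x1i = - t) *
   (G x0i y0i = 0) * (G y0i x0i = 0) * (G x1i y1i = 0) * (G y1i x1i = 0) *
   (G x1i x0i = s) * (G y1i x0i = t) * (G y1i y0i = s) * (G x1i y0i = - t))%type.
Proof.
have GE a b : G a b = G b a by rewrite -[in LHS]GS mxE.
have e1 : G y0i y0i = s1 by rewrite -bil_delta -!/(ev _) -evJ0 GJ.
have e2 : G y1i y1i = s2 by rewrite -bil_delta -!/(ev _) -evJ1 GJ.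
have e3 : G y0i y1i = s by rewrite -bil_delta -!/(ev _) -evJ0 -evJ1 GJ.
have e4 : G y0i x1i = - t by rewrite -bil_delta -!/(ev _) -evJ0.
have e5 : G y0i x0i = 0 by rewrite -bil_delta -!/(ev _) -evJ0.
have e6 : G y1i x1i = 0 by rewrite -bil_delta -!/(ev _) -evJ1.
by do !split; rewrite // GE.
Qed.

End HermitianMatrix.

(** The derivatives are grouped by complex coordinate, in the order x_0, y_0, x_1, y_1, unlike the
    coordinates of R^4. *)
Definition grad4 (R : realType) (F : 'rV[R]_4 -> R) (x : 'rV[R]_4) (a b c d : R) : Prop :=
  [/\ 'D_(ev R x0i) F x = a, 'D_(ev R y0i) F x = b,
      'D_(ev R x1i) F x = c & 'D_(ev R y1i) F x = d].

(** * First derivatives of a compatible metric *)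

Section MetricSystem.
Variables (R : realType) (g : cotensor2 R) (k : 'I_3) (A : set 'rV[R]_4).
Hypothesis oA : open A.
Hypothesis sg : smooth_on A (g k).
Hypothesis gS : forall x, A x -> (g k x)^T = g k x.
Hypothesis gU : forall x, A x -> g k x \in unitmx.
Hypothesis gJ : forall x, A x ->
  forall u v, bil (g k x) (u *m Jmx R) (v *m Jmx R) = bil (g k x) u v.
Local Notation LC := (levi_civita g k).
Hypothesis LJ : forall x u v, A x -> LC x u (v *m Jmx R) = LC x u v *m Jmx R.
Hypothesis LS : forall x u v, A x -> LC x u v = LC x v u.
Hypothesis LW : forall x u, A x -> wedge3_eq0 (LC x u u) u (u *m Jmx R).
Implicit Types (x u v w : 'rV[R]_4).
Local Notation ev := (@ev R).

(** The Levi-Civita connection is metric: in the sum of the two Christoffel formulas all other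
    derivatives cancel by symmetry of [g]. *)
Lemma derive_metric x w a b : A x -> 'D_w (fun y => g k y a b) x =
  bil (g k x) (LC x w (ev a)) (ev b) + bil (g k x) (LC x w (ev b)) (ev a).
Proof.
move=> Ax.
have E u m : bil (g k x) (LC x w u) (ev m) =
    2^-1 * ('D_w (fun y => bil (g k y) u (ev m)) x
            + 'D_u (fun y => bil (g k y) w (ev m)) x
            - 'D_(ev m) (fun y => bil (g k y) w u) x).
  by rewrite -bil_mulmx /levi_civita mulmxKV ?gU// mxE.
rewrite !E.
have -> : 'D_w (fun y => g k y a b) x = 'D_w (fun y => bil (g k y) (ev a) (ev b)) x.
  by congr derive; apply/funext => y; rewrite bil_delta.
have -> : 'D_w (fun y => bil (g k y) (ev b) (ev a)) x =
    'D_w (fun y => bil (g k y) (ev a) (ev b)) x.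
  apply: near_eq_derive; apply: filterS (open_near oA Ax) => y Ay.
  by apply: bilC; exact: gS.
by field.
Qed.

(* p_j + i q_j are the coefficients of the 1-form b in Gamma (u, v) = b(u) v + b(v) u *)
Lemma metric_system x : A x -> exists p0 q0 p1 q1 : R,
  let s1 := g k x x0i x0i in let s2 := g k x x1i x1i in
  let s := g k x x0i x1i in let t := g k x x0i y1i in
  [/\ grad4 (fun y => g k y x0i x0i) x (4 * p0 * s1) (- 4 * q0 * s1)
        (2 * (p1 * s1 + p0 * s + q0 * t)) (2 * (- q1 * s1 - q0 * s + p0 * t)),
      grad4 (fun y => g k y x1i x1i) x (2 * (p0 * s2 + p1 * s - q1 * t))
        (2 * (- q0 * s2 - q1 * s - p1 * t)) (4 * p1 * s2) (- 4 * q1 * s2),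
      grad4 (fun y => g k y x0i x1i) x (3 * p0 * s - q0 * t + p1 * s1)
        (- 3 * q0 * s - p0 * t - q1 * s1)
        (3 * p1 * s + q1 * t + p0 * s2) (- 3 * q1 * s + p1 * t - q0 * s2)
    & grad4 (fun y => g k y x0i y1i) x (3 * p0 * t + q0 * s - q1 * s1)
        (- 3 * q0 * t + p0 * s - p1 * s1)
        (3 * p1 * t - q1 * s + q0 * s2) (- 3 * q1 * t - p1 * s + p0 * s2)].
Proof.
move=> Ax; have [b0 [b1 [e00 e11 e01]]] := LC_beta oA sg LJ LS LW Ax.
exists (complex.Re b0), (complex.Im b0), (complex.Re b1), (complex.Im b1) => s1 s2 s t.
have D w a b := derive_metric w a b Ax.
have LS' u v : LC x u v = LC x v u by exact: LS.
have LJ' u v : LC x u (v *m Jmx R) = LC x u v *m Jmx R by exact: LJ.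
move: D LS' LJ' e00 e11 e01; move: (LC x) => L D LS' LJ' e00 e11 e01.
(* By symmetry [L] is complex-linear in its first argument too. *)
have L0 v : L (ev y0i) v = cact 'i%C (L (ev x0i) v).
  by rewrite -evJ0 LS' LJ' LS' mulJE.
have L1 v : L (ev y1i) v = cact 'i%C (L (ev x1i) v).
  by rewrite -evJ1 LS' LJ' LS' mulJE.
have LR u : L u (ev y1i) = cact 'i%C (L u (ev x1i)) by rewrite -evJ1 LJ' mulJE.
have e10 : L (ev x1i) (ev x0i) = cact b1 (ev x0i) + cact b0 (ev x1i) by rewrite LS'.
have cD l u v : cact l (u + v) = cact l u + cact l v.
  by rewrite !cactE mulmxDl !scalerDr addrACA.
have [GS GJ] := (gS Ax, gJ Ax).
have D1 w := D w x0i x0i; have D2 w := D w x1i x1i.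
have D3 w := D w x0i x1i; have D4 w := D w x0i y1i.
have B00 := bil_cact00 GS GJ; have B11 := bil_cact11 GS GJ; have B01 := bil_cact01 GJ.
have B10 := bil_cact10 GS; have B0J := bil_cact0J GS GJ; have B1J := bil_cact1J GS GJ.
move: D1 D2 D3 D4 B00 B11 B01 B10 B0J B1J; rewrite -/s1 -/s2 -/s -/t {D}.
rewrite /grad4; move: (fun y => g k y x0i x0i) (fun y => g k y x1i x1i)
  (fun y => g k y x0i x1i) (fun y => g k y x0i y1i) => F1 F2 F3 F4.
move: s1 s2 s t L0 L1 LR e00 e11 e01 e10 cD {GS GJ LS' LJ'}; move: (g k x) => G.
move: (ev x0i) (ev x1i) (ev y0i) (ev y1i) => e0 e1 f0 f1.
move=> s1 s2 s t L0 L1 LR e00 e11 e01 e10 cD D1 D2 D3 D4 B00 B11 B01 B10 B0J B1J.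
have V0 l m : bil G (cact l e0 + cact m e1) e0 =
    complex.Re l * s1 + (complex.Re m * s + complex.Im m * t).
  by rewrite bilDl B00 B10.
have V1 l m : bil G (cact l e0 + cact m e1) e1 =
    complex.Re l * s - complex.Im l * t + complex.Re m * s2.
  by rewrite bilDl B01 B11.
have VJ l m : bil G (cact l e0 + cact m e1) f1 =
    complex.Re l * t + complex.Im l * s + complex.Im m * s2.
  by rewrite bilDl B0J B1J.
have Z (a : 'rV[R]_4) : cact 0 a = 0 by rewrite cactE !scale0r addr0.
have E00 : L e0 e0 = cact (2 * b0) e0 + cact 0 e1 by rewrite Z addr0.
have E11 : L e1 e1 = cact 0 e0 + cact (2 * b1) e1 by rewrite Z add0r.
have EI u v l m : L u v = cact l e0 + cact m e1 ->
    cact 'i%C (L u v) = cact ('i%C * l) e0 + cact ('i%C * m) e1.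
  by move=> ->; rewrite cD !cactA.
have F00 : L f0 e0 = cact ('i%C * (2 * b0)) e0 + cact ('i%C * 0) e1 by rewrite L0; exact: EI E00.
have F01 : L f0 e1 = cact ('i%C * b1) e0 + cact ('i%C * b0) e1 by rewrite L0; exact: EI e01.
have F10 : L f1 e0 = cact ('i%C * b1) e0 + cact ('i%C * b0) e1 by rewrite L1; exact: EI e10.
have F11 : L f1 e1 = cact ('i%C * 0) e0 + cact ('i%C * (2 * b1)) e1 by rewrite L1; exact: EI E11.
split; split.
- rewrite D1 E00 V0 ?(cReM, cImM) /=; ring.
- rewrite D1 F00 V0 ?(cReM, cImM) /=; ring.
- rewrite D1 e10 V0 ?(cReM, cImM) /=; ring.
- rewrite D1 F10 V0 ?(cReM, cImM) /=; ring.
- rewrite D2 e01 V1 ?(cReM, cImM) /=; ring.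
- rewrite D2 F01 V1 ?(cReM, cImM) /=; ring.
- rewrite D2 E11 V1 ?(cReM, cImM) /=; ring.
- rewrite D2 F11 V1 ?(cReM, cImM) /=; ring.
- rewrite D3 E00 e01 V1 V0 ?(cReM, cImM) /=; ring.
- rewrite D3 F00 F01 V1 V0 ?(cReM, cImM) /=; ring.
- rewrite D3 e10 E11 V1 V0 ?(cReM, cImM) /=; ring.
- rewrite D3 F10 F11 V1 V0 ?(cReM, cImM) /=; ring.
- rewrite D4 LR E00 (EI _ _ _ _ e01) VJ V0 ?(cReM, cImM) /=; ring.
- rewrite D4 LR F00 (EI _ _ _ _ F01) VJ V0 ?(cReM, cImM) /=; ring.
- rewrite D4 LR e10 (EI _ _ _ _ E11) VJ V0 ?(cReM, cImM) /=; ring.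
- rewrite D4 LR F10 (EI _ _ _ _ F11) VJ V0 ?(cReM, cImM) /=; ring.
Qed.

End MetricSystem.

(** * The weighted metric and its differential system *)

Section CubeRoot.
Variables (R : realType) (V : normedModType R).

Lemma is_derive_comp1 (f : V -> R) (h : R -> R) (x v : V) (df dh : R) :
  is_derive x v f df -> is_derive (f x) 1 h dh ->
  is_derive x v (fun y => h (f y)) (dh * df).
Proof.
move=> [fxv <-] [hx <-].
have x0 : x = 0 *: v + x by rewrite scale0r add0r.
pose F := fun s : R => f (s *: v + x).
have F0 : F 0 = f x by rewrite /F -x0.
have dF : derivable F 0 1 by apply/derivable_lineP; rewrite -x0.
rewrite -F0 in hx *; have De := derive1_comp dF hx.
split.
  rewrite {1}x0; apply/derivable_lineP/derivable1_diffP.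
  have -> : (fun s : R => h (f (s *: v + x))) = h \o F by [].
  by apply: differentiable_comp; apply/derivable1_diffP.
have Ex : 'D_v f x = 'D_1 F 0 by rewrite -derive_line -x0.
have Eh : 'D_v (fun y => h (f y)) x = 'D_1 (h \o F) 0.
  by rewrite {1}x0 derive_line.
by rewrite Eh Ex -!derive1E.
Qed.

(* r^(-1/3), odd and smooth on both half lines *)
Definition icroot (r : R) : R := r * (r * r) `^ (- (2 / 3)).

Lemma icroot3 r : r != 0 -> icroot r ^+ 3 * r = 1.
Proof.
move=> r0; have rr : 0 <= r * r by rewrite -expr2 sqr_ge0.
have e : ((r * r) `^ (- (2 / 3))) ^+ 3 = (r * r) ^- 2.
  rewrite -powR_mulrn ?powR_ge0// -powRrM.
  have -> : - (2 / 3) * 3%:R = - 2%:R :> R by field.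
  by rewrite powR_invn.
by rewrite /icroot exprMn e; field.
Qed.

Lemma is_derive_icroot (f : V -> R) (x v : V) (df : R) : f x != 0 ->
  is_derive x v f df ->
  is_derive x v (fun y => icroot (f y)) (- (icroot (f x) / f x / 3) * df).
Proof.
move=> f0 Df.
have ff : 0 < f x * f x by rewrite -expr2 exprn_even_gt0.
have D2 := is_derive_mul Df Df.
have Dp := is_derive_comp1 D2 (is_derive1_powR (- (2 / 3)) ff).
have := is_derive_mul Df Dp.
have -> : (f x * f x) `^ (- (2 / 3) - 1) = (f x * f x) `^ (- (2 / 3)) / (f x * f x).
  have n0 : f x * f x != 0 by rewrite gt_eqF.
  by rewrite powRB ?n0 ?implybT// powRr1// ltW.
rewrite /icroot; set p := _ `^ _; set D := (X in is_derive _ _ _ X -> _).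
have -> : D = - (f x * p / f x / 3) * df by rewrite /D; field.
by [].
Qed.

End CubeRoot.

Section SmoothCubeRoot.
Variables (R : realType) (V : normedModType R).

(** The derivative is again [icroot (f x)] times a smooth function, which closes the induction on
    the order. *)
Lemma smooth_icroot (A : set V) (f : V -> R) : open A ->
  (forall x, A x -> f x != 0) -> smooth_on A f ->
  smooth_on A (fun y => icroot (f y)).
Proof.
move=> oA f0 sf.
have Dd x v : A x -> is_derive x v (fun y => icroot (f y))
    (- (icroot (f x) / f x / 3) * 'D_v f x).
  move=> Ax; apply: is_derive_icroot; first exact: f0.
  by apply: derivableP; exact: smooth_on_derivable sf Ax.
have cd x : A x -> {for x, continuous (fun y => icroot (f y))}.
  move=> Ax; have [+ _] := sf 0%N => /(_ x Ax) cf.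
  have [+ _] := is_derive_icroot (f0 x Ax) (is_derive_id (f x) (1 : R)).
  move=> /derivable1_diffP/differentiable_continuous ci.
  exact: (continuous_comp cf ci).
elim=> [|n IH]; split=> // v; split=> [x /(Dd _ v)[]//|].
have sD := smooth_on_derive v sf n.
have := Ck_onM oA (Ck_onM oA (Ck_onN oA (Ck_onM oA IH (Ck_onV oA f0 (sf n))))
  (Ck_on_cst n A (3^-1 : R))) sD.
apply: Ck_on_ext => // x Ax; have [_ ->] := Dd x v Ax.
by rewrite mulNr.
Qed.

End SmoothCubeRoot.

(* D_w tau = w r^* + r w^* for tau = [[TA, TP + i TQ], [TP - i TQ, TB]] and
   r = (r1 + i c1, r2 + i c2). *)
Definition tau_grads (R : realType) (TA TB TP TQ : 'rV[R]_4 -> R) (x : 'rV[R]_4)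
    (r1 c1 r2 c2 : R) : Prop :=
  [/\ grad4 TA x (2 * r1) (2 * c1) 0 0, grad4 TB x 0 0 (2 * r2) (2 * c2),
      grad4 TP x r2 c2 r1 c1 & grad4 TQ x (- c2) r2 c1 (- r1)].

(** * Weighting the cofactors by a power of the determinant *)

Section Tau.
Variables (R : realType) (A : set 'rV[R]_4) (s1 s2 s t : 'rV[R]_4 -> R).
Hypothesis oA : open A.
Hypotheses (S1 : smooth_on A s1) (S2 : smooth_on A s2).
Hypotheses (S : smooth_on A s) (T : smooth_on A t).

Definition hdet y : R := s1 y * s2 y - (s y * s y + t y * t y).
Hypothesis hdet0 : forall x, A x -> hdet x != 0.
Let d y := icroot (hdet y).

Lemma smooth_add (f g : 'rV[R]_4 -> R) :
  smooth_on A f -> smooth_on A g -> smooth_on A (fun y => f y + g y).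
Proof. by move=> sf sg n; exact: Ck_onD. Qed.
Lemma smooth_mul (f g : 'rV[R]_4 -> R) :
  smooth_on A f -> smooth_on A g -> smooth_on A (fun y => f y * g y).
Proof. by move=> sf sg n; exact: Ck_onM. Qed.
Lemma smooth_opp (f : 'rV[R]_4 -> R) : smooth_on A f -> smooth_on A (fun y => - f y).
Proof. by move=> sf n; exact: Ck_onN. Qed.

Lemma smooth_hdet : smooth_on A hdet.
Proof.
by apply: smooth_add; [exact: smooth_mul|apply: smooth_opp; apply: smooth_add; exact: smooth_mul].
Qed.

Lemma smooth_weight (f : 'rV[R]_4 -> R) : smooth_on A f ->
  smooth_on A (fun y => d y * d y * f y).
Proof.
have sd : smooth_on A d by apply: smooth_icroot => //; exact: smooth_hdet.
by move=> sf; apply: smooth_mul => //; exact: smooth_mul.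
Qed.

Let D (f : 'rV[R]_4 -> R) x v : smooth_on A f -> A x -> is_derive x v f ('D_v f x).
Proof. by move=> sf Ax; apply: derivableP; exact: smooth_on_derivable sf Ax. Qed.

Lemma derive_hdet x v : A x -> 'D_v hdet x =
  s1 x * 'D_v s2 x + s2 x * 'D_v s1 x - 2 * (s x * 'D_v s x + t x * 'D_v t x).
Proof.
move=> Ax.
have [_ ->] := is_derive_add (is_derive_mul (D v S1 Ax) (D v S2 Ax))
  (is_derive_opp (is_derive_add (is_derive_mul (D v S Ax) (D v S Ax))
    (is_derive_mul (D v T Ax) (D v T Ax)))).
by ring.
Qed.

(** A logarithmic derivative 6 p of the determinant gives -2 p for its power -1/3, hence -4 p for
    the square. *)
Lemma derive_weight (f : 'rV[R]_4 -> R) x v (p : R) : A x -> smooth_on A f ->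
  'D_v hdet x = 6 * p * hdet x ->
  'D_v (fun y => d y * d y * f y) x = d x * d x * ('D_v f x - 4 * p * f x).
Proof.
move=> Ax sf e; have h0 := hdet0 Ax.
have Dd := is_derive_icroot h0 (D v smooth_hdet Ax).
have [_ ->] := is_derive_mul (is_derive_mul Dd Dd) (D v sf Ax).
rewrite e -/(d x); by field.
Qed.

Lemma tau_system x : A x -> (exists p0 q0 p1 q1 : R,
  let s1' := s1 x in let s2' := s2 x in let s' := s x in let t' := t x in
  [/\ grad4 s1 x (4 * p0 * s1') (- 4 * q0 * s1')
        (2 * (p1 * s1' + p0 * s' + q0 * t')) (2 * (- q1 * s1' - q0 * s' + p0 * t')),
      grad4 s2 x (2 * (p0 * s2' + p1 * s' - q1 * t'))
        (2 * (- q0 * s2' - q1 * s' - p1 * t')) (4 * p1 * s2') (- 4 * q1 * s2'),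
      grad4 s x (3 * p0 * s' - q0 * t' + p1 * s1')
        (- 3 * q0 * s' - p0 * t' - q1 * s1')
        (3 * p1 * s' + q1 * t' + p0 * s2') (- 3 * q1 * s' + p1 * t' - q0 * s2')
    & grad4 t x (3 * p0 * t' + q0 * s' - q1 * s1')
        (- 3 * q0 * t' + p0 * s' - p1 * s1')
        (3 * p1 * t' - q1 * s' + q0 * s2') (- 3 * q1 * t' - p1 * s' + p0 * s2')]) ->
  exists r1 c1 r2 c2, tau_grads (fun y => d y * d y * s2 y) (fun y => d y * d y * s1 y)
    (fun y => d y * d y * - s y) (fun y => d y * d y * t y) x r1 c1 r2 c2.
Proof.
move=> Ax [p0 [q0 [p1 [q1]]]] /= [[a1 a2 a3 a4] [b1 b2 b3 b4] [u1 u2 u3 u4] [v1 v2 v3 v4]].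
have SN : smooth_on A (fun y => - s y) by exact: smooth_opp.
have DN v : 'D_v (fun y => - s y) x = - 'D_v s x by have [_ ->] := is_derive_opp (D v S Ax).
have h1 : 'D_(ev R x0i) hdet x = 6 * p0 * hdet x.
  by rewrite derive_hdet// a1 b1 u1 v1 /hdet; ring.
have h2 : 'D_(ev R y0i) hdet x = 6 * (- q0) * hdet x.
  by rewrite derive_hdet// a2 b2 u2 v2 /hdet; ring.
have h3 : 'D_(ev R x1i) hdet x = 6 * p1 * hdet x.
  by rewrite derive_hdet// a3 b3 u3 v3 /hdet; ring.
have h4 : 'D_(ev R y1i) hdet x = 6 * (- q1) * hdet x.
  by rewrite derive_hdet// a4 b4 u4 v4 /hdet; ring.
have W1 f sf := @derive_weight f x _ _ Ax sf h1.
have W2 f sf := @derive_weight f x _ _ Ax sf h2.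
have W3 f sf := @derive_weight f x _ _ Ax sf h3.
have W4 f sf := @derive_weight f x _ _ Ax sf h4.
pose dd := d x * d x.
(* The vector r is - tau applied to the conjugate of (p_0 + i q_0, p_1 + i q_1). *)
exists (- dd * (s2 x * p0 - s x * p1 + t x * q1)), (dd * (s2 x * q0 - s x * q1 - t x * p1)),
  (- dd * (- s x * p0 - t x * q0 + s1 x * p1)), (dd * (- s x * q0 + t x * p0 + s1 x * q1)).
split; split; rewrite (W1, W2, W3, W4)// ?DN ?(a1, a2, a3, a4, b1, b2, b3, b4)
  ?(u1, u2, u3, u4, v1, v2, v3, v4) -/dd; ring.
Qed.

End Tau.

(** * Integration of the system for tau on a ball *)

Section Integrate.
Variables (R : realType) (x0 : 'rV[R]_4) (rho : R).
Let A : set 'rV[R]_4 := ball x0 rho.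
Implicit Types (F : 'rV[R]_4 -> R) (x v : 'rV[R]_4).

Let oA : open A. Proof. exact: ball_open. Qed.

Lemma ev_sum v : v = v 0 x0i *: ev R x0i + v 0 y0i *: ev R y0i
  + (v 0 x1i *: ev R x1i + v 0 y1i *: ev R y1i).
Proof.
apply/rowP; elim/ord4P; elim/ord2P; rewrite !mxE /= ?(mulr0, mulr1, addr0, add0r) //.
Qed.

Lemma derive_grad4 F x v a b c e : smooth_on A F -> A x -> grad4 F x a b c e ->
  'D_v F x = v 0 x0i * a + v 0 y0i * b + (v 0 x1i * c + v 0 y1i * e).
Proof.
move=> sF Ax [<- <- <- <-].
have Z (l : R) w : 'D_(l *: w) F x = l * 'D_w F x.
  have Dw : is_derive x w F ('D_w F x).
    by apply: derivableP; exact: smooth_on_derivable sF Ax.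
  by have [_ ->] := is_derive_scale l Dw.
rewrite {1}[v]ev_sum !(C1_deriveD _ _ oA Ax (sF 1%N)) !Z.
by [].
Qed.

Lemma grad4_cst F : smooth_on A F -> (forall x, A x -> grad4 F x 0 0 0 0) ->
  forall x, A x -> F x = F x0.
Proof.
move=> sF gF x Ax.
apply: (@derive0_cst _ _ A) => [t /andP[t0 t1]|z v Az].
  move: Ax; rewrite /A -!ball_normE /= opprD addrCA subrr addr0 normrN normrZ ger0_norm//.
  by rewrite distrC; apply: le_lt_trans; rewrite ler_piMl.
have <- : 'D_v F z = 0 by rewrite (derive_grad4 v sF Az (gF z Az)) !mulr0 !addr0.
by apply: derivableP; exact: smooth_on_derivable sF Az.
Qed.

(** A quadratic polynomial without constant term; its mixed products are only those between the two
    complex coordinates, as in |w|^2 and the products of w_0 with the conjugate of w_1. *)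
Definition quad (l1 l2 l3 l4 n1 n2 n3 n4 k1 k2 k3 k4 : R) (y : 'rV[R]_4) : R :=
  l1 * y 0 x0i + l2 * y 0 y0i + l3 * y 0 x1i + l4 * y 0 y1i
  + (n1 * (y 0 x0i * y 0 x0i) + n2 * (y 0 y0i * y 0 y0i)
     + n3 * (y 0 x1i * y 0 x1i) + n4 * (y 0 y1i * y 0 y1i))
  + (k1 * (y 0 x0i * y 0 x1i) + k2 * (y 0 y0i * y 0 y1i)
     + k3 * (y 0 x0i * y 0 y1i) + k4 * (y 0 y0i * y 0 x1i)).

Lemma is_derive_coord (i : 'I_4) x v :
  is_derive x v (fun y : 'rV[R]_4 => y 0 i) (v 0 i).
Proof.
have dI : derivable (id : 'rV[R]_4 -> 'rV[R]_4) x v by exact: derivable_id.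
have := derive_mx dI; rewrite derive_id => /rowP/(_ i) e.
split; last by rewrite [RHS]e mxE.
by move/derivable_mxP: dI => /(_ 0 i).
Qed.

Lemma smooth_coord (i : 'I_4) : smooth_on A (fun y : 'rV[R]_4 => y 0 i).
Proof.
move=> n; apply: (@Ck_on_lin _ _ n A _ (fun v => v 0 i)); first exact: coord_continuous.
by move=> x v; exact: is_derive_coord.
Qed.

Lemma is_derive_quad l1 l2 l3 l4 n1 n2 n3 n4 k1 k2 k3 k4 x v :
  is_derive x v (quad l1 l2 l3 l4 n1 n2 n3 n4 k1 k2 k3 k4)
    (v 0 x0i * (l1 + 2 * n1 * x 0 x0i + k1 * x 0 x1i + k3 * x 0 y1i)
     + v 0 y0i * (l2 + 2 * n2 * x 0 y0i + k2 * x 0 y1i + k4 * x 0 x1i)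
     + v 0 x1i * (l3 + 2 * n3 * x 0 x1i + k1 * x 0 x0i + k4 * x 0 y0i)
     + v 0 y1i * (l4 + 2 * n4 * x 0 y1i + k2 * x 0 y0i + k3 * x 0 x0i)).
Proof.
have C i := is_derive_coord i x v.
have L l i := is_derive_mul (is_derive_cst l x v) (C i).
have M l i j := is_derive_mul (is_derive_cst l x v) (is_derive_mul (C i) (C j)).
have := is_derive_add (is_derive_add
  (is_derive_add (is_derive_add (is_derive_add (L l1 x0i) (L l2 y0i)) (L l3 x1i)) (L l4 y1i))
  (is_derive_add (is_derive_add (is_derive_add (M n1 x0i x0i) (M n2 y0i y0i)) (M n3 x1i x1i))
    (M n4 y1i y1i)))
  (is_derive_add (is_derive_add (is_derive_add (M k1 x0i x1i) (M k2 y0i y1i)) (M k3 x0i y1i))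
    (M k4 y0i x1i)).
by move=> [d1 d2]; split; [exact: d1|rewrite d2 /cst; ring].
Qed.

Lemma smooth_quad l1 l2 l3 l4 n1 n2 n3 n4 k1 k2 k3 k4 :
  smooth_on A (quad l1 l2 l3 l4 n1 n2 n3 n4 k1 k2 k3 k4).
Proof.
have C l : smooth_on A (fun _ => l) by move=> n; exact: Ck_on_cst.
have X := smooth_coord.
by do !(apply: smooth_add => //); apply: smooth_mul => //; exact: smooth_mul.
Qed.

Lemma integrate_quad F l1 l2 l3 l4 n1 n2 n3 n4 k1 k2 k3 k4 : smooth_on A F ->
  (forall x, A x -> grad4 F x
    (l1 + 2 * n1 * x 0 x0i + k1 * x 0 x1i + k3 * x 0 y1i)
    (l2 + 2 * n2 * x 0 y0i + k2 * x 0 y1i + k4 * x 0 x1i)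
    (l3 + 2 * n3 * x 0 x1i + k1 * x 0 x0i + k4 * x 0 y0i)
    (l4 + 2 * n4 * x 0 y1i + k2 * x 0 y0i + k3 * x 0 x0i)) ->
  exists c, forall x, A x -> F x = c + quad l1 l2 l3 l4 n1 n2 n3 n4 k1 k2 k3 k4 x.
Proof.
move=> sF gF; pose Q := quad l1 l2 l3 l4 n1 n2 n3 n4 k1 k2 k3 k4.
exists (F x0 - Q x0) => x Ax.
have sH : smooth_on A (fun y => F y + - Q y).
  by apply: smooth_add => //; apply: smooth_opp => //; exact: smooth_quad.
rewrite -[F x](subrK (Q x)); congr (_ + _).
apply: (grad4_cst sH) Ax => z Az.
have DH v : 'D_v (fun y => F y + - Q y) z = 0.
  have DF : is_derive z v F ('D_v F z).
    by apply: derivableP; exact: smooth_on_derivable sF Az.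
  have [_ ->] := is_derive_add DF (is_derive_opp (is_derive_quad l1 l2 l3 l4 n1 n2 n3 n4 k1 k2 k3 k4 z v)).
  by rewrite (derive_grad4 v sF Az (gF z Az)); ring.
by split.
Qed.

(** The components of r integrate to β + m w with β = (b1 + i e1, b2 + i e2), and tau to a constant
    plus w β^* + β w^* + m w w^*, written out in real coordinates. *)
Lemma tau_integrate (TA TB TP TQ r1 c1 r2 c2 : 'rV[R]_4 -> R) (m : R) :
  smooth_on A TA -> smooth_on A TB -> smooth_on A TP -> smooth_on A TQ ->
  smooth_on A r1 -> smooth_on A c1 -> smooth_on A r2 -> smooth_on A c2 ->
  (forall x, A x -> tau_grads TA TB TP TQ x (r1 x) (c1 x) (r2 x) (c2 x)) ->
  (forall x, A x -> grad4 r1 x m 0 0 0) -> (forall x, A x -> grad4 c1 x 0 m 0 0) ->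
  (forall x, A x -> grad4 r2 x 0 0 m 0) -> (forall x, A x -> grad4 c2 x 0 0 0 m) ->
  exists a b p q b1 e1 b2 e2 m : R, forall y, A y ->
    [/\ TA y = a + quad (2 * b1) (2 * e1) 0 0 m m 0 0 0 0 0 0 y,
        TB y = b + quad 0 0 (2 * b2) (2 * e2) 0 0 m m 0 0 0 0 y,
        TP y = p + quad b2 e2 b1 e1 0 0 0 0 m m 0 0 y
      & TQ y = q + quad (- e2) b2 e1 (- b1) 0 0 0 0 0 0 (- m) m y].
Proof.
move=> sA sB sP sQ sr1 sc1 sr2 sc2 G G1 G2 G3 G4.
have I F l1 l2 l3 l4 n1 n2 n3 n4 k1 k2 k3 k4 f1 f2 f3 f4 : smooth_on A F ->
    (forall x, A x -> grad4 F x (f1 x) (f2 x) (f3 x) (f4 x)) ->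
    (forall x, A x -> [/\ f1 x = l1 + 2 * n1 * x 0 x0i + k1 * x 0 x1i + k3 * x 0 y1i,
      f2 x = l2 + 2 * n2 * x 0 y0i + k2 * x 0 y1i + k4 * x 0 x1i,
      f3 x = l3 + 2 * n3 * x 0 x1i + k1 * x 0 x0i + k4 * x 0 y0i
      & f4 x = l4 + 2 * n4 * x 0 y1i + k2 * x 0 y0i + k3 * x 0 x0i]) ->
    exists c, forall x, A x -> F x = c + quad l1 l2 l3 l4 n1 n2 n3 n4 k1 k2 k3 k4 x.
  move=> sF gF e; apply: (integrate_quad sF) => x Ax.
  by have := gF x Ax; have [-> -> -> ->] := e x Ax.
have q0 := (mulr0, mul0r, addr0, add0r).
have [b1 r1E] : exists c, forall x, A x -> r1 x = c + quad m 0 0 0 0 0 0 0 0 0 0 0 x.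
  by apply: I sr1 G1 _ => x _; rewrite !q0.
have [e1 c1E] : exists c, forall x, A x -> c1 x = c + quad 0 m 0 0 0 0 0 0 0 0 0 0 x.
  by apply: I sc1 G2 _ => x _; rewrite !q0.
have [b2 r2E] : exists c, forall x, A x -> r2 x = c + quad 0 0 m 0 0 0 0 0 0 0 0 0 x.
  by apply: I sr2 G3 _ => x _; rewrite !q0.
have [e2 c2E] : exists c, forall x, A x -> c2 x = c + quad 0 0 0 m 0 0 0 0 0 0 0 0 x.
  by apply: I sc2 G4 _ => x _; rewrite !q0.
have GA x : A x -> grad4 TA x (2 * r1 x) (2 * c1 x) 0 0 by case/G.
have GB x : A x -> grad4 TB x 0 0 (2 * r2 x) (2 * c2 x) by case/G.
have GP x : A x -> grad4 TP x (r2 x) (c2 x) (r1 x) (c1 x) by case/G.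
have GQ x : A x -> grad4 TQ x (- c2 x) (r2 x) (c1 x) (- r1 x) by case/G.
have [a aE] : exists c, forall x, A x -> TA x = c + quad (2 * b1) (2 * e1) 0 0 m m 0 0 0 0 0 0 x.
  apply: I sA GA _ => x Ax; rewrite (r1E x Ax) (c1E x Ax) /quad; split; ring.
have [b bE] : exists c, forall x, A x -> TB x = c + quad 0 0 (2 * b2) (2 * e2) 0 0 m m 0 0 0 0 x.
  apply: I sB GB _ => x Ax; rewrite (r2E x Ax) (c2E x Ax) /quad; split; ring.
have [p pE] : exists c, forall x, A x -> TP x = c + quad b2 e2 b1 e1 0 0 0 0 m m 0 0 x.
  apply: I sP GP _ => x Ax.
  rewrite (r1E x Ax) (c1E x Ax) (r2E x Ax) (c2E x Ax) /quad; split; ring.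
have [q qE] : exists c, forall x, A x -> TQ x = c + quad (- e2) b2 e1 (- b1) 0 0 0 0 0 0 (- m) m x.
  apply: I sQ GQ _ => x Ax.
  rewrite (r1E x Ax) (c1E x Ax) (r2E x Ax) (c2E x Ax) /quad; split; ring.
by exists a, b, p, q, b1, e1, b2, e2, m => y Ay; split; [exact: aE|exact: bE|exact: pE|exact: qE].
Qed.

(** Each entry of tau gives relations between derivatives of r by exchanging two directions;
    together they leave a single function [mu] on the diagonal, which is then seen to be
    constant. *)
Lemma tau_solve (TA TB TP TQ : 'rV[R]_4 -> R) :
  smooth_on A TA -> smooth_on A TB -> smooth_on A TP -> smooth_on A TQ ->
  (forall x, A x -> exists r1 c1 r2 c2, tau_grads TA TB TP TQ x r1 c1 r2 c2) ->
  exists a b p q b1 e1 b2 e2 m : R, forall y, A y ->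
    [/\ TA y = a + quad (2 * b1) (2 * e1) 0 0 m m 0 0 0 0 0 0 y,
        TB y = b + quad 0 0 (2 * b2) (2 * e2) 0 0 m m 0 0 0 0 y,
        TP y = p + quad b2 e2 b1 e1 0 0 0 0 m m 0 0 y
      & TQ y = q + quad (- e2) b2 e1 (- b1) 0 0 0 0 0 0 (- m) m y].
Proof.
move=> sA sB sP sQ sys.
pose X := ev R x0i; pose Y := ev R y0i; pose U := ev R x1i; pose W := ev R y1i.
(* The off-diagonal entry [TP] alone contains all four components of r among its derivatives. *)
pose r1 := 'D_U TP; pose c1 := 'D_W TP; pose r2 := 'D_X TP; pose c2 := 'D_Y TP.
have G x : A x -> tau_grads TA TB TP TQ x (r1 x) (c1 x) (r2 x) (c2 x).
  move=> Ax; have [r [c [r' [c' h]]]] := sys x Ax.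
  by have [_ _ [e1 e2 e3 e4] _] := h; rewrite /r1 /c1 /r2 /c2 e1 e2 e3 e4.
have sr1 : smooth_on A r1 by exact: smooth_on_derive.
have sc1 : smooth_on A c1 by exact: smooth_on_derive.
have sr2 : smooth_on A r2 by exact: smooth_on_derive.
have sc2 : smooth_on A c2 by exact: smooth_on_derive.
have sw F u v x : smooth_on A F -> A x -> 'D_u ('D_v F) x = 'D_v ('D_u F) x.
  by move=> sF Ax; exact: (Schwarz u v oA Ax (sF 2%N)).
have dE (F H : 'rV[R]_4 -> R) (l : R) v x : smooth_on A H ->
    (forall y, A y -> F y = l * H y) -> A x -> 'D_v F x = l * 'D_v H x.
  move=> sH e Ax; have DH : is_derive x v H ('D_v H x).
    by apply: derivableP; exact: smooth_on_derivable sH Ax.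
  have [_ E] := is_derive_mul (is_derive_cst l x v) DH.
  rewrite mulr0 addr0 in E; apply: etrans E; apply: near_eq_derive.
  by apply: filterS (open_near oA Ax) => y /e.
have d0 F v x : (forall y, A y -> F y = 0) -> A x -> 'D_v F x = 0.
  move=> e Ax; rewrite -[RHS](derive_cst (0 : R) x v); apply: near_eq_derive.
  by apply: filterS (open_near oA Ax) => y /e.
have dX F H v x (l : R) : l != 0 -> smooth_on A H -> A x ->
    (forall y, A y -> F y = l * H y) -> 'D_v F x = 0 -> 'D_v H x = 0.
  move=> l0 sH Ax e; rewrite (dE F H l)// => /eqP.
  by rewrite mulf_eq0 (negPf l0) => /eqP.
have n2 : (2 : R) != 0 by rewrite pnatr_eq0.
have gA y : A y -> [/\ 'D_X TA y = 2 * r1 y, 'D_Y TA y = 2 * c1 y, 'D_U TA y = 0 & 'D_W TA y = 0].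
  by move=> /G[].
have gB y : A y -> [/\ 'D_X TB y = 0, 'D_Y TB y = 0, 'D_U TB y = 2 * r2 y & 'D_W TB y = 2 * c2 y].
  by move=> /G[].
have gQ y : A y -> [/\ 'D_X TQ y = -1 * c2 y, 'D_Y TQ y = 1 * r2 y,
    'D_U TQ y = 1 * c1 y & 'D_W TQ y = -1 * r1 y].
  by rewrite !mul1r !mulN1r => /G[].
have gA1 y : A y -> 'D_X TA y = 2 * r1 y by case/gA.
have gA2 y : A y -> 'D_Y TA y = 2 * c1 y by case/gA.
have gA3 y : A y -> 'D_U TA y = 0 by case/gA.
have gA4 y : A y -> 'D_W TA y = 0 by case/gA.
have gB1 y : A y -> 'D_X TB y = 0 by case/gB.
have gB2 y : A y -> 'D_Y TB y = 0 by case/gB.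
have gB3 y : A y -> 'D_U TB y = 2 * r2 y by case/gB.
have gB4 y : A y -> 'D_W TB y = 2 * c2 y by case/gB.
have gQ1 y : A y -> 'D_X TQ y = -1 * c2 y by case/gQ.
have gQ2 y : A y -> 'D_Y TQ y = 1 * r2 y by case/gQ.
have gQ3 y : A y -> 'D_U TQ y = 1 * c1 y by case/gQ.
have gQ4 y : A y -> 'D_W TQ y = -1 * r1 y by case/gQ.
have s0 F u v x : smooth_on A F -> (forall y, A y -> 'D_v F y = 0) -> A x ->
    'D_v ('D_u F) x = 0.
  by move=> sF e Ax; apply: etrans (sw F v u x sF Ax) _; exact: d0 e Ax.
have z x : A x -> [/\ 'D_U r1 x = 0, 'D_W r1 x = 0, 'D_U c1 x = 0 & 'D_W c1 x = 0].
  move=> Ax; split.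
  - exact: (dX _ _ _ _ _ n2 sr1 Ax gA1 (s0 TA X U x sA gA3 Ax)).
  - exact: (dX _ _ _ _ _ n2 sr1 Ax gA1 (s0 TA X W x sA gA4 Ax)).
  - exact: (dX _ _ _ _ _ n2 sc1 Ax gA2 (s0 TA Y U x sA gA3 Ax)).
  - exact: (dX _ _ _ _ _ n2 sc1 Ax gA2 (s0 TA Y W x sA gA4 Ax)).
have z' x : A x -> [/\ 'D_X r2 x = 0, 'D_Y r2 x = 0, 'D_X c2 x = 0 & 'D_Y c2 x = 0].
  move=> Ax; split.
  - exact: (dX _ _ _ _ _ n2 sr2 Ax gB3 (s0 TB U X x sB gB1 Ax)).
  - exact: (dX _ _ _ _ _ n2 sr2 Ax gB3 (s0 TB U Y x sB gB2 Ax)).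
  - exact: (dX _ _ _ _ _ n2 sc2 Ax gB4 (s0 TB W X x sB gB1 Ax)).
  - exact: (dX _ _ _ _ _ n2 sc2 Ax gB4 (s0 TB W Y x sB gB2 Ax)).
have off4 (a b c e : R) : 2 * a = 2 * b -> c = b -> e = a -> 1 * b = -1 * e ->
    [/\ a = 0, b = 0, c = 0 & e = 0] by move=> *; split; lra.
have mI (a b : R) : 1 * a = 1 * b -> a = b by rewrite !mul1r.
(* [TA] and [TP] make these four derivatives equal, while [TQ] makes two of them opposite. *)
have off x : A x -> [/\ 'D_Y r1 x = 0, 'D_X c1 x = 0, 'D_W r2 x = 0 & 'D_U c2 x = 0].
  move=> Ax.
  have e1 : 2 * 'D_Y r1 x = 2 * 'D_X c1 x.
    have f1 := dE _ _ _ Y x sr1 gA1 Ax.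
    have f2 := dE _ _ _ X x sc1 gA2 Ax.
    exact: etrans (etrans (esym f1) (sw TA Y X x sA Ax)) f2.
  have e2 : 'D_W r2 x = 'D_X c1 x by exact: (sw TP W X x sP Ax).
  have e3 : 'D_U c2 x = 'D_Y r1 x by exact: (sw TP U Y x sP Ax).
  have e4 : 1 * 'D_X c1 x = -1 * 'D_U c2 x.
    have f1 := dE _ _ _ X x sc1 gQ3 Ax.
    have f2 := dE _ _ _ U x sc2 gQ1 Ax.
    exact: etrans (etrans (esym f1) (sw TQ X U x sQ Ax)) f2.
  exact: off4 e1 e2 e3 e4.
have [mu muE] : exists mu, mu = 'D_X r1 by exists ('D_X r1).
have smu : smooth_on A mu by rewrite muE; exact: smooth_on_derive.
have dg x : A x -> [/\ 'D_U r2 x = mu x, 'D_Y c1 x = mu x & 'D_W c2 x = mu x].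
  move=> Ax.
  have e1 : 'D_U r2 x = mu x by rewrite muE; exact: (sw TP U X x sP Ax).
  have e2 : 'D_W c2 x = 'D_Y c1 x by exact: (sw TP W Y x sP Ax).
  have e3 : 1 * 'D_Y c1 x = 1 * 'D_U r2 x.
    have f1 := dE _ _ _ Y x sc1 gQ3 Ax.
    have f2 := dE _ _ _ U x sr2 gQ2 Ax.
    exact: etrans (etrans (esym f1) (sw TQ Y U x sQ Ax)) f2.
  have e4 : 'D_Y c1 x = mu x := etrans (mI _ _ e3) e1.
  exact: And3 e1 e4 (etrans e2 e4).
(* In the direction [X] the expression ['D_U r2] of [mu] is used, since ['D_X r2] vanishes; in the
   other directions ['D_X r1] is used. *)
have mu0 x : A x -> grad4 mu x 0 0 0 0.
  move=> Ax; split.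
  - have f1 : 'D_X mu x = 'D_X ('D_U r2) x.
      apply: near_eq_derive; apply: filterS (open_near oA Ax) => y Ay.
      by have [h _ _] := dg y Ay; exact: esym h.
    have z1 y : A y -> 'D_X r2 y = 0 by case/z'.
    exact: etrans f1 (s0 r2 U X x sr2 z1 Ax).
  - have z1 y : A y -> 'D_Y r1 y = 0 by case/off.
    rewrite muE; exact: (s0 r1 X Y x sr1 z1 Ax).
  - have z1 y : A y -> 'D_U r1 y = 0 by case/z.
    rewrite muE; exact: (s0 r1 X U x sr1 z1 Ax).
  - have z1 y : A y -> 'D_W r1 y = 0 by case/z.
    rewrite muE; exact: (s0 r1 X W x sr1 z1 Ax).
pose m := mu x0.
have mE x : A x -> mu x = m by move=> Ax; exact: grad4_cst.
have G1 x : A x -> grad4 r1 x m 0 0 0.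
  move=> Ax; have [h1 h2 _ _] := z x Ax; have [h3 _ _ _] := off x Ax.
  exact: And4 (etrans (esym (congr1 (@^~ x) muE)) (mE x Ax)) h3 h1 h2.
have G2 x : A x -> grad4 c1 x 0 m 0 0.
  move=> Ax; have [_ _ h1 h2] := z x Ax; have [_ h3 _ _] := off x Ax.
  have [_ h4 _] := dg x Ax; exact: And4 h3 (etrans h4 (mE x Ax)) h1 h2.
have G3 x : A x -> grad4 r2 x 0 0 m 0.
  move=> Ax; have [h1 h2 _ _] := z' x Ax; have [_ _ h3 _] := off x Ax.
  have [h4 _ _] := dg x Ax; exact: And4 h1 h2 (etrans h4 (mE x Ax)) h3.
have G4 x : A x -> grad4 c2 x 0 0 0 m.
  move=> Ax; have [_ _ h1 h2] := z' x Ax; have [_ _ _ h3] := off x Ax.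
  have [_ _ h4] := dg x Ax; exact: And4 h1 h2 h3 (etrans h4 (mE x Ax)).
exact: (tau_integrate sA sB sP sQ sr1 sc1 sr2 sc2 G G1 G2 G3 G4).
Qed.

End Integrate.

(** * Recovering the hermitian matrix *)

Section LocalMetric.
Variable R : realType.
Implicit Types (C : 'M[R[i]]_3) (k : 'I_3) (x y : 'rV[R]_4).

Lemma gC_entries C k x (al be p q d : R) :
  chartH C k (toC x) 0 0 = al%:C%C -> chartH C k (toC x) 1 1 = be%:C%C ->
  chartH C k (toC x) 0 1 = (p +i* q)%C -> chartH C k (toC x) 1 0 = (p +i* - q)%C ->
  dform C (affpt k x) = d%:C%C ->
  [/\ gC C k x x0i x0i = - be / d ^+ 2, gC C k x x1i x1i = - al / d ^+ 2,
      gC C k x x0i x1i = p / d ^+ 2 & gC C k x x0i y1i = - q / d ^+ 2].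
Proof.
move=> h00 h11 h01 h10 hd.
have tE (a b : 'I_4) : gC C k x a b = complex.Re (nform C (ins3 k 1 (toC x))
    (ins3 k 0 (toC (ev R a))) (ins3 k 0 (toC (ev R b))) * ((d ^+ 2)^-1)%:C%C).
  by rewrite mxE /gmet hd -rmorphXn -fmorphV.
have dE i j : (delta_mx 0 i : 'rV[R[i]]_2) 0 j = (i == j)%:R by rewrite mxE eq_sym.
have d00 : (delta_mx 0 0 : 'rV[R[i]]_2) 0 0 = 1 by rewrite dE.
have d01 : (delta_mx 0 0 : 'rV[R[i]]_2) 0 1 = 0 by rewrite dE.
have d10 : (delta_mx 0 1 : 'rV[R[i]]_2) 0 0 = 0 by rewrite dE.
have d11 : (delta_mx 0 1 : 'rV[R[i]]_2) 0 1 = 1 by rewrite dE.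
have e0 : toC (ev R x0i) = delta_mx 0 0 by exact: toC_ev.
have e1 : toC (ev R x1i) = delta_mx 0 1 by exact: toC_ev.
have f1 : toC (ev R y1i) = 'i%C *: delta_mx 0 1.
  by rewrite -evJ1 mulJE toC_cact e1.
have v00 : toC (ev R x0i) 0 0 = 1 by rewrite e0.
have v01 : toC (ev R x0i) 0 1 = 0 by rewrite e0.
have v10 : toC (ev R x1i) 0 0 = 0 by rewrite e1.
have v11 : toC (ev R x1i) 0 1 = 1 by rewrite e1.
have w10 : toC (ev R y1i) 0 0 = 0 by rewrite f1 mxE d10 mulr0.
have w11 : toC (ev R y1i) 0 1 = 'i%C by rewrite f1 mxE d11 mulr1.
have ci : ('i%C : R[i])^* = - 'i%C.
  by apply: complex_eqP; rewrite ?cReJ ?cImJ ?cReN ?cImN /= ?oppr0.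
split; rewrite tE nform_chart h00 h11 h01 h10 ?(v00, v01, v10, v11, w10, w11);
  move: ((d ^+ 2)^-1) => z; rewrite ?ci ?conjC0 ?conjC1 ?(mulr0, mulr1, mul0r)
  ?(subr0, sub0r, add0r, addr0) ?(cReM, cImM, cReN, cImN) /=; ring.
Qed.

(* The hermitian matrix whose chartH is minus the polynomial matrix found by
   integration. *)
Definition chart_matrix k (m a b : R) (b0 b1 c : R[i]) : 'M[R[i]]_3 :=
  let v (j : 'I_2) := if j == 0 then b0 else b1 in
  \matrix_(i, j) match unlift k i, unlift k j with
    | None, None => (- m)%:C%C
    | None, Some j => (v j)^*
    | Some i, None => v i
    | Some i, Some j =>
      if i == j then if i == 0 then (- a)%:C%C else (- b)%:C%C
      else if i == 0 then - c else - c^*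
    end.

Lemma chart_matrix_hermitian k m a b b0 b1 c : hermitian3 (chart_matrix k m a b b0 b1 c).
Proof.
apply/matrixP => i j; rewrite !mxE.
case: (unliftP k i) => [i' _|_]; case: (unliftP k j) => [j' _|_]; rewrite ?conjCK ?conjR//.
by move: i' j'; elim/ord2P; elim/ord2P; rewrite /= ?conjR// rmorphN /= ?conjCK.
Qed.

Lemma chartH_chart_matrix k (m a b p q b1 e1 b2 e2 : R) y :
  let H := chartH (chart_matrix k m a b (b1 +i* e1)%C (b2 +i* e2)%C (p +i* q)%C) k (toC y) in
  let P := p + quad b2 e2 b1 e1 0 0 0 0 m m 0 0 y in
  let Q := q + quad (- e2) b2 e1 (- b1) 0 0 0 0 0 0 (- m) m y in
  [/\ H 0 0 = (- (a + quad (2 * b1) (2 * e1) 0 0 m m 0 0 0 0 0 0 y))%:C%C,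
      H 1 1 = (- (b + quad 0 0 (2 * b2) (2 * e2) 0 0 m m 0 0 0 0 y))%:C%C,
      H 0 1 = (- P +i* - Q)%C & H 1 0 = (- P +i* - - Q)%C].
Proof.
move=> H P Q.
have w0 : toC y 0 0 = (y 0 x0i +i* y 0 y0i)%C by exact: toCE.
have w1 : toC y 0 1 = (y 0 x1i +i* y 0 y1i)%C by exact: toCE.
pose C := chart_matrix k m a b (b1 +i* e1)%C (b2 +i* e2)%C (p +i* q)%C.
have HE i j : H i j = C (lift k i) (lift k j) - toC y 0 i * C k (lift k j)
    - (toC y 0 j)^* * C (lift k i) k + toC y 0 i * (toC y 0 j)^* * C k k by rewrite mxE.
have Ck : C k k = (- m)%:C%C by rewrite mxE unlift_none.
have Cr j : C k (lift k j) = (if j == 0 then (b1 +i* e1)%C else (b2 +i* e2)%C)^*.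
  by rewrite mxE unlift_none liftK.
have Cl j : C (lift k j) k = if j == 0 then (b1 +i* e1)%C else (b2 +i* e2)%C.
  by rewrite mxE unlift_none liftK.
have Cc i j : C (lift k i) (lift k j) =
    if i == j then if i == 0 then (- a)%:C%C else (- b)%:C%C
    else if i == 0 then - (p +i* q)%C else - (p +i* q)%C^* by rewrite mxE !liftK.
rewrite /P /Q /quad; split; rewrite HE Ck !Cr !Cl Cc ?w0 ?w1 /=;
  move: {w0 w1 P Q HE Ck Cr Cl Cc H C} (y 0 x0i) (y 0 y0i) (y 0 x1i) (y 0 y1i) => u0 v0 u1 v1;
  apply: complex_eqP; rewrite !(cReD, cImD, cReN, cImN, cReM, cImM, cReJ, cImJ) /=; ring.
Qed.

End LocalMetric.

Section LocalHermitian.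
Variable R : realType.
Implicit Types (G : 'M[R]_4) (k : 'I_3) (x y : 'rV[R]_4).

Lemma sum4E (V : nmodType) (F : 'I_4 -> V) :
  \sum_i F i = F x0i + F x1i + (F y0i + F y1i).
Proof. by rewrite (@big_split_ord _ _ _ 2 2) /= !sum2E. Qed.

Lemma ord4_basis (P : 'I_4 -> Prop) : P x0i -> P x1i -> P y0i -> P y1i -> forall i, P i.
Proof. by move=> h1 h2 h3 h4; elim/ord4P; elim/ord2P. Qed.

Lemma hermitian_eq G G' : G^T = G ->
  (forall u v, bil G (u *m Jmx R) (v *m Jmx R) = bil G u v) -> G'^T = G' ->
  (forall u v, bil G' (u *m Jmx R) (v *m Jmx R) = bil G' u v) ->
  G x0i x0i = G' x0i x0i -> G x1i x1i = G' x1i x1i ->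
  G x0i x1i = G' x0i x1i -> G x0i y1i = G' x0i y1i -> G = G'.
Proof.
move=> GS GJ GS' GJ' h1 h2 h3 h4; have E := hermitian_entries GS GJ.
have E' := hermitian_entries GS' GJ'.
by apply/matrixP; elim/ord4_basis; elim/ord4_basis; rewrite ?E ?E' ?h1 ?h2 ?h3 ?h4.
Qed.

(** If the determinant vanishes, a row of the 2 × 2 adjugate lies in the kernel, hence is zero; then
    the second basis vector lies in the kernel. *)
Lemma hermitian_det_neq0 G : G^T = G ->
  (forall u v, bil G (u *m Jmx R) (v *m Jmx R) = bil G u v) -> G \in unitmx ->
  G x0i x0i * G x1i x1i - (G x0i x1i * G x0i x1i + G x0i y1i * G x0i y1i) != 0.
Proof.
move=> GS GJ GU; have E := hermitian_entries GS GJ; apply/eqP => d0.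
have ker (u : 'rV[R]_4) : u *m G = 0 -> u = 0.
  by move=> uG; rewrite -[u](mulmxK GU) uG mul0mx.
pose u : 'rV[R]_4 := G x1i x1i *: ev R x0i - G x0i x1i *: ev R x1i - G x0i y1i *: ev R y1i.
have ux0 : u 0 x0i = G x1i x1i by rewrite !mxE /= ?(mulr0, mulr1) ?subr0.
have ux1 : u 0 x1i = - G x0i x1i by rewrite !mxE /= ?(mulr0, mulr1) ?subr0 ?sub0r.
have uy0 : u 0 y0i = 0 by rewrite !mxE /= ?(mulr0, mulr1) ?subr0.
have uy1 : u 0 y1i = - G x0i y1i by rewrite !mxE /= ?(mulr0, mulr1) ?subr0 ?sub0r.
have /rowP u0 : u = 0.
  apply: ker; apply/rowP => j; rewrite mxE sum4E ux0 ux1 uy0 uy1 [RHS]mxE.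
  move: j; elim/ord4_basis; rewrite ?E; [rewrite -[RHS]d0|..]; ring.
have := u0 x0i; rewrite ux0 mxE => z2.
have := u0 x1i; rewrite ux1 mxE => /eqP; rewrite oppr_eq0 => /eqP zs.
have := u0 y1i; rewrite uy1 mxE => /eqP; rewrite oppr_eq0 => /eqP zt.
have /rowP/(_ x1i) : ev R x1i = 0.
  apply: ker; apply/rowP; rewrite -rowE; elim/ord4_basis; by rewrite !mxE ?E ?z2 ?zs ?zt ?oppr0.
by rewrite !mxE eqxx => /eqP; rewrite oner_eq0.
Qed.

Lemma local_hermitian U (g : cotensor2 R) k (x0 : 'rV[R]_4) (rho : R) : open U ->
  pseudo_kahler U g -> compatible U g -> ball x0 rho `<=` chart_img U k ->
  exists2 C : 'M[R[i]]_3, hermitian3 C &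
    forall y, ball x0 rho y -> dform C (affpt k y) != 0 /\ g k y = gC C k y.
Proof.
move=> oU [_ pk] cg AU; set A := ball x0 rho.
have oA : open A by exact: ball_open.
have [sgU gP] := pk k.
have sg : smooth_on A (g k) by move=> n; apply: Ck_on_sub (sgU n).
have gS y : A y -> (g k y)^T = g k y by move=> /AU /gP[].
have gU y : A y -> g k y \in unitmx by move=> /AU /gP[].
have gJ y : A y -> forall u v, bil (g k y) (u *m Jmx R) (v *m Jmx R) = bil (g k y) u v.
  by move=> /AU /gP[].
have [cl tf _] := cg.
have LJ x u v : A x -> levi_civita g k x u (v *m Jmx R) = levi_civita g k x u v *m Jmx R.
  by move=> /AU; exact: cl.
have LS x u v : A x -> levi_civita g k x u v = levi_civita g k x v u.
  by move=> /AU; exact: tf.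
have LW x u : A x -> wedge3_eq0 (levi_civita g k x u u) u (u *m Jmx R).
  by move=> /AU; exact: compatible_line.
have MS x := metric_system oA sg gS gU gJ LJ LS LW (x := x).
pose s1 y := g k y x0i x0i; pose s2 y := g k y x1i x1i.
pose s y := g k y x0i x1i; pose t y := g k y x0i y1i.
have S1 : smooth_on A s1 by exact: smooth_entry.
have S2 : smooth_on A s2 by exact: smooth_entry.
have S : smooth_on A s by exact: smooth_entry.
have T : smooth_on A t by exact: smooth_entry.
have h0 y : A y -> hdet s1 s2 s t y != 0.
  by move=> Ay; exact: hermitian_det_neq0 (gS y Ay) (gJ y Ay) (gU y Ay).
have SN : smooth_on A (fun y => - s y) by exact: smooth_opp.
have W := smooth_weight oA S1 S2 S T h0.
have TS x (Ax : A x) := tau_system oA S1 S2 S T h0 Ax (MS x Ax).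
have [a [b [p [q [b1 [e1 [b2 [e2 [m tE]]]]]]]]] :=
  tau_solve (W _ S2) (W _ S1) (W _ SN) (W _ T) TS.
exists (chart_matrix k m a b (b1 +i* e1)%C (b2 +i* e2)%C (p +i* q)%C).
  exact: chart_matrix_hermitian.
move=> y Ay; have [EA EB EP EQ] := tE y Ay.
have [H00 H11 H01 H10] := chartH_chart_matrix k m a b p q b1 e1 b2 e2 y.
rewrite -EA in H00; rewrite -EB in H11; rewrite -EP -EQ in H01 H10.
have c3 := icroot3 (h0 y Ay).
move: H00 H11 H01 H10 c3; set C := chart_matrix _ _ _ _ _ _ _.
have hC : hermitian3 C by exact: chart_matrix_hermitian.
set d := icroot _ => H00 H11 H01 H10 c3.
have d0 : d != 0.
  by apply: contra_eq_neq c3 => ->; rewrite expr0n mul0r eq_sym oner_eq0.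
have dE : dform C (affpt k y) = d%:C%C.
  rewrite -[affpt k y]/(ins3 k 1 (toC y)) dform_chart H00 H11 H01 H10.
  (* The determinant of tau is d^4 times that of the hermitian matrix of g, which is d because d^3
     times the latter is 1. *)
  have dd : d = d ^+ 3 * hdet s1 s2 s t y * d by rewrite c3 mul1r.
  rewrite [in RHS]dd /hdet; move: (s1 y) (s2 y) (s y) (t y) {H00 H11 H01 H10 c3 d0 dd} d => *.
  by apply: complex_eqP; rewrite !(cReD, cImD, cReN, cImN, cReM, cImM) /=; ring.
split.
  by rewrite dE; apply: contra_neq d0 => /(congr1 (@complex.Re R)).
have [g1 g2 g3 g4] := gC_entries H00 H11 H01 H10 dE.
apply: hermitian_eq (gS y Ay) (gJ y Ay) (gC_sym hC k y) _ _ _ _ _ => [u v||||].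
- exact: gC_J.
- by rewrite g1 -/(s1 y); field.
- by rewrite g2 -/(s2 y); field.
- by rewrite g3 -/(s y); field.
- by rewrite g4 -/(t y); field.
Qed.

End LocalHermitian.

(** * The metric on an open set determines the matrix *)

Section LocalUniqueness.
Variable R : realType.
Implicit Types (C : 'M[R[i]]_3) (k : 'I_3) (x y : 'rV[R]_4).

Lemma cube_inj (a b : R) : a ^+ 3 = b ^+ 3 -> a = b.
Proof.
move=> e; apply/eqP; rewrite -subr_eq0; apply: contra_eqT e => ab.
rewrite -subr_eq0 (_ : _ - _ = (a - b) * ((a + b / 2) ^+ 2 + 3 / 4 * b ^+ 2)); last by field.
rewrite mulf_neq0// gt_eqF//.
have [b0|b0] := eqVneq b 0; last first.
  have : 0 < b ^+ 2 by rewrite exprn_even_gt0.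
  have := sqr_ge0 (a + b / 2); lra.
by move: ab; rewrite b0 !subr0 mul0r addr0 expr0n mulr0 addr0 => a0; rewrite exprn_even_gt0.
Qed.

Lemma chartH_hermitian C k (w : 'rV[R[i]]_2) i j : hermitian3 C ->
  (chartH C k w i j)^* = chartH C k w j i.
Proof.
move=> hC; have hE a b : (C a b)^* = C b a by rewrite [in RHS]hC !mxE.
by rewrite !mxE !(rmorphD, rmorphN, rmorphM) /= !conjCK !hE; ring.
Qed.

Lemma conj_real (z : R[i]) : z^* = z -> z = (complex.Re z)%:C%C.
Proof.
move=> e; apply: complex_eqP => //=; have := congr1 (@complex.Im R) e.
rewrite cImJ; lra.
Qed.

Lemma chartH_data C k y : hermitian3 C -> exists al be p q d : R,
  let H := chartH C k (toC y) in
  [/\ H = \matrix_(i, j) (if i == 0 then if j == 0 then al%:C%C else (p +i* q)%C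
                          else if j == 0 then (p +i* - q)%C else be%:C%C),
      dform C (affpt k y) = d%:C%C, d = al * be - (p * p + q * q)
    & (gC C k y x0i x0i = - be / d ^+ 2) * (gC C k y x1i x1i = - al / d ^+ 2)
      * (gC C k y x0i x1i = p / d ^+ 2) * (gC C k y x0i y1i = - q / d ^+ 2)].
Proof.
move=> hC; pose H := chartH C k (toC y).
have h00 := conj_real (chartH_hermitian k (toC y) 0 0 hC).
have h11 := conj_real (chartH_hermitian k (toC y) 1 1 hC).
have h10 := chartH_hermitian k (toC y) 0 1 hC.
have [p [q h01]] : exists p q, H 0 1 = (p +i* q)%C by case: (H 0 1) => p q; exists p, q.
rewrite -[chartH _ _ _]/H h01 in h10.
exists (complex.Re (H 0 0)), (complex.Re (H 1 1)), p, q.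
exists (complex.Re (H 0 0) * complex.Re (H 1 1) - (p * p + q * q)) => /=.
have hd : dform C (affpt k y) = (complex.Re (H 0 0) * complex.Re (H 1 1) - (p * p + q * q))%:C%C.
  rewrite -[affpt k y]/(ins3 k 1 (toC y)) dform_chart -/H -h10 h00 h11 h01 -/H.
  by apply: complex_eqP; rewrite !(cReD, cImD, cReN, cImN, cReM, cImM, cReJ, cImJ) /=; ring.
have h10' : H 1 0 = (p +i* - q)%C.
  by rewrite -h10; apply: complex_eqP; rewrite ?cReJ ?cImJ.
have [g1 g2 g3 g4] := gC_entries h00 h11 h01 h10' hd.
split=> //.
by apply/matrixP; elim/ord2P; elim/ord2P; rewrite [RHS]mxE /= -?h01 -?h10' -/H.
Qed.

(** The hermitian matrix of the metric has determinant d^(-3), which gives the real number [d];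
    multiplying the entries by d^2 then gives those of the block H. *)
Lemma chartH_inj C C' k y : hermitian3 C -> hermitian3 C' ->
  dform C (affpt k y) != 0 -> dform C' (affpt k y) != 0 ->
  gC C k y = gC C' k y -> chartH C k (toC y) = chartH C' k (toC y).
Proof.
move=> hC hC' d0 d0' gE.
have [al [be [p [q [d [-> hd dE g]]]]]] := chartH_data k y hC.
have [al' [be' [p' [q' [d' [-> hd' dE' g']]]]]] := chartH_data k y hC'.
have e1 := g.1.1.1; have e2 := g.1.1.2; have e3 := g.1.2; have e4 := g.2.
rewrite !gE !g' in e1 e2 e3 e4.
have n0 : d != 0 by apply: contraNneq d0 => z; rewrite hd z.
have n0' : d' != 0 by apply: contraNneq d0' => z; rewrite hd' z.
have dd : d = d'.
  apply/invr_inj/cube_inj.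
  have -> : d^-1 ^+ 3 = (- be / d ^+ 2) * (- al / d ^+ 2) - (p / d ^+ 2 * (p / d ^+ 2)
      + (- q / d ^+ 2) * (- q / d ^+ 2)).
    transitivity (d / d ^+ 4); first by field.
    by rewrite {1}dE; field.
  rewrite -e1 -e2 -e3 -e4; transitivity (d' / d' ^+ 4); last by field.
  by rewrite [X in _ = X / _]dE'; field.
have dn : (d ^+ 2)^-1 != 0 by rewrite invr_eq0 expf_neq0.
rewrite -dd in e1 e2 e3 e4.
have /oppr_inj -> := mulIf dn e1; have /oppr_inj -> := mulIf dn e2.
by have -> := mulIf dn e3; have /oppr_inj -> := mulIf dn e4.
Qed.

(** The blocks H of the two matrices agree on [A], so their difference is a polynomial in w and its
    conjugate that vanishes there; finite differences inside [A] extract its coefficients. *)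
Lemma gC_inj C C' k (A : set 'rV[R]_4) x : open A -> A x ->
  hermitian3 C -> hermitian3 C' ->
  (forall y, A y -> [/\ dform C (affpt k y) != 0, dform C' (affpt k y) != 0
    & gC C k y = gC C' k y]) -> C = C'.
Proof.
move=> oA Ax hC hC' H.
have HE y : A y -> chartH C k (toC y) = chartH C' k (toC y).
  by move=> /H[*]; exact: chartH_inj.
have step v : exists2 e : R, e != 0 & A (e *: v + x) /\ A (- e *: v + x).
  have : \forall t \near (0 : R), A (t *: v + x) /\ A (- t *: v + x).
    have n1 w : \forall t \near (0 : R), A (t *: w + x).
      apply: (@open_near _ _ [set t : R | A (t *: w + x)]); last by rewrite /= scale0r add0r.
      by move/continuousP: (@line_continuous _ _ x w); apply.
    by apply: filterS2 (n1 v) (n1 (- v)) => t; rewrite scaleNr scalerN.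
  move=> /nbhs_ballP[e /= e0 he]; exists (e / 2); first by rewrite gt_eqF ?divr_gt0.
  by apply: he; rewrite -ball_normE /= sub0r normrN ger0_norm ?divr_ge0 ?(ltW e0)//; lra.
pose D := C - C'.
pose f i j (w : 'rV[R[i]]_2) := D (lift k i) (lift k j) - w 0 i * D k (lift k j)
  - (w 0 j)^* * D (lift k i) k + w 0 i * (w 0 j)^* * D k k.
have f0 y i j : A y -> f i j (toC y) = 0.
  have DE a b : D a b = C a b - C' a b by rewrite !mxE.
  move=> /HE/matrixP/(_ i j); rewrite [LHS]mxE [RHS]mxE => /eqP; rewrite -subr_eq0 => /eqP <-.
  by rewrite /f !DE; ring.
have [e e0 [ep en]] := step (ev R x0i).
have [e' e0' [ep' _]] := step (ev R x1i).
have tC (l : R) v j : toC (l *: v + x) 0 j = l%:C%C * toC v 0 j + toC x 0 j.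
  by rewrite !toCE !mxE; apply: complex_eqP; rewrite !(cReD, cImD, cReM, cImM) /=; ring.
have t00 : toC (ev R x0i) 0 0 = 1 by rewrite (toC_ev R 0) mxE.
have t01 : toC (ev R x0i) 0 1 = 0 by rewrite (toC_ev R 0) mxE.
have t10 : toC (ev R x1i) 0 0 = 0 by rewrite (toC_ev R 1) mxE.
have t11 : toC (ev R x1i) 0 1 = 1 by rewrite (toC_ev R 1) mxE.
have c0 : e%:C%C != 0 :> R[i] by apply: contra_neq e0 => /(congr1 (@complex.Re R)).
have c0' : e'%:C%C != 0 :> R[i] by apply: contra_neq e0' => /(congr1 (@complex.Re R)).
have Dkk : D k k = 0.
  have := f0 _ 0 0 ep; have := f0 _ 0 0 en; have := f0 x 0 0 Ax.
  rewrite /f !tC !t00 !mulr1 !(rmorphD, rmorphN) /= !conjR.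
  move: (toC x 0 0) (toC x 0 0)^* (e%:C%C) c0 => w wb ee c0 h1 h2 h3.
  (* The second difference along x_0 removes the constant and linear terms. *)
  have /eqP : 2 * ee * ee * D k k = 0.
    rewrite -[RHS](subrr (0 : R[i])) -{1}[0](addr0 (0 : R[i])) -[X in _ = _ - X](mulr0 2).
    rewrite -[X in _ = X + _ - _]h3 -[X in _ = _ + X - _]h2 -[X in _ = _ - 2 * X]h1; ring.
  by rewrite !mulf_eq0 !(negPf c0) pnatr_eq0 => /eqP.
(* With the quadratic coefficient gone, a first difference that moves w_j and fixes w_j' isolates
   one coefficient. *)
have Dk (j j' : 'I_2) (l : R) v : l%:C%C != 0 :> R[i] -> A (l *: v + x) ->
    toC v 0 j = 1 -> toC v 0 j' = 0 -> D k (lift k j') = 0.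
  move=> l0 Al v1 v0; have := f0 _ j j' Al; have := f0 x j j' Ax.
  rewrite /f !tC v0 v1 !mulr1 mulr0 add0r Dkk !mulr0 !addr0.
  move: (toC x 0 j) (toC x 0 j')^* (l%:C%C) l0 => w wb ee l0 h1 h2.
  have /eqP : - ee * D k (lift k j') = 0.
    by rewrite -[RHS](subrr (0 : R[i])) -[X in _ = X - _]h2 -[X in _ = _ - X]h1; ring.
  by rewrite mulf_eq0 oppr_eq0 (negPf l0) => /eqP.
have Dk1 : D k (lift k 1) = 0 by exact: Dk c0 ep t00 t01.
have Dk0 : D k (lift k 0) = 0 by exact: Dk c0' ep' t11 t10.
have Dkl j : D k (lift k j) = 0 by move: j; elim/ord2P.
have hD a b : (D a b)^* = D b a.
  by rewrite /D {2}hC {2}hC' !mxE rmorphB.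
have Dlk j : D (lift k j) k = 0 by rewrite -hD Dkl conjC0.
have Dll i j : D (lift k i) (lift k j) = 0.
  by have := f0 x i j Ax; rewrite /f Dkl Dlk Dkk !mulr0 !subr0 addr0.
apply/eqP; rewrite -subr_eq0 -/D; apply/eqP/matrixP => a b; rewrite [RHS]mxE.
by case: (unliftP k a) => [a' ->|->]; case: (unliftP k b) => [b' ->|->].
Qed.

End LocalUniqueness.

(** * From local matrices to one matrix on a connected set *)

Section Globalize.
Variables (R : realType) (U : set (CP2 R)) (g : cotensor2 R).
Implicit Types (C : 'M[R[i]]_3) (k : 'I_3) (p : CP2 R) (x y : 'rV[R]_4).

Definition agrees C p := dform C (hcoord p) != 0 /\
  forall k, chart_dom k p -> g k (chart k p) = gC C k (chart k p).

(** Both tensors obey the same transformation law, so equality in one chart at a point implies it in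
    every chart there. *)
Lemma agrees_chart C k p : is_cotensor2 U g -> U p -> chart_dom k p ->
  dform C (affpt k (chart k p)) != 0 -> g k (chart k p) = gC C k (chart k p) ->
  agrees C p.
Proof.
move=> cg Up pk dC gE; split=> [|j pj].
  by rewrite -(chartK pk) dform_hcoord.
have Ux : chart_img U j (chart j p) by rewrite /chart_img /= chartK.
have dk : chart_dom k (chart_inv j (chart j p)) by rewrite chartK.
rewrite (cg j k _ Ux dk) (gC_cotensor2 C Ux dk).
by rewrite /transition chartK// gE.
Qed.

Lemma agrees_inj C C' (V : set (CP2 R)) p : open V -> V p ->
  hermitian3 C -> hermitian3 C' -> (forall q, V q -> agrees C q /\ agrees C' q) -> C = C'.
Proof.
move=> oV Vp hC hC' H; have [k pk] := exists_chart p.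
have Vk : chart_img V k (chart k p) by rewrite /chart_img /= chartK.
apply: (gC_inj (chart_img_open oV) Vk hC hC').
move=> y Vy; have [[d e] [d' e']] := H (chart_inv k y) Vy.
have ky := chart_dom_inv k y; have {}e := e k ky; have {}e' := e' k ky.
rewrite chart_invK in e e'; split; last exact: etrans (esym e) e'.
  by rewrite -dform_hcoord; exact: d.
by rewrite -dform_hcoord; exact: d'.
Qed.

Lemma agrees_local p : open U -> pseudo_kahler U g -> compatible U g -> U p ->
  exists C V, [/\ hermitian3 C, open V, V p, V `<=` U & forall q, V q -> agrees C q].
Proof.
move=> oU pk cg Up; have [k kp] := exists_chart p.
have Ux : chart_img U k (chart k p) by rewrite /chart_img /= chartK.
have : nbhs (chart k p) (chart_img U k) by exact: open_near (chart_img_open oU) Ux.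
move=> /nbhs_ballP[rho /= rho0 sub].
have [C hC CE] := local_hermitian oU pk cg sub.
exists C, [set q | chart_dom k q /\ ball (chart k p) rho (chart k q)]; split=> //.
- by apply: open_chart; exact: ball_open.
- by split; [|exact: ballxx].
- by move=> q [qk /sub]; rewrite /chart_img /= chartK.
move=> q [qk qb]; have [d e] := CE _ qb; have Uq : U q by rewrite -(chartK qk); exact: sub.
exact: agrees_chart (pk.1) Uq qk d e.
Qed.

(** Fix the matrix found near one point and let [B] be the set of points having a neighbourhood in
    [U] on which it agrees with [g]. This set is open, nonempty and relatively closed in [U]. *)
Lemma agrees_global : domain U -> pseudo_kahler U g -> compatible U g ->
  exists2 C, hermitian3 C & forall p, U p -> agrees C p.
Proof.
move=> [oU cU [p0 Up0]] pk cg.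
have [C [V0 [hC oV0 V0p V0U V0C]]] := agrees_local oU pk cg Up0; exists C => //.
pose B := [set p | exists V, [/\ open V, V p, V `<=` U & forall q, V q -> agrees C q]].
have BU : B `<=` U by move=> p [V [_ Vp VU _]]; exact: VU.
have oB : open B.
  rewrite openE => p [V [oV Vp VU VC]]; apply: filterS (open_nbhs_nbhs (conj oV Vp)) => q Vq.
  by exists V.
have oUB : open (U `\` B).
  rewrite openE => p [Up nBp].
  have [C' [V [hC' oV Vp VU VC']]] := agrees_local oU pk cg Up.
  apply: filterS (open_nbhs_nbhs (conj oV Vp)) => q Vq; split; first exact: VU.
  move=> [W [oW Wq WU WC]]; apply: nBp; exists V.
  (* If a neighbourhood of a point outside [B] met [B], uniqueness on the overlap would identify its
     matrix with [C] and put the point in [B]. *)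
  suff <- : C' = C by [].
  have oVW : open (V `&` W) by exact: openI.
  apply: (agrees_inj oVW (conj Vq Wq) hC' hC) => r [Vr Wr].
  exact: conj (VC' r Vr) (WC r Wr).
have BE : B = U.
  apply: cU.
  - by exists p0, V0.
  - by exists B => //; rewrite setIC; apply/esym/setIidl.
  - exists (~` (U `\` B)); first exact: open_closedC.
    by rewrite setDE setCI setCK setIUr setICr set0U; apply/esym/setIidr.
by move=> p; rewrite -BE => -[V [_ Vp _ VC]]; exact: VC.
Qed.

End Globalize.

Theorem corollary3p1 (R : realType) :
  (forall (U : set (CP2 R)) (g : cotensor2 R),
     domain U -> pseudo_kahler U g -> compatible U g ->
     exists! C : 'M[R[i]]_3,
       [/\ hermitian3 C, (2 <= \rank C)%N & induced_by U g C]) /\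
  (forall C : 'M[R[i]]_3, hermitian3 C -> (2 <= \rank C)%N ->
     exists (U : set (CP2 R)) (g : cotensor2 R),
       [/\ domain U, pseudo_kahler U g, compatible U g & induced_by U g C]).
Proof.
split=> [U g dU pk cg|C]; last exact: exists_metric.
have [C hC CE] := agrees_global dU pk cg; have [oU _ [p Up]] := dU.
have ind : induced_by U g C by apply: induced_by_of => // q /CE.
exists C; split=> [|C' [hC' _ ind']].
  by split=> //; have [/dform_rank] := CE p Up.
(* Uniqueness is decided in a single chart around one point of [U]. *)
have [k pk'] := exists_chart p.
have Uk : chart_img U k (chart k p) by rewrite /chart_img /= chartK.
apply: (gC_inj (chart_img_open oU) Uk hC hC').
move=> y Uy; have [d e] := induced_by_at hC ind Uy.
have [d' e'] := induced_by_at hC' ind' Uy.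
by split; [exact: d|exact: d'|exact: etrans (esym e) e'].
Qed.
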